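(* Let $\mathcal{M}$ be a non-empty class of metric spaces and let $(\mathbf{G}_m)_{m\in\mathbb{N}}$ be a sequence in $\mathcal{G}(k)$, where $k\in\mathbb{N}_{\geq 1}$. (i)(1) Assume that all $\mathbf{G}_m$, $m\in\mathbb{N}$, are finite. Then for every $q\in[1,\infty)$: if $\bigsqcup_{m\in\mathbb{N}}\mathrm{Cay}(\mathbf{G}_m)$ admits a fibred coarse embedding into $\mathcal{M}$ as a disjoint union, then $\partial_{\mathrm{Cay}}(\mathbf{G}_m)_{m\in\mathbb{N}}$ is uniformly a-$\mathcal{F}_q(\mathcal{M})$-menable. Moreover, for every $q\in[1,\infty)$, $$\mathcal{CP}_{\mathcal{M}}^{\mathrm{fib}}\Big(\bigsqcup_{m}\mathrm{Cay}(\mathbf{G}_m)\Big)\subseteq \bigcap_{\mathbf{G}_{\infty}\in \partial_{\mathrm{Cay}}(\mathbf{G}_m)_m}\mathcal{CP}^{\sharp}_{\mathcal{F}_q(\mathcal{M})}(\mathbf{G}_{\infty}).$$ (i)(2) Assume that all $\mathbf{G}_m$, $m\in\mathbb{N}$, are amenable. Assume moreover that either (a) there exists $q\in(1,\infty)$ such that for every $M\in\mathcal{M}$ there exists an element $L$ of $\mathcal{F}_q(M)=\mathcal{F}_q(\{M\})$ that is uniquely geodesic (and $\mathcal{FS}_q(\mathcal{M})$ is defined), or (b) the class $\mathcal{M}$ consists only of Banach spaces (with no restriction on $q\in[1,\infty)$). Then for every $q$ as in (a) in the first case (respectively, for every $q\in[1,\infty)$ in the second case): if $\bigsqcup_{m\in\mathbb{N}}\mathrm{Cay}(\mathbf{G}_m)$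 admits a fibred coarse embedding into $\mathcal{M}$ as a disjoint union, then $\partial_{\mathrm{Cay}}(\mathbf{G}_m)_{m\in\mathbb{N}}$ is uniformly a-$\mathcal{FS}_q(\mathcal{M})$-menable. Moreover, for every such $q$, $$\mathcal{CP}_{\mathcal{M}}^{\mathrm{fib}}\Big(\bigsqcup_{m}\mathrm{Cay}(\mathbf{G}_m)\Big)\subseteq \bigcap_{\mathbf{G}_{\infty}\in \partial_{\mathrm{Cay}}(\mathbf{G}_m)_m}\mathcal{CP}^{\sharp}_{\mathcal{FS}_q(\mathcal{M})}(\mathbf{G}_{\infty}).$$ (ii) For every $q\in[1,\infty)$: if $\partial_{\mathrm{Cay}}(\mathbf{G}_m)_{m\in\mathbb{N}}$ is uniformly a-$\mathcal{M}$-menable, then $\bigsqcup_{m\in\mathbb{N}}\mathrm{Cay}(\mathbf{G}_m)$ admits a fibred coarse embedding into $\ell_q(\mathcal{M})$ as a disjoint union. Moreover, for every $q\in[1,\infty)$, $$\bigcap_{\mathbf{G}_{\infty}\in \partial_{\mathrm{Cay}}(\mathbf{G}_m)_m}\mathcal{CP}^{\sharp}_{\mathcal{M}}(\mathbf{G}_{\infty})\subseteq \mathcal{CP}_{\ell_q(\mathcal{M})}^{\mathrm{fib}}\Big(\bigsqcup_{m}\mathrm{Cay}(\mathbf{G}_m)\Big).$$ If $(\mathbf{G}_m)_{m\in\mathbb{N}}$ is a convergent sequence with Cayley limit $\mathbf{G}_\infty$, then $\ell_q(\mathcal{M})$ may be replaced with the original class $\mathcal{M}$ in these assertions; in that case $$\mathcal{CP}^{\sharp}_{\mathcal{M}}(\mathbf{G}_{\infty})\subseteq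 \mathcal{CP}_{\mathcal{M}}^{\mathrm{fib}}\Big(\bigsqcup_{m}\mathrm{Cay}(\mathbf{G}_m)\Big).$$
   Context: Metric spaces are non-empty; isometries (of a space onto a space) are surjective; geodesics are minimal (isometric embeddings of intervals). A function $[0,\infty)\to[0,\infty)$ is proper if it tends to $+\infty$ at $+\infty$. **Marked groups.** A $k$-marked group $\mathbf{G}=(G;s_1,\dots,s_k)$ is a group $G$ with an ordered $k$-tuple generating $G$ as a group, up to isomorphisms preserving the ordered tuples. $\mathrm{Cay}(\mathbf{G})$ is the graph with vertex set $G$ and edges joining $g$ and $s_jg$; $d_{\mathbf{G}}$ is its shortest path metric on $G$ (the right-invariant word metric). $\mathcal{G}(k)$ is the set of all $k$-marked groups; identifying $\mathbf{G}$ with the kernel of $F_k\to G$, $a_j\mapsto s_j$ ($F_k$ free on $a_1,\dots,a_k$), the Cayley topology is the one induced from the product topology on $\{0,1\}^{F_k}$; it is compact and metrizable. A marked group is finite/amenable if its underlying group is. $\partial_{\mathrm{Cay}}(\mathbf{G}_m)_m$ is the set of accumulation points of $(\mathbf{G}_m)_m$ (limits of subsequences) in $\mathcal{G}(k)$. **Disjoint union.** For metric spaces $(X_m,d_m)_{m\in\mathbb{N}}$, $\bigsqcup_m X_m$ carries the generalized metric equal to $d_m$ on $X_m$ and $+\infty$ between different components. Cayley graphs are regarded as the vertex sets with $d_{\mathbf{G}_m}$. **Fibred coarse embeddings.** Let $X=\bigsqcup_mX_m$ with $(X_m)_m$ equi-uniformly locally finite (for every $R$, closed $R$-balls have cardinality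 bounded by a constant independent of center and $m$), with metric $d$, and let $\rho,\omega:[0,\infty)\to[0,\infty)$ be non-decreasing proper. $X$ admits a $(\rho,\omega)$-fibred coarse embedding into $\mathcal{M}$ as a disjoint union if there are $M\in\mathcal{M}$, a field $(M_x)_{x\in X}$ of metric spaces each isometric to $M$, and a section $s$ with $s(x)\in M_x$, such that for every $R\ge0$ there is $m^{(R)}\in\mathbb{N}_{\ge1}$ such that each non-empty $C\subseteq X\setminus\bigsqcup_{m<m^{(R)}}X_m$ of diameter at most $R$ has a trivialization $t_{C,R}$, i.e. isometries $t_{C,R}(x):M_x\to M$ ($x\in C$), with (1) $\rho(d(x_1,x_2))\le d_M(t_{C,R}(x_1)(s(x_1)),t_{C,R}(x_2)(s(x_2)))\le\omega(d(x_1,x_2))$ for all $x_1,x_2\in C$; (2) for any two such $C_1,C_2$ with $C_1\cap C_2\neq\emptyset$ there is an isometry $t_{C_1,C_2,R}:M\to M$ with $t_{C_1,R}(x)\circ t_{C_2,R}(x)^{-1}=t_{C_1,C_2,R}$ for all $x\in C_1\cap C_2$. (Trivializations for different $R$ need not be compatible. If $\mathcal{M}$ consists of Banach spaces, these isometries are assumed affine.) $\mathcal{CP}^{\mathrm{fib}}_{\mathcal{M}}(X)$ is the set of all such $(\rho,\omega)$; $X$ admits a fibred coarse embedding into $\mathcal{M}$ as a disjoint union if this set is non-empty. **Equivariant embeddings.** $\mathcal{CP}^\sharp_{\mathcal{M}}(\mathbf{G})$ is the set of pairs $(\rho,\omega)$ of non-decreasing proper functions $[0,\infty)\to[0,\infty)$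 for which there are $M\in\mathcal{M}$, a right action $\alpha$ of $G$ on $M$ by isometries, and $y\in M$ with $\rho(d_{\mathbf{G}}(g,h))\le d_M(y\cdot\alpha(g),y\cdot\alpha(h))\le\omega(d_{\mathbf{G}}(g,h))$ for all $g,h\in G$. A non-empty $K\subseteq\mathcal{G}(k)$ is uniformly a-$\mathcal{M}$-menable if $\bigcap_{\mathbf{G}\in K}\mathcal{CP}^\sharp_{\mathcal{M}}(\mathbf{G})\neq\emptyset$. **Products and ultraproducts.** For pointed metric spaces $(M_j,d_j,y_j)_{j\in B}$ ($B$ non-empty, at most countable), $r_j>0$ and $q\in[1,\infty)$, $(\prod_{j\in B}(M_j,y_j,r_j))_{\ell_q}$ is the set of $(z_j)_j$ with $\sum_j(r_jd_j(z_j,y_j))^q<\infty$, with metric $(\sum_j(r_jd_j(z_j,w_j))^q)^{1/q}$; base points are omitted if $B$ is finite, and the $r_j$ are omitted if all equal $1$. For a non-principal ultrafilter $\mathcal{U}$ on $\mathbb{N}$, the pointed metric ultraproduct $\lim_{\mathcal{U}}(M_m,y_m)$ is the quotient of $\{(z_m)_m:\sup_md_m(z_m,y_m)<\infty\}$ by the pseudometric $\lim_{\mathcal{U}}d_m(z_m,w_m)$, with the induced metric. **Operations on classes** (all up to isometry, base points forgotten). $\mathcal{F}_q(\mathcal{M})$: all $\lim_{\mathcal{U}}(N_m,y_m)$, where a single $M\in\mathcal{M}$ is chosen, $N_m=(\prod_{f\in F^{(m)}}(M,\sharp(F^{(m)})^{-1/q}))_{\ell_q}$ for finite non-empty sets $F^{(m)}$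 with $\sharp(F^{(m)})\to\infty$, $y_m\in N_m$, and $\mathcal{U}$ is a non-principal ultrafilter on $\mathbb{N}$. $\mathcal{FS}_q(\mathcal{M})$ is defined only if every element of $\mathcal{F}_q(\mathcal{M})$ is a geodesic space. If $\mathcal{M}$ consists only of Banach spaces, it is the class of Banach spaces isometrically affinely isomorphic to non-empty closed affine subspaces of elements of $\mathcal{F}_q(\mathcal{M})$; otherwise it is the class of metric spaces isometric to non-empty closed geodesically convex subsets $L_0$ (every geodesic of $L$ between points of $L_0$ lies in $L_0$), with induced metric, of elements $L\in\mathcal{F}_q(\mathcal{M})$. $\ell_q(\mathcal{M})$: all $(\prod_{j\in B}(M_j,y_j))_{\ell_q}$ with $B$ non-empty at most countable, $M_j\in\mathcal{M}$, $y_j\in M_j$. A metric space is geodesic if any two points are joined by a geodesic, and uniquely geodesic if this geodesic is always unique. *)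

(* Defs.v *)
From HB Require Import structures.
From mathcomp Require Import all_boot all_order all_algebra finmap.
From mathcomp Require Import all_classical all_reals all_analysis.

Set Implicit Arguments.
Unset Strict Implicit.
Unset Printing Implicit Defensive.

Import Order.TTheory GRing.Theory Num.Theory.
Import numFieldNormedType.Exports.

Local Open Scope classical_set_scope.
Local Open Scope ring_scope.

Definition banach_metric (R : realType) (V : completeNormedModType R) : Type := V.

Section BanachMetric.
Context (R : realType) (V : completeNormedModType R).

HB.instance Definition _ := PseudoMetric.copy (banach_metric V) V.

Let dist (x y : V) : R := `|x - y|.

Let dist_ge0 x y : 0 <= dist x y.
Proof. exact: normr_ge0. Qed.

Let dist_positivity x y : dist x y = 0 -> x = y.
Proof. by move/normr0_eq0/eqP; rewrite subr_eq0 => /eqP. Qed.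

Let ball_dist (x : banach_metric V) d : ball x d = [set y | dist x y < d].
Proof. by rewrite -ball_normE. Qed.

HB.instance Definition _ := @PseudoMetric_isMetric.Build R (banach_metric V)
  dist dist_ge0 dist_positivity ball_dist.

End BanachMetric.

(* [BanachSpaces] is for classes consisting only of Banach spaces;
   [MetricSpaces] is the remaining case, in which a linear structure on a member
   of the class is ignored. *)
Variant space_kind := MetricSpaces | BanachSpaces.

Definition kspace (R : realType) (K : space_kind) : Type :=
  match K with
  | MetricSpaces => metricType R
  | BanachSpaces => completeNormedModType R
  end.

Definition carrier (R : realType) (K : space_kind) : kspace R K -> metricType R :=
  match K with
  | MetricSpaces => fun M => M
  | BanachSpaces => fun V => banach_metric V : metricType R
  end.
Coercion carrier : kspace >-> Metric.type.

(* Not [set (kspace R K)]: the universe of [set] is below that of [metricType]. *)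
Definition space_class (R : realType) (K : space_kind) : Type := kspace R K -> Prop.

Definition is_isometry (R : realType) (M N : metricType R) (f : M -> N) : Prop :=
  (forall x y, mdist (f x) (f y) = mdist x y) /\ (forall y, exists x, f x = y).

(* On the domain [D] of families of points, [f] respects the coordinatewise
   affine combinations; no condition for metric spaces. *)
Definition affine_on (R : realType) (K : space_kind) :
    forall (J : Type) (A : J -> kspace R K) (B : kspace R K),
      set (forall j, A j) -> ((forall j, A j) -> B) -> Prop :=
  match K with
  | MetricSpaces => fun _ _ _ _ _ => True
  | BanachSpaces => fun J (A : J -> completeNormedModType R)
      (B : completeNormedModType R) (D : set (forall j, A j))
      (f : (forall j, A j) -> B) =>
      forall (t : R) (z w : forall j, A j), D z -> D w ->
        f (fun j => t *: z j + (1 - t) *: w j) = t *: f z + (1 - t) *: f w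
  end.

Definition affine_map (R : realType) (K : space_kind) :
    forall A B : kspace R K, (A -> B) -> Prop :=
  match K with
  | MetricSpaces => fun _ _ _ => True
  | BanachSpaces => fun (A B : completeNormedModType R) (f : A -> B) =>
      forall (t : R) (x y : A),
        f (t *: x + (1 - t) *: y) = t *: f x + (1 - t) *: f y
  end.

Definition space_iso (R : realType) (K : space_kind) (A B : kspace R K)
    (f : A -> B) : Prop := is_isometry f /\ affine_map f.

(* The letter (j, false) stands for a_j and (j, true) for its inverse. *)
Definition word (k : nat) : Type := seq ('I_k * bool).

Definition eval_letter (k : nat) (G : groupType) (s : 'I_k -> G)
    (a : 'I_k * bool) : G := if a.2 then ((s a.1)^-1)%g else s a.1.

Definition eval_word (k : nat) (G : groupType) (s : 'I_k -> G) (w : word k) : G :=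
  foldr (fun a g => (eval_letter s a * g)%g) 1%g w.

Record marked_group (k : nat) := MarkedGroup {
  mg_group :> groupType;
  mg_gen : 'I_k -> mg_group;
  mg_gen_surj : forall g : mg_group, exists w : word k, eval_word mg_gen w = g
}.
Arguments mg_gen {k} G : rename.
Arguments mg_gen_surj {k} G : rename.

(* The free group on a_1, ..., a_k as the set of reduced words. *)
Definition reduced (k : nat) (w : word k) : bool :=
  sorted (fun a b : 'I_k * bool => (a.1 == b.1) ==> (a.2 == b.2)) w.

Definition free_group (k : nat) : Type := {w : word k | reduced w}.

Definition mg_kernel (k : nat) (G : marked_group k) : {ptws free_group k -> bool} :=
  fun w => `[< eval_word (mg_gen G) (val w) = 1%g >].

Definition cay_cvg (k : nat) (G : nat -> marked_group k) (H : marked_group k) : Prop :=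
  mg_kernel (G m) @[m --> \oo] --> mg_kernel H.

(* Marked groups are meant up to marked isomorphism: every predicate on
   [marked_group k] used here is invariant under it. *)
Definition cay_boundary (k : nat) (G : nat -> marked_group k)
    (H : marked_group k) : Prop :=
  exists n : nat -> nat,
    {homo n : i j / (i < j)%N} /\ cay_cvg (fun i => G (n i)) H.

Definition finite_group (G : groupType) : Prop := finite_set [set: G].

(* Amenability of a discrete group, as the Folner condition for left
   translations. *)
Definition amenable (R : realType) (G : groupType) : Prop :=
  forall (S : {fset G}) (e : R), 0 < e ->
    exists F : {fset G}, F != fset0 /\
      forall s, s \in S ->
        let sF := [fset (s * x)%g | x in F]%fset in
        #|` (sF `\` F) `|` (F `\` sF)|%fset%:R <= e * #|` F|%fset%:R.

Section CayleyGraph.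
Context (k : nat) (G : marked_group k).

Definition cay_adj (g h : G) : bool :=
  [exists j : 'I_k, (h == (mg_gen G j * g)%g) || (g == (mg_gen G j * h)%g)].

Definition cay_walk (g h : G) (n : nat) : Prop :=
  exists p : seq G, [/\ path cay_adj g p, last g p = h & size p = n].

Lemma cay_adj_sym g h : cay_adj g h = cay_adj h g.
Proof. by apply: eq_existsb => j; rewrite orbC. Qed.

Lemma cay_walk0 g : cay_walk g g 0.
Proof. by exists [::]. Qed.

Lemma cay_walkD g h l m n :
  cay_walk g h m -> cay_walk h l n -> cay_walk g l (m + n).
Proof.
move=> [p [p1 p2 p3]] [q [q1 q2 q3]]; exists (p ++ q).
by rewrite cat_path p1 p2 q1 last_cat p2 q2 size_cat p3 q3.
Qed.

Lemma cay_walk1 g h : cay_adj g h -> cay_walk g h 1.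
Proof. by move=> gh; exists [:: h]; rewrite /= gh. Qed.

Lemma cay_walk_sym g h n : cay_walk g h n -> cay_walk h g n.
Proof.
move=> [p []]; elim: p g n => [|x p IH] g n /=; first by move=> _ <- <-; exact: cay_walk0.
move=> /andP[gx xp] lp <-; rewrite -addn1; apply: (cay_walkD (IH x (size p) xp lp erefl)).
by apply: cay_walk1; rewrite cay_adj_sym.
Qed.

Lemma cay_connected g h : exists n, `[< cay_walk g h n >].
Proof.
suff H (w : word k) : exists n, cay_walk g (eval_word (mg_gen G) w * g)%g n.
  have [w wE] := mg_gen_surj G (h * g^-1)%g; have [n] := H w.
  by rewrite wE mulgVK => gh; exists n; apply/asboolP.
elim: w => [|[j b] w [n IH]] /=; first by rewrite mul1g; exists 0%N; exact: cay_walk0.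
exists (n + 1)%N; apply: (cay_walkD IH); apply: cay_walk1.
apply/existsP; exists j; rewrite /eval_letter/= -mulgA.
by case: b; rewrite ?eqxx// mulVKg eqxx orbT.
Qed.

Definition cay_dist (g h : G) : nat := ex_minn (cay_connected g h).

Lemma cay_dist_walk g h : cay_walk g h (cay_dist g h).
Proof. by rewrite /cay_dist; case: ex_minnP => n /asboolP. Qed.

Lemma cay_dist_le g h n : cay_walk g h n -> (cay_dist g h <= n)%N.
Proof. by rewrite /cay_dist; case: ex_minnP => m _ H gh; apply: H; apply/asboolP. Qed.

End CayleyGraph.

(* The vertices with the path metric; [R] only fixes where distances live. *)
Definition cayley (R : realType) (k : nat) (G : marked_group k) : Type := G.

Section CayleyMetric.
Context (R : realType) (k : nat) (G : marked_group k).

HB.instance Definition _ := Choice.on (cayley R G).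

Let dist (g h : G) : R := (cay_dist g h)%:R.

Let distxx x : dist x x = 0.
Proof. by apply/eqP; rewrite pnatr_eq0 -leqn0; apply/cay_dist_le/cay_walk0. Qed.

Let dist_positivity x y : dist x y = 0 -> x = y.
Proof.
move/eqP; rewrite pnatr_eq0 => /eqP xy.
have := cay_dist_walk x y; rewrite xy => -[p [_ lp /size0nil p0]].
by rewrite p0 in lp.
Qed.

Let dist_sym x y : dist x y = dist y x.
Proof.
by congr (_%:R); apply/eqP; rewrite eqn_leq !cay_dist_le//;
  apply/cay_walk_sym/cay_dist_walk.
Qed.

Let dist_triangle y x z : dist x z <= dist x y + dist y z.
Proof.
by rewrite -natrD ler_nat cay_dist_le//; apply: cay_walkD; apply: cay_dist_walk.
Qed.

HB.instance Definition _ := isMetric.Build R (cayley R G)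
  distxx dist_positivity dist_sym dist_triangle.

End CayleyMetric.

Definition cayleys (R : realType) (k : nat) (G : nat -> marked_group k) :
    nat -> metricType R := fun m => cayley R (G m) : metricType R.

(* Only the values on [0, +oo[ matter. *)
Definition control_fun (R : realType) (f : R -> R) : Prop :=
  [/\ (forall t, 0 <= t -> 0 <= f t),
      (forall t u, 0 <= t -> t <= u -> f t <= f u) &
      f t @[t --> +oo] --> +oo].

Definition du_dist (R : realType) (X : nat -> metricType R)
    (x y : {m : nat & X m}) : \bar R :=
  (if tag x == tag y then (mdist (tagged x) (tagged_as x y))%:E else +oo)%E.

Definition small_subset (R : realType) (X : nat -> metricType R) (r : R) (n : nat)
    (C : set {m : nat & X m}) : Prop :=
  [/\ C !=set0, (forall x, C x -> (n <= tag x)%N) &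
      (forall x y, C x -> C y -> (du_dist x y <= r%:E)%E)].

(* On a subset of finite diameter [du_dist] is finite, so [fine] is harmless.
   The condition (t C1 x) \o (t C2 x)^-1 = u is written without the inverse. *)
Definition fibred_coarse_embedding (R : realType) (K : space_kind)
    (MM : space_class R K) (X : nat -> metricType R) (rho omega : R -> R) : Prop :=
  exists (M : kspace R K) (F : {m : nat & X m} -> kspace R K) (s : forall x, F x),
    [/\ MM M, (forall x, exists f : F x -> M, space_iso f) &
    forall r : R, 0 <= r ->
      exists (n : nat) (t : set {m : nat & X m} -> forall x, F x -> M),
      [/\ (1 <= n)%N,
          (forall C, small_subset r n C -> forall x, C x -> space_iso (t C x)),
          (forall C, small_subset r n C -> forall x1 x2, C x1 -> C x2 ->
             rho (fine (du_dist x1 x2)) <= mdist (t C x1 (s x1)) (t C x2 (s x2))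
             /\ mdist (t C x1 (s x1)) (t C x2 (s x2)) <= omega (fine (du_dist x1 x2))) &
          (forall C1 C2, small_subset r n C1 -> small_subset r n C2 ->
             C1 `&` C2 !=set0 ->
             exists u : M -> M, space_iso u /\
               forall x, (C1 `&` C2) x -> forall p : F x, u (t C2 x p) = t C1 x p)]].

Definition CPfib (R : realType) (K : space_kind) (MM : space_class R K)
    (X : nat -> metricType R) : set ((R -> R) * (R -> R)) :=
  [set ro | [/\ control_fun ro.1, control_fun ro.2 &
                fibred_coarse_embedding MM X ro.1 ro.2]].

Definition admits_fibred (R : realType) (K : space_kind) (MM : space_class R K)
    (X : nat -> metricType R) : Prop := CPfib MM X !=set0.

Definition isometric_right_action (R : realType) (G : groupType) (M : metricType R)
    (alpha : M -> G -> M) : Prop :=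
  [/\ (forall y, alpha y 1%g = y),
      (forall y g h, alpha y (g * h)%g = alpha (alpha y g) h) &
      (forall g, is_isometry (fun y => alpha y g))].

Definition CPsharp (R : realType) (K : space_kind) (MM : space_class R K)
    (k : nat) (G : marked_group k) : set ((R -> R) * (R -> R)) :=
  [set ro | [/\ control_fun ro.1, control_fun ro.2 &
     exists (M : kspace R K) (alpha : M -> G -> M) (y : M),
       [/\ MM M, isometric_right_action alpha &
           forall g h : G,
             ro.1 (cay_dist g h)%:R <= mdist (alpha y g) (alpha y h) /\
             mdist (alpha y g) (alpha y h) <= ro.2 (cay_dist g h)%:R]]].

Definition CPsharp_inter (R : realType) (K : space_kind) (MM : space_class R K)
    (k : nat) (A : marked_group k -> Prop) : set ((R -> R) * (R -> R)) :=
  [set ro | forall G, A G -> CPsharp MM G ro].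

Definition uniformly_menable (R : realType) (K : space_kind) (MM : space_class R K)
    (k : nat) (A : marked_group k -> Prop) : Prop :=
  (exists G, A G) /\ CPsharp_inter MM A !=set0.

(* Products and ultraproducts are taken up to isometry: [N] is one of them when
   the relevant set of families has a distance-preserving map onto [N] (affine in
   the Banach case), i.e. when [N] is isometric to its separated quotient. *)

Definition lq_sum (R : realType) (J : countType) (M : J -> metricType R) (q : R)
    (r : J -> R) (z w : forall j, M j) : \bar R :=
  (\esum_(j in [set: J]) ((r j * mdist (z j) (w j)) `^ q)%:E)%E.

Definition lq_domain (R : realType) (J : countType) (M : J -> metricType R) (q : R)
    (r : J -> R) (y : forall j, M j) : set (forall j, M j) :=
  [set z | (lq_sum q r z y < +oo)%E].

Definition is_lq_product (R : realType) (K : space_kind) (J : countType)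
    (M : J -> kspace R K) (q : R) (r : J -> R) (D : set (forall j, M j))
    (N : kspace R K) (phi : (forall j, M j) -> N) : Prop :=
  [/\ (forall x : N, exists2 z, D z & phi z = x),
      (forall z w, D z -> D w ->
         mdist (phi z) (phi w) = (fine (lq_sum q r z w)) `^ q^-1) &
      affine_on D phi].

Definition nonprincipal (U : set_system nat) : Prop :=
  UltraFilter U /\ forall n, U <> principal_filter n.

Definition ultra_domain (R : realType) (M : nat -> metricType R)
    (y : forall m, M m) : set (forall m, M m) :=
  [set z | exists c : R, forall m, mdist (z m) (y m) <= c].

Definition is_ultraproduct (R : realType) (K : space_kind) (U : set_system nat)
    (M : nat -> kspace R K) (y : forall m, M m)
    (L : kspace R K) (pi : (forall m, M m) -> L) : Prop :=
  [/\ (forall x : L, exists2 z, ultra_domain y z & pi z = x),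
      (forall z w, ultra_domain y z -> ultra_domain y w ->
         mdist (z m) (w m) @[m --> U] --> mdist (pi z) (pi w)) &
      affine_on (ultra_domain y) pi].

(* The products over [F m] being finite, their domain is everything and no base
   point is needed. *)
Definition Fq (R : realType) (K : space_kind) (q : R) (MM : space_class R K) :
    space_class R K :=
  fun L => exists (M : kspace R K) (F : nat -> finType) (N : nat -> kspace R K)
      (phi : forall m, (F m -> M) -> N m) (y : forall m, N m) (U : set_system nat)
      (pi : (forall m, N m) -> L),
    [/\ MM M,
        (forall m, (0 < #|F m|)%N) /\ #|F m| @[m --> \oo] --> \oo,
        (forall m, is_lq_product q (fun=> #|F m|%:R `^ (- q^-1)) [set: F m -> M]
                     (phi m)),
        nonprincipal U & is_ultraproduct U y pi].

Definition lq_class (R : realType) (K : space_kind) (q : R)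
    (MM : space_class R K) : space_class R K :=
  fun L => exists (B : countType) (M : B -> kspace R K) (y : forall j, M j)
      (phi : (forall j, M j) -> L),
    [/\ inhabited B, (forall j, MM (M j)) &
        is_lq_product q (fun=> 1) (lq_domain q (fun=> 1) y) phi].

Definition is_geodesic (R : realType) (M : metricType R) (x y : M)
    (c : R -> M) : Prop :=
  [/\ c 0 = x, c (mdist x y) = y &
      forall s t : R, 0 <= s <= mdist x y -> 0 <= t <= mdist x y ->
        mdist (c s) (c t) = `|s - t|].

Definition geodesic_space (R : realType) (M : metricType R) : Prop :=
  forall x y : M, exists c, is_geodesic x y c.

Definition uniquely_geodesic (R : realType) (M : metricType R) : Prop :=
  geodesic_space M /\
  forall (x y : M) (c1 c2 : R -> M), is_geodesic x y c1 -> is_geodesic x y c2 ->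
    forall t, 0 <= t <= mdist x y -> c1 t = c2 t.

Definition geodesically_convex (R : realType) (M : metricType R) (A : set M) : Prop :=
  forall (x y : M) (c : R -> M), A x -> A y -> is_geodesic x y c ->
    forall t, 0 <= t <= mdist x y -> A (c t).

Definition affine_subspace (R : realType) (V : completeNormedModType R)
    (A : set V) : Prop :=
  forall (t : R) (x y : V), A x -> A y -> A (t *: x + (1 - t) *: y).

Definition admissible_subset (R : realType) (K : space_kind) :
    forall L : kspace R K, set L -> Prop :=
  match K with
  | MetricSpaces => fun L A => geodesically_convex A
  | BanachSpaces => fun L A => @affine_subspace R L A
  end.

Definition FSq_defined (R : realType) (K : space_kind) (q : R)
    (MM : space_class R K) : Prop := forall L, Fq q MM L -> geodesic_space L.

(* Only meaningful under [FSq_defined q MM], which always holds for Banach spaces. *)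
Definition FSq (R : realType) (K : space_kind) (q : R) (MM : space_class R K) :
    space_class R K :=
  fun L0 => exists (L : kspace R K) (A : set L) (f : L0 -> L),
    [/\ Fq q MM L,
        [/\ A !=set0, closed A & admissible_subset A],
        (forall x y, mdist (f x) (f y) = mdist x y),
        range f = A & affine_map f].

(* Main.v *)
Require Import Defs.
From HB Require Import structures.
From mathcomp Require Import all_boot all_order all_algebra finmap.
From mathcomp Require Import all_classical all_reals all_analysis.
From mathcomp Require Import ring lra.

Set Implicit Arguments.
Unset Strict Implicit.
Unset Printing Implicit Defensive.

Import Order.TTheory GRing.Theory Num.Theory.
Import numFieldNormedType.Exports.

Local Open Scope classical_set_scope.
Local Open Scope ring_scope.

(** Words in the generators compare marked groups: convergence in the space of marked
    groups means that for each [n] the relations of length at most [n] eventually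
    agree ([cay_cvg_agree]), so the Cayley graphs have the same balls. The space is
    compact: the relations holding along an ultrafilter define a limit group, which
    is the limit of a subsequence ([cay_compact]).

    From actions to fibred embeddings. Let a limit group act on [M] with base point
    [y]. All fibres are [M] and the section is constantly [y]; on a small set around
    [c] the trivialization at [x] is the action of the element of the limit group
    spelled like [x c^-1]. On the overlap of two sets around [c1] and [c2] the change
    of trivialization is the action of the element spelled like [c2 c1^-1], whatever
    the point ([fibred_of_actions]). If there are several limit groups, countably many
    of them exhibit all balls that matter ([countable_boundary]), and they act on the
    l_q product of their spaces, each on its own coordinate ([lq_product_actions]).
    For Banach spaces the trivializations have to be affine, which is the theorem of
    Mazur and Ulam.

    From fibred embeddings to actions. Let [G i] converge to [H]. On finite subsets
    [F i] of [G i] consider the functions to [M], with the averaged l_q distance. The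
    trivialization on the ball around [g] shows the value of the section at [h g] as a
    point of [M]; letting [g] range over [F i] this gives a family [f_h]. The
    translation by [h] takes a family [z] to the family whose value at [g] is [z (h g)]
    transported by the change of trivialization from around [h g] to around [g]. The
    cocycle relations make this a right action, up to the points [g] of [F i] such
    that [h g] leaves [F i] and up to errors that vanish in the limit, and it takes
    [f_1] to [f_h]; the control functions are inherited since all coordinates of
    [f_g] and [f_h] satisfy the same bounds.

    If the groups are finite, [F i] is everything and the action lives on the whole
    ultraproduct. If they are amenable, [F i] is a Folner set, and a sequence of sets
    of points of vanishing density is lost. It matters only for families whose
    distance to [f_1] concentrates on such null sets; so the action is restricted to
    the families without concentration. They form a closed subset, on which the
    translations are isometric and multiplicative. This subset is affine in the Banach
    case. It is also geodesically convex: if [p] lies between [a] and [b] and the distance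
    of [a] and [b] is carried by the complement of a null set, then on this
    complement [p] is already as far from [a] as it is altogether, so the null set
    carries nothing of the q-th power of the distance of [a] and [p]
    ([between_near_base]).

    The spaces are all quotients of sets of families of points by a pseudometric
    computed from the coordinatewise distances ([space_quotient]), which treats
    metric and Banach spaces, products and ultraproducts at the same time. *)

(** * Words in marked groups *)

Lemma ex_choice (X Y : Type) (P : X -> Y -> Prop) :
  (forall x, exists y, P x y) -> exists f : X -> Y, forall x, P x (f x).
Proof.
move=> H; exists (fun x => sval (cid (H x))) => x; exact: svalP (cid (H x)).
Qed.

Section Words.
Context (k : nat).
Implicit Types (G H : marked_group k) (w : word k).
Local Open Scope group_scope.

Definition ev G w : G := eval_word (mg_gen G) w.

Lemma ev_cat G w1 w2 : ev G (w1 ++ w2) = ev G w1 * ev G w2.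
Proof. by elim: w1 => [|a w IH] /=; rewrite ?mul1g// IH mulgA. Qed.

Definition inv_word w : word k := rev [seq (a.1, ~~ a.2) | a <- w].

Lemma size_inv_word w : size (inv_word w) = size w.
Proof. by rewrite size_rev size_map. Qed.

Lemma ev_inv G w : ev G (inv_word w) = (ev G w)^-1.
Proof.
elim: w => [|[j b] w IH] /=; first by rewrite invg1.
rewrite /inv_word/= rev_cons -cats1 ev_cat -/(inv_word w) IH invgM; congr (_ * _).
by rewrite /ev/= mulg1 /eval_letter/=; case: b => //=; rewrite invgK.
Qed.

Lemma reduced_word w : exists2 w' : word k, reduced w' &
  forall G, ev G w' = ev G w.
Proof.
elim: w => [|a w [w' rw' IH]]; first by exists [::].
case: w' rw' IH => [|b w'] rw' IH.
  by exists [:: a] => // G; rewrite /ev/= -/(ev G w) -IH.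
case ab: ((a.1 == b.1) ==> (a.2 == b.2)).
  exists [:: a, b & w']; first by rewrite /reduced/= ab.
  by move=> G; rewrite /ev/= -/(ev G w) -IH.
exists w'; first by move: rw'; rewrite /reduced/=; exact: path_sorted.
move=> G; rewrite /ev/= -/(ev G w) -IH /ev/=.
move: ab; case: a b {rw' IH} => [j b] [j' b'] /=.
case: eqP => //= <-; rewrite /eval_letter/=.
by case: b; case: b' => //= _; rewrite ?mulKg ?mulVKg.
Qed.

Lemma cay_cvg_ker (G : nat -> marked_group k) H :
  cay_cvg G H <->
  forall w : free_group k, \forall m \near \oo, mg_kernel (G m) w = mg_kernel H w.
Proof.
have := @pointwise_cvgP (discrete_topology {w : word k | reduced w}) bool
  ((fun m => mg_kernel (G m)) @ \oo) (mg_kernel H) _.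
rewrite /cay_cvg => ->; split=> h w; last by apply/discrete_cvg; exact: h.
by have /discrete_cvg := h w.
Qed.

Lemma cay_cvgP (G : nat -> marked_group k) H :
  cay_cvg G H <->
  forall w, \forall m \near \oo, ev (G m) w = 1 <-> ev H w = 1.
Proof.
rewrite cay_cvg_ker; split=> h w.
  have [w' rw' E] := reduced_word w.
  move: (h (exist _ w' rw')); apply: filterS => m e.
  by rewrite -!E; exact: (asbool_eq_equiv e).
move: (h (val w)); apply: filterS => m e.
exact: (asbool_equiv_eq e).
Qed.

Fixpoint words (n : nat) : seq (word k) :=
  if n is n'.+1 then
    words n' ++ [seq a :: w | a <- enum {: 'I_k * bool}, w <- words n']
  else [:: [::]].

Lemma mem_words n w : (w \in words n) = (size w <= n)%N.
Proof.
elim: n w => [|n IH] w /=; first by rewrite inE leqn0 size_eq0.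
rewrite mem_cat IH; case: w => [|a w]; first by rewrite leq0n.
apply/idP/idP => /=.
  move=> /orP[/leqW//|/allpairsP[[b v] /= [_ +]] [_ ->]].
  by rewrite IH.
rewrite ltnS => wn; apply/orP; right; apply/allpairsP; exists (a, w) => /=.
by rewrite mem_enum IH.
Qed.

(** Equality of the balls of radius [n./2] of the two Cayley graphs, expressed by
    the relations of length at most [n]. *)
Definition agree (n : nat) G H : Prop :=
  forall w, (size w <= n)%N -> ev G w = 1 <-> ev H w = 1.

Lemma agree_sym n G H : agree n G H -> agree n H G.
Proof. by move=> GH w wn; apply: iff_sym; exact: GH. Qed.

Lemma agreeW m n G H : (m <= n)%N -> agree n G H -> agree m G H.
Proof. by move=> mn GH w wm; apply: GH; exact: leq_trans mn. Qed.

Lemma agree_eq n G H w1 w2 : agree n G H -> (size w1 + size w2 <= n)%N ->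
  ev G w1 = ev G w2 <-> ev H w1 = ev H w2.
Proof.
move=> GH wn.
have E (L : marked_group k) : ev L w1 = ev L w2 <-> ev L (w1 ++ inv_word w2) = 1.
  rewrite ev_cat ev_inv; split => [->|]; first by rewrite mulgV.
  by move=> /(congr1 (fun x => x * ev L w2)); rewrite mulgVK mul1g.
by rewrite !E; apply: GH; rewrite size_cat size_inv_word.
Qed.

Lemma cay_cvg_agree (G : nat -> marked_group k) H :
  cay_cvg G H <-> forall n, \forall m \near \oo, agree n (G m) H.
Proof.
rewrite cay_cvgP; split => h.
  move=> n.
  suff: \forall m \near \oo, forall w, w \in words n -> ev (G m) w = 1 <-> ev H w = 1.
    by apply: filterS => m hm w; rewrite -mem_words; exact: hm.
  elim: (words n) => [|w s IH]; first by near=> m.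
  near=> m => v; rewrite inE => /orP[/eqP->|].
    by near: m; exact: h.
  by move: v; near: m.
by move=> w; move: (h (size w)); apply: filterS => m; apply.
Unshelve. all: by end_near. Qed.

(** ** The word metric *)

Lemma cay_walkP G (g h : G) n :
  cay_walk g h n <-> exists w : word k, size w = n /\ ev G w * g = h.
Proof.
split.
  move=> [p []]; elim: p g n => [|x p IH] g n /=.
    by move=> _ <- <-; exists [::]; rewrite /ev/= mul1g.
  move=> /andP[gx xp] lp <-; have [w [sw <-]] := IH _ _ xp lp erefl.
  have [a ->] : exists a, x = eval_letter (mg_gen G) a * g.
    move/existsP: gx => [j /orP[/eqP ->|/eqP ->]]; first by exists (j, false).
    by exists (j, true); rewrite /eval_letter/= mulKg.
  exists (w ++ [:: a]); rewrite size_cat sw addn1; split => //.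
  by rewrite ev_cat -mulgA; congr (_ * _); rewrite /ev/= mulg1.
move=> [w [<- <-]]; elim: w => [|[j b] w IH].
  by rewrite /ev/= mul1g; exact: cay_walk0.
rewrite /= -addn1; apply: (cay_walkD IH); apply: cay_walk1.
apply/existsP; exists j; rewrite /ev/= /eval_letter/= -/(ev G w).
case: b => /=; first by rewrite -!mulgA mulVKg eqxx orbT.
by rewrite -mulgA eqxx.
Qed.

Lemma cay_dist_leP G (g h : G) n :
  (cay_dist g h <= n)%N <-> exists2 w : word k, (size w <= n)%N & ev G w * g = h.
Proof.
split => [dn|[w wn wE]].
  by have /cay_walkP[w [sw wE]] := cay_dist_walk g h; exists w; rewrite ?sw.
by apply: leq_trans wn; apply: cay_dist_le; apply/cay_walkP; exists w.
Qed.

Lemma cay_dist_ev G (g : G) w : (cay_dist g (ev G w * g) <= size w)%N.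
Proof. by apply/cay_dist_leP; exists w. Qed.

Lemma cay_distC G (g h : G) : cay_dist g h = cay_dist h g.
Proof.
by apply/eqP; rewrite eqn_leq !cay_dist_le//; apply/cay_walk_sym/cay_dist_walk.
Qed.

Lemma cay_distD G (x y z : G) : (cay_dist x z <= cay_dist x y + cay_dist y z)%N.
Proof. by rewrite cay_dist_le//; apply: cay_walkD; exact: cay_dist_walk. Qed.

Lemma cay_distxx G (g : G) : cay_dist g g = 0%N.
Proof. by apply/eqP; rewrite -leqn0; apply/cay_dist_le/cay_walk0. Qed.

Lemma cay_distMr G (g h x : G) : cay_dist (g * x) (h * x) = cay_dist g h.
Proof.
have H n : (cay_dist (g * x) (h * x) <= n)%N <-> (cay_dist g h <= n)%N.
  rewrite !cay_dist_leP; split => -[w wn wE]; exists w => //.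
    by apply: (mulIg x); rewrite -mulgA.
  by rewrite mulgA wE.
by apply/eqP; rewrite eqn_leq; apply/andP; split; [apply/H|apply/(H _).1].
Qed.

Lemma geod_exists G (g : G) :
  exists w : word k, ev G w = g /\ size w = cay_dist 1 g.
Proof.
have /cay_walkP[w [sw wE]] := cay_dist_walk 1 g.
by exists w; rewrite -{1}wE mulg1 sw.
Qed.

Definition geod G (g : G) : word k := sval (cid (geod_exists g)).

Lemma ev_geod G (g : G) : ev G (geod g) = g.
Proof. exact: (svalP (cid (geod_exists g))).1. Qed.

Lemma size_geod G (g : G) : size (geod g) = cay_dist 1 g.
Proof. exact: (svalP (cid (geod_exists g))).2. Qed.

(** A shortest word leading from one point to the other is no longer than the two
    given words together, so that it leads there is a relation of length at most
    [n]. *)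
Lemma agree_dist n G H w1 w2 : agree n G H -> (2 * (size w1 + size w2) <= n)%N ->
  cay_dist (ev G w1) (ev G w2) = cay_dist (ev H w1) (ev H w2).
Proof.
wlog suff W : G H / agree n G H -> (2 * (size w1 + size w2) <= n)%N ->
    (cay_dist (ev G w1) (ev G w2) <= cay_dist (ev H w1) (ev H w2))%N.
  move=> GH wn; apply/eqP; rewrite eqn_leq !W//; exact: agree_sym.
move=> GH wn.
have /cay_dist_leP[w sw wE] := leqnn (cay_dist (ev H w1) (ev H w2)).
apply/cay_dist_leP; exists w => //.
have sw' : (size w <= size w1 + size w2)%N.
  apply: (leq_trans sw); apply/cay_dist_leP; exists (w2 ++ inv_word w1).
    by rewrite size_cat size_inv_word addnC.
  by rewrite ev_cat ev_inv mulgVK.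
move: wE; rewrite -!ev_cat; apply: (agree_eq GH _).2.
rewrite size_cat; apply: leq_trans wn; rewrite mul2n -addnn.
by rewrite -addnA leq_add.
Qed.
End Words.

(** * Compactness of the space of marked groups *)

(** Words modulo equality along the filter, i.e. the subgroup generated by the
    sequences of generators in the reduced product of the groups. *)
Section FilterLimit.
Context (k : nat) (G : nat -> marked_group k) (U : set_system nat) {FU : Filter U}.
Local Open Scope group_scope.
Local Open Scope quotient_scope.

Let e (w w' : word k) : bool := `[< \forall m \near U, ev (G m) w = ev (G m) w' >].

Let e_refl : reflexive e.
Proof. by move=> w; apply/asboolP; near=> m. Unshelve. all: by end_near. Qed.

Let e_sym : symmetric e.
Proof.
suff W w w' : e w w' -> e w' w by move=> w w'; apply/idP/idP; exact: W.
by move/asboolP => h; apply/asboolP; apply: filterS h => m ->.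
Qed.

Let e_trans : transitive e.
Proof.
move=> w2 w1 w3 /asboolP h1 /asboolP h2; apply/asboolP.
by apply: filterS2 h1 h2 => m -> ->.
Qed.

Canonical limit_equiv := EquivRel e e_refl e_sym e_trans.

Definition filter_limit : Type := {eq_quot limit_equiv}.
HB.instance Definition _ := Choice.on filter_limit.

Definition limit_class (w : word k) : filter_limit := \pi_{eq_quot limit_equiv} w.

Lemma limit_class_eq w w' :
  limit_class w = limit_class w' <-> \forall m \near U, ev (G m) w = ev (G m) w'.
Proof.
rewrite /limit_class; split => [h|h].
  have /eqmodP ww' : w = w' %[mod_eq limit_equiv] := h.
  exact: asboolW ww'.
by apply/eqmodP; exact: asboolT h.
Qed.

Lemma limit_class_repr (x : filter_limit) : limit_class (repr x) = x.
Proof. exact: reprK. Qed.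

Let mul (x y : filter_limit) := limit_class (repr x ++ repr y).
Let inv (x : filter_limit) := limit_class (inv_word (repr x)).
Let one := limit_class [::].

Let near_repr w : \forall m \near U, ev (G m) (repr (limit_class w)) = ev (G m) w.
Proof. by apply/limit_class_eq; rewrite limit_class_repr. Qed.

Let mulE w w' : mul (limit_class w) (limit_class w') = limit_class (w ++ w').
Proof.
apply/limit_class_eq; apply: filterS2 (near_repr w) (near_repr w') => m h1 h2.
by rewrite !ev_cat h1 h2.
Qed.

Let invE w : inv (limit_class w) = limit_class (inv_word w).
Proof.
apply/limit_class_eq; apply: filterS (near_repr w) => m h.
by rewrite !ev_inv h.
Qed.

Let mulA : associative mul.
Proof.
move=> x y z; rewrite -(limit_class_repr x) -(limit_class_repr y) -(limit_class_repr z).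
by rewrite !mulE catA.
Qed.

Let mul1 : left_id one mul.
Proof. by move=> x; rewrite -(limit_class_repr x) mulE. Qed.

Let mulr1 : right_id one mul.
Proof. by move=> x; rewrite -(limit_class_repr x) mulE cats0. Qed.

Let mulV : left_inverse one inv mul.
Proof.
move=> x; rewrite -(limit_class_repr x) invE mulE; apply/limit_class_eq.
near=> m; by rewrite ev_cat ev_inv mulVg.
Unshelve. all: by end_near. Qed.

Let mulrV : right_inverse one inv mul.
Proof.
move=> x; rewrite -(limit_class_repr x) invE mulE; apply/limit_class_eq.
near=> m; by rewrite ev_cat ev_inv mulgV.
Unshelve. all: by end_near. Qed.

HB.instance Definition _ := isGroup.Build filter_limit
  mulA mul1 mulr1 mulV mulrV.

Let gen (j : 'I_k) : filter_limit := limit_class [:: (j, false)].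

Let eval_gen w : eval_word gen w = limit_class w.
Proof.
elim: w => [//|[j b] w /= ->].
suff -> : eval_letter gen (j, b) = limit_class [:: (j, b)] by exact: mulE.
by rewrite /eval_letter/=; case: b => //; exact: invE.
Qed.

Let gen_surj (g : filter_limit) : exists w : word k, eval_word gen w = g.
Proof. by exists (repr g); rewrite eval_gen limit_class_repr. Qed.

Definition limit_group : marked_group k := MarkedGroup gen_surj.

Lemma limit_groupP w :
  ev limit_group w = 1 <-> \forall m \near U, ev (G m) w = 1.
Proof. by rewrite /ev/= eval_gen; exact: limit_class_eq. Qed.

End FilterLimit.

(** The values are chosen one after the other, each beyond the previous one. *)
Lemma cofinal_subsequence (P : nat -> nat -> Prop) :
  (forall L N, exists2 m, (N <= m)%N & P L m) ->
  exists n : nat -> nat, {homo n : i j / (i < j)%N} /\ forall L, P L (n L).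
Proof.
move=> h.
have [f fP] : exists f : nat -> nat -> nat, forall L N, (N <= f L N)%N /\ P L (f L N).
  suff /ex_choice[f fP] : forall L, exists g : nat -> nat, forall N, (N <= g N)%N /\ P L (g N).
    by exists f.
  move=> L; apply: (@ex_choice _ _ (fun N m => (N <= m)%N /\ P L m)) => N.
  by have [m] := h L N; exists m.
pose n := fix n L := if L is L'.+1 then f L (n L').+1 else f 0%N 0%N.
exists n; split; last by case=> [|L]; exact: (fP _ _).2.
by apply: (homo_ltn ltn_trans) => i; exact: (fP _ _).1.
Qed.

Lemma eventually_lt N : \forall m \near \oo, (N <= m)%N.
Proof. exact: nbhs_infty_ge. Qed.

(** The limit along an ultrafilter of relations is a limit in the space of marked
    groups of some subsequence, because only finitely many words are tested at a
    time. *)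
Lemma cay_compact k (G : nat -> marked_group k) : exists H, cay_boundary G H.
Proof.
have [U [UU oU]] := ultraFilterLemma (F := \oo) _.
have FU : Filter U by exact: filter_filter.
pose H := @limit_group k G U FU; exists H.
have agr L : \forall m \near U, agree L (G m) H.
  suff: \forall m \near U, forall w, w \in words k L -> ev (G m) w = 1%g <-> ev H w = 1%g.
    by apply: filterS => m hm w; rewrite -mem_words; exact: hm.
  elim: (words k L) => [|w s IH]; first by near=> m.
  have h : \forall m \near U, ev (G m) w = 1%g <-> ev H w = 1%g.
    have [u|u] := in_ultra_setVsetC [set m | ev (G m) w = 1%g] UU.
      apply: (@filterS _ U _ _ _ _ u) => m hm; split => // _.
      exact: (limit_groupP G w).2.
    apply: (@filterS _ U _ _ _ _ u) => m hm; split => // /limit_groupP v.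
    by have [i []] := filter_ex (filterI u v).
  near=> m => v; rewrite inE => /orP[/eqP->|]; first by near: m.
  by move: v; near: m.
have [|n [n_lt nP]] := @cofinal_subsequence (fun L m => agree L (G m) H).
  move=> L N; have [m [m1 m2]] := filter_ex (filterI (agr L) (oU _ (eventually_lt N))).
  by exists m.
exists n; split => //; apply/cay_cvg_agree => L.
near=> i; apply: (agreeW _ (nP i)); near: i; exact: eventually_lt.
Unshelve. all: by end_near. Qed.

(** Otherwise the exceptional indices would form a subsequence, and an accumulation
    point of that subsequence agrees with infinitely many of its terms. *)
Lemma boundary_agree k (G : nat -> marked_group k) n :
  \forall m \near \oo, exists2 H, cay_boundary G H & agree n (G m) H.
Proof.
apply: contrapT => h.
have [|f [f_lt fP]] := @cofinal_subsequence
    (fun _ m => ~ exists2 H, cay_boundary G H & agree n (G m) H).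
  move=> _ N; apply: contrapT => h'; apply: h.
  near=> m; apply: contrapT => h''; apply: h'; exists m => //.
  by near: m; exact: eventually_lt.
have [H [g [g_lt gH]]] := cay_compact (G \o f).
have [i agi] := filter_ex ((cay_cvg_agree _ _).1 gH n).
apply: (fP (g i)); exists H => //; exists (f \o g); split => //.
by move=> i' j' ij; apply: f_lt; exact: g_lt.
Unshelve. all: by end_near. Qed.

Lemma cvg_boundary k (G : nat -> marked_group k) H : cay_cvg G H -> cay_boundary G H.
Proof. by move=> GH; exists id; split => // i j. Qed.

Lemma homo_ltn_ge (n : nat -> nat) : {homo n : i j / (i < j)%N} ->
  forall i, (i <= n i)%N.
Proof. by move=> h; elim=> // i IH; apply: leq_ltn_trans IH _; exact: h. Qed.

(** * Surjective isometries of Banach spaces are affine *)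

Section MazurUlam.
Context (R : realType).

Let isom (E F : normedModType R) (f : E -> F) := forall x y, `|f x - f y| = `|x - y|.

Let flip (E : normedModType R) (a b x : E) := a + b - x.

Let flipK (E : normedModType R) (a b : E) : involutive (flip a b).
Proof. by move=> x; rewrite /flip opprB addrC subrK. Qed.

Let flip_isom (E : normedModType R) (a b : E) : isom (flip a b).
Proof. by move=> x y; rewrite /flip opprB addrC addrA subrK distrC. Qed.

Let mid (E : normedModType R) (a b : E) : E := 2^-1 *: (a + b).

Let midD (E : normedModType R) (a b : E) : mid a b + mid a b = a + b.
Proof. by rewrite -scalerDl -[2^-1 + _]mulr2n -[_ *+ 2]mulr_natr mulVf ?scale1r// pnatr_eq0. Qed.

Let half (E : normedModType R) (x : E) : 2^-1 *: (x + x) = x.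
Proof. by rewrite -mulr2n -(scaler_nat 2 x) scalerA mulVf ?scale1r// pnatr_eq0. Qed.

Let fixing (E : normedModType R) (a b : E) (g g' : E -> E) :=
  [/\ isom g, cancel g g', cancel g' g, g a = a & g b = b].

(** The displacement of the midpoint of [a] and [b] is bounded over the isometries
    [g] fixing both; conjugating [g] by the reflection in the midpoint produces
    another such isometry with twice the displacement, which therefore vanishes. *)
Let fixing_mid (E : normedModType R) (a b : E) g g' :
  fixing a b g g' -> g (mid a b) = mid a b.
Proof.
pose z := mid a b; rewrite -/z => gP.
have dist_flip x : `|flip a b x - x| = 2 * `|x - z|.
  have -> : flip a b x - x = 2 *: (z - x).
    by rewrite /flip -(midD a b) -/z scaler_nat mulr2n -addrA addrACA.
  by rewrite normrZ ger0_norm// distrC.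
have flip_z x : `|flip a b x - z| = `|x - z|.
  have {1}-> : z = flip a b z by rewrite /flip -(midD a b) addrK.
  exact: flip_isom.
have bound n h h' : fixing a b h h' -> 2 ^+ n * `|h z - z| <= 2 * `|a - z|.
  elim: n h h' => [|n IH] h h' [hi hh' h'h ha hb].
    rewrite expr0 mul1r mulr_natl mulr2n.
    apply: le_trans (ler_distD a _ _) _.
    by rewrite -{1}ha hi distrC.
  have h'i : isom h' by move=> x y; rewrite -hi !h'h.
  have h'a : h' a = a by rewrite -{1}ha hh'.
  have h'b : h' b = b by rewrite -{1}hb hh'.
  have fa : flip a b a = b by rewrite /flip addrC addKr.
  have fb : flip a b b = a by rewrite /flip addrK.
  rewrite exprSr -mulrA -dist_flip.
  have -> : `|flip a b (h z) - h z| =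
            `|(flip a b \o h' \o flip a b \o h) z - z|.
    by rewrite /= flip_z -(hh' z) h'i hh'.
  apply: (IH _ (h' \o flip a b \o h \o flip a b)); split.
  - by move=> x y /=; rewrite flip_isom h'i flip_isom hi.
  - by move=> x /=; rewrite flipK h'h flipK hh'.
  - by move=> x /=; rewrite h'h flipK hh' flipK.
  - by rewrite /= ha fa h'b fb.
  - by rewrite /= hb fb h'a fa.
apply/eqP; rewrite -subr_eq0 -normr_le0; apply/ler_addgt0Pr => e e0; rewrite add0r.
have [n] : exists n : nat, 2 * `|a - z| / e < n%:R.
  by exists (Num.bound (2 * `|a - z| / e)); rewrite archi_boundP// divr_ge0// ?mulr_ge0// ltW.
rewrite ltr_pdivrMr// => ne.
have n2 : n%:R <= 2 ^+ n :> R by rewrite -natrX ler_nat ltnW// ltn_expl.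
have n0 : 0 < 2 ^+ n :> R by rewrite exprn_gt0.
rewrite -(ler_pM2l n0); apply: le_trans (bound n _ _ gP) _.
by apply: le_trans (ltW ne) _; rewrite ler_pM2r.
Qed.

Let isom_mid (E F : normedModType R) (f : E -> F) (a b : E) :
  isom f -> (forall y, exists x, f x = y) -> f (mid a b) = mid (f a) (f b).
Proof.
move=> fi /ex_choice[f' ff'].
have f'f x : f' (f x) = x.
  by apply/eqP; rewrite -subr_eq0 -normr_eq0 -fi ff' subrr normr0.
have f'i : isom f' by move=> x y; rewrite -fi !ff'.
pose g := flip a b \o f' \o flip (f a) (f b) \o f.
pose g' := f' \o flip (f a) (f b) \o f \o flip a b.
have gP : fixing a b g g'.
  split.
  - by move=> x y; rewrite /g/= flip_isom f'i flip_isom fi.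
  - by move=> x; rewrite /g /g'/= flipK ff' flipK f'f.
  - by move=> x; rewrite /g /g'/= ff' flipK f'f flipK.
  - by rewrite /g /flip /= [f a + _]addrC addrK f'f addrK.
  - by rewrite /g /flip /= addrK f'f [a + _]addrC addrK.
have := fixing_mid gP; set z := mid a b => gz.
have e : flip (f a) (f b) (f z) = f z.
  rewrite -[LHS]ff'; congr f; rewrite -[LHS](flipK a b) -/(g z).
  by rewrite [flip _ _ (f' _)]gz /flip -(midD a b) -/z addrK.
have e2 : mid (f a) (f b) + mid (f a) (f b) = f z + f z.
  by rewrite midD -{1}e /flip subrK.
by rewrite -[LHS]half -e2 half.
Qed.

(** A map preserving midpoints is additive up to translation, hence commutes with
    multiplication by rationals; real scalars follow by continuity. *)
Lemma mazur_ulam (E F : normedModType R) (f : E -> F) :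
  (forall x y, `|f x - f y| = `|x - y|) -> (forall y, exists x, f x = y) ->
  forall (t : R) (x y : E), f (t *: x + (1 - t) *: y) = t *: f x + (1 - t) *: f y.
Proof.
move=> fi fs; pose g x := f x - f 0.
have g0 : g 0 = 0 by rewrite /g subrr.
have gi : isom g by move=> x y; rewrite /g opprB addrA subrK fi.
have gmid x y : g (mid x y) = mid (g x) (g y).
  by rewrite /g isom_mid// /mid addrACA -opprD [in RHS]scalerDr scalerN half.
have gD x y : g (x + y) = g x + g y.
  have gd v : g (v + v) = g v + g v.
    have := midD (g (v + v)) (g 0); rewrite -gmid.
    have -> : mid (v + v) 0 = v by rewrite /mid addr0 half.
    by rewrite g0 addr0 => ->.
  by rewrite -(midD x y) gd gmid midD.
have gN x : g (- x) = - g x.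
  by apply/eqP; rewrite -addr_eq0 -gD addNr g0.
have gM n x : g (n%:R *: x) = n%:R *: g x.
  elim: n => [|n IH]; first by rewrite !scale0r.
  by rewrite -addn1 natrD !scalerDl gD IH !scale1r.
have gZ (z : int) x : g (z%:~R *: x) = z%:~R *: g x.
  case: z => n; first exact: gM.
  by rewrite NegzE mulrNz !scaleNr gN -gM.
have gL t x : g (t *: x) = t *: g x.
  apply/eqP; rewrite -subr_eq0 -normr_le0; apply/ler_addgt0Pr => e e0; rewrite add0r.
  have [n] : exists n : nat, 2 * `|x| / e < n%:R.
    by exists (Num.bound (2 * `|x| / e)); rewrite archi_boundP// divr_ge0// ?mulr_ge0// ltW.
  rewrite ltr_pdivrMr// => ne.
  have n0 : 0 < n%:R :> R.
    by rewrite -(pmulr_lgt0 _ e0); apply: le_lt_trans ne; rewrite mulr_ge0.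
  pose z := Num.floor (t * n%:R).
  have tz : `|t * n%:R - z%:~R| <= 1.
    rewrite ger0_norm ?subr_ge0 ?floor_le_tmp//.
    by rewrite lerBlDl; apply/ltW; rewrite -intrD1 floorD1_gt.
  rewrite -(ler_pM2l n0) -[n%:R * `|_|]/(n%:R * _) -{1}[n%:R]ger0_norm ?ler0n// -normrZ.
  rewrite scalerBr -gM !scalerA [n%:R * t]mulrC.
  have -> : g ((t * n%:R) *: x) - (t * n%:R) *: g x =
    (g ((t * n%:R) *: x) - g (z%:~R *: x)) + (z%:~R - t * n%:R) *: g x.
    by rewrite gZ scalerBl addrA subrK.
  apply: le_trans (ler_normD _ _) _; rewrite gi -scalerBl !normrZ.
  have -> : `|g x| = `|x| by rewrite -[g x]subr0 -g0 gi subr0.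
  rewrite (distrC z%:~R) -mulrDl.
  apply: le_trans (ltW ne); rewrite ler_wpM2r//.
  by apply: le_trans (lerD tz tz) _.
move=> t x y; apply: (addIr (- f 0)); rewrite -[LHS]/(g _) gD !gL /g.
rewrite !scalerBr addrACA -opprD -scalerDl [t + _]addrC subrK scale1r//.
Qed.
End MazurUlam.

Lemma isometry_space_iso (R : realType) (K : space_kind) (A B : kspace R K) (f : A -> B) :
  is_isometry f -> space_iso f.
Proof.
case: K A B f => [//|] A B f [fi fs]; split => //=.
exact: mazur_ulam.
Qed.

(** * Finite l_q norms *)

(** Locked, since comparing two such norms by conversion would unfold the real
    powers. *)
HB.lock Definition nq (R : realType) (q : R) (I : Type) (s : seq I) (P : pred I)
    (f : I -> R) : R := (\sum_(i <- s | P i) f i `^ q) `^ q^-1.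

Section FiniteNorm.
Context (R : realType) (q : R) (q1 : 1 <= q).

Let q0 : 0 < q. Proof. exact: lt_le_trans q1. Qed.
Let qn0 : q != 0. Proof. by rewrite gt_eqF. Qed.
Let qV0 : 0 <= q^-1. Proof. by rewrite invr_ge0 ltW. Qed.

Lemma powRK (x : R) : 0 <= x -> (x `^ q) `^ q^-1 = x.
Proof. by move=> x0; rewrite -powRrM mulfV// powRr1. Qed.

Lemma powRVK (x : R) : 0 <= x -> (x `^ q^-1) `^ q = x.
Proof. by move=> x0; rewrite -powRrM mulVf// powRr1. Qed.

Lemma powR_le (x y : R) : 0 <= x -> x <= y -> x `^ q <= y `^ q.
Proof.
by move=> x0 xy; apply: ge0_ler_powR; rewrite ?nnegrE ?(ltW q0)// (le_trans x0).
Qed.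

Lemma powRV_le (x y : R) : 0 <= x -> x <= y -> x `^ q^-1 <= y `^ q^-1.
Proof.
by move=> x0 xy; apply: ge0_ler_powR; rewrite ?nnegrE ?qV0// (le_trans x0).
Qed.

Lemma powR_le_cancel (x y : R) : 0 <= x -> 0 <= y -> x `^ q <= y `^ q -> x <= y.
Proof.
move=> x0 y0 xy; rewrite -(powRK x0) -(powRK y0); apply: powRV_le => //.
exact: powR_ge0.
Qed.

Lemma powRV_leP (x c : R) : 0 <= x -> 0 <= c -> (x `^ q^-1 <= c) = (x <= c `^ q).
Proof.
move=> x0 c0; apply/idP/idP => h.
  by rewrite -[x]powRVK//; apply: powR_le => //; exact: powR_ge0.
by rewrite -[c]powRK//; exact: powRV_le.
Qed.

Lemma powR_div (x a : R) : 0 <= x -> 0 < a -> (x / a) `^ q = x `^ q / a `^ q.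
Proof.
move=> x0 a0; have aq : a `^ q != 0 by rewrite gt_eqF// powR_gt0.
by apply: (mulIf aq); rewrite divfK// -powRM ?divr_ge0 ?(ltW a0)// divfK// gt_eqF.
Qed.

Lemma powR_conv (t x y : R) : 0 <= t <= 1 -> 0 <= x -> 0 <= y ->
  (t * x + (1 - t) * y) `^ q <= t * x `^ q + (1 - t) * y `^ q.
Proof.
move=> /andP[t0 t1] x0 y0.
by apply: (convex_powR q1 (Itv01 t0 t1)); rewrite inE/= in_itv/= andbT.
Qed.

Section Def.
Context (I : Type) (s : seq I).
Implicit Types (P Q : pred I) (f g : I -> R).

Local Notation nq := (nq q s).

Lemma nqE P f : nq P f = (\sum_(i <- s | P i) f i `^ q) `^ q^-1.
Proof. by rewrite unlock. Qed.

Lemma sum_powR_ge0 P f : 0 <= \sum_(i <- s | P i) f i `^ q.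
Proof. by apply: sumr_ge0 => i _; exact: powR_ge0. Qed.

Lemma nq_ge0 P f : 0 <= nq P f. Proof. by rewrite nqE powR_ge0. Qed.

Lemma nq_powR P f : nq P f `^ q = \sum_(i <- s | P i) f i `^ q.
Proof. by rewrite nqE powRVK// sum_powR_ge0. Qed.

Lemma nq_leP P f c : 0 <= c ->
  (nq P f <= c) = (\sum_(i <- s | P i) f i `^ q <= c `^ q).
Proof. by move=> c0; rewrite nqE powRV_leP// sum_powR_ge0. Qed.

Lemma eq_nq P f g : (forall i, P i -> f i = g i) -> nq P f = nq P g.
Proof. by move=> fg; rewrite !nqE; congr (_ `^ _); apply: eq_bigr => i Pi; rewrite fg. Qed.

Lemma nq_le P f g : (forall i, P i -> 0 <= f i <= g i) -> nq P f <= nq P g.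
Proof.
move=> fg; rewrite !nqE; apply: powRV_le; first exact: sum_powR_ge0.
by apply: ler_sum => i /fg/andP[f0 fi]; exact: powR_le.
Qed.

Lemma nq_sub P Q f : (forall i, P i -> Q i) -> nq P f <= nq Q f.
Proof.
move=> PQ; rewrite !nqE; apply: powRV_le; first exact: sum_powR_ge0.
rewrite big_mkcond [leRHS]big_mkcond; apply: ler_sum => i _.
by case: (boolP (P i)) => [/PQ->//|_]; case: ifP => // _; exact: powR_ge0.
Qed.

Lemma nqZ P c f : 0 <= c -> (forall i, P i -> 0 <= f i) ->
  nq P (fun i => c * f i) = c * nq P f.
Proof.
move=> c0 f0; rewrite !nqE -{2}[c]powRK// -powRM ?powR_ge0 ?sum_powR_ge0//.
by rewrite mulr_sumr; congr (_ `^ _); apply: eq_bigr => i /f0 fi; rewrite powRM.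
Qed.

Lemma nq_const P c : 0 <= c -> nq P (fun=> c) = c * ((count P s)%:R `^ q^-1).
Proof.
move=> c0; rewrite !nqE big_const_seq iter_addr_0 -(mulr_natr (c `^ q)).
by rewrite powRM ?powR_ge0 ?ler0n// (powRK c0).
Qed.

(** Minkowski's inequality: after normalising, it is the convexity of the q-th
    power. *)
Lemma nqD P f g : (forall i, P i -> 0 <= f i) -> (forall i, P i -> 0 <= g i) ->
  nq P (fun i => f i + g i) <= nq P f + nq P g.
Proof.
move=> f0 g0.
suff W A B : 0 < A -> 0 < B -> nq P f <= A -> nq P g <= B ->
    nq P (fun i => f i + g i) <= A + B.
  apply/ler_addgt0Pr => e e0; have e2 : 0 < e / 2 by rewrite divr_gt0.
  rewrite [e]splitr addrACA.
  by apply: W; rewrite ?ltr_wpDl ?nq_ge0// lerDl ltW.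
move=> A0 B0; have AB0 : 0 < A + B by rewrite addr_gt0.
have sum_le h C : 0 < C -> nq P h <= C -> \sum_(i <- s | P i) h i `^ q <= C `^ q.
  by move=> C0; rewrite nq_leP// ltW.
move=> /(sum_le _ _ A0) fA /(sum_le _ _ B0) gB; rewrite (nq_leP P _ (ltW AB0)).
pose t := A / (A + B).
have t01 : 0 <= t <= 1.
  by rewrite divr_ge0 ?(ltW A0) ?(ltW AB0)//= ler_pdivrMr// mul1r lerDl ltW.
have tE : 1 - t = B / (A + B).
  by rewrite -(divff (lt0r_neq0 AB0)) -mulrBl addrAC subrr add0r.
have conv i : P i -> ((f i + g i) / (A + B)) `^ q <=
    t * (f i `^ q / A `^ q) + (1 - t) * (g i `^ q / B `^ q).
  move=> Pi.
  rewrite -!powR_div ?f0 ?g0//.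
  have -> : (f i + g i) / (A + B) = t * (f i / A) + (1 - t) * (g i / B).
    by rewrite tE /t; field; rewrite (gt_eqF A0) (gt_eqF B0) (gt_eqF AB0).
  by apply: powR_conv => //; apply: divr_ge0; rewrite ?f0 ?g0 ?(ltW A0) ?(ltW B0).
have ABq : 0 < (A + B) `^ q by exact: powR_gt0.
rewrite -[leRHS]mul1r -ler_pdivrMr// mulr_suml.
apply: le_trans (_ : \sum_(i <- s | P i)
    (t * (f i `^ q / A `^ q) + (1 - t) * (g i `^ q / B `^ q)) <= _).
  by apply: ler_sum => i Pi; rewrite -(@powR_div (f i + g i)) ?addr_ge0 ?f0 ?g0//; exact: conv.
rewrite big_split/= -!mulr_sumr -!mulr_suml.
apply: (@le_trans _ _ (t * 1 + (1 - t) * 1)); last by rewrite !mulr1 addrC subrK.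
move/andP: t01 => [t0 t1].
apply: lerD; apply: ler_wpM2l; rewrite ?subr_ge0//.
  by rewrite ler_pdivrMr ?mul1r// powR_gt0.
by rewrite ler_pdivrMr ?mul1r// powR_gt0.
Qed.

Lemma nq_tri P f g h : (forall i, P i -> 0 <= f i) -> (forall i, P i -> 0 <= g i) ->
  (forall i, P i -> 0 <= h i <= f i + g i) -> nq P h <= nq P f + nq P g.
Proof. by move=> f0 g0 hfg; apply: le_trans (nqD f0 g0); exact: nq_le. Qed.

Lemma nq_split P Q f : (forall i, P i -> 0 <= f i) ->
  nq P f <= nq (fun i => P i && Q i) f + nq (fun i => P i && ~~ Q i) f.
Proof.
move=> f0.
pose f1 i := if Q i then f i else 0; pose f2 i := if Q i then 0 else f i.
have -> : nq (fun i => P i && Q i) f = nq P f1.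
  rewrite !nqE big_mkcondr; congr (_ `^ _); apply: eq_bigr => i _.
  by rewrite /f1; case: ifP => // _; rewrite powR0.
have -> : nq (fun i => P i && ~~ Q i) f = nq P f2.
  rewrite !nqE big_mkcondr; congr (_ `^ _); apply: eq_bigr => i _.
  by rewrite /f2; case: (Q i) => //=; rewrite powR0.
apply: nq_tri => i Pi; rewrite /f1 /f2; case: (Q i) => //; rewrite ?f0 //=.
  by rewrite addr0.
by rewrite add0r.
Qed.

End Def.

Lemma le_nq (I : eqType) (s : seq I) (P : pred I) (f : I -> R) i :
  i \in s -> P i -> 0 <= f i -> f i <= nq q s P f.
Proof.
move=> si Pi f0; rewrite -[leLHS]powRK// nqE; apply: powRV_le; first exact: powR_ge0.
rewrite (big_rem i)//= Pi lerDl; exact: sum_powR_ge0.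
Qed.

End FiniteNorm.
Arguments nq {R} q {I} s P f.

(** * Quotient spaces of families of points *)

Lemma mdist_banach (R : realType) (V : completeNormedModType R) (x y : banach_metric V) :
  mdist x y = `|(x : V) - y|.
Proof. by []. Qed.

(** The separated quotient of a pseudometric which only behaves on a subset. *)
Section MetricQuotient.
Local Open Scope quotient_scope.
Context (R : realType) (T : Type) (D : T -> Prop) (pd : T -> T -> R).
Hypothesis pdxx : forall z, D z -> pd z z = 0.
Hypothesis pd_sym : forall z w, D z -> D w -> pd z w = pd w z.
Hypothesis pd_tri : forall y z w, D y -> D z -> D w -> pd z w <= pd z y + pd y w.

Definition pd_dom : Type := {z : T | D z}.
HB.instance Definition _ := gen_eqMixin pd_dom.
HB.instance Definition _ := gen_choiceMixin pd_dom.

Let pd_ge0 z w : D z -> D w -> 0 <= pd z w.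
Proof.
move=> Dz Dw; rewrite -(@pmulrn_lge0 _ _ 2)// mulr2n {2}pd_sym// -(pdxx Dz).
exact: pd_tri.
Qed.

Let e (z w : pd_dom) : bool := pd (sval z) (sval w) == 0.

Let e_refl : reflexive e.
Proof. by move=> z; rewrite /e pdxx//; exact: svalP. Qed.

Let e_sym : symmetric e.
Proof. by move=> z w; rewrite /e pd_sym//; exact: svalP. Qed.

Let e_trans : transitive e.
Proof.
move=> y z w /eqP h1 /eqP h2; rewrite /e eq_le pd_ge0 ?andbT; try exact: svalP.
rewrite -[leRHS]addr0 -{1}h1 -h2; apply: pd_tri; exact: svalP.
Qed.

Canonical quot_equiv := EquivRel e e_refl e_sym e_trans.

Definition quot : Type := {eq_quot quot_equiv}.
HB.instance Definition _ := Choice.on quot.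

Definition cls (z : pd_dom) : quot := (\pi_{eq_quot quot_equiv} z)%qT.
Definition rep (x : quot) : T := sval (repr (x : {eq_quot quot_equiv})).

Lemma repP x : D (rep x). Proof. exact: svalP. Qed.

Lemma cls_eq z w : cls z = cls w <-> pd (sval z) (sval w) = 0.
Proof.
rewrite /cls; split => [h|h].
  by have /eqmodP/eqP : (z = w %[mod_eq quot_equiv])%qT := h.
by apply/eqmodP/eqP.
Qed.

Lemma rep_cls z : pd (rep (cls z)) (sval z) = 0.
Proof. by apply/cls_eq; exact: reprK. Qed.

Lemma cls_rep x Dx : cls (exist _ (rep x) Dx) = x.
Proof.
rewrite -[RHS](reprK x); apply/cls_eq => /=; exact: pdxx.
Qed.

Lemma pd_eq z z' w w' : D z -> D z' -> D w -> D w' ->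
  pd z z' = 0 -> pd w w' = 0 -> pd z w = pd z' w'.
Proof.
move=> Dz Dz' Dw Dw' h h'; apply/eqP; rewrite eq_le; apply/andP; split.
  apply: le_trans (pd_tri Dz' Dz Dw) _; rewrite h add0r.
  by apply: le_trans (pd_tri Dw' Dz' Dw) _; rewrite [pd w' w]pd_sym// h' addr0.
apply: le_trans (pd_tri Dz Dz' Dw') _; rewrite pd_sym// h add0r.
by apply: le_trans (pd_tri Dw Dz Dw') _; rewrite h' addr0.
Qed.

Definition qdist (x y : quot) : R := pd (rep x) (rep y).

Lemma qdist_cls z w : qdist (cls z) (cls w) = pd (sval z) (sval w).
Proof.
by apply: pd_eq; [exact: repP|exact: svalP|exact: repP|exact: svalP|
  exact: rep_cls|exact: rep_cls].
Qed.

Let qdistxx x : qdist x x = 0. Proof. exact/pdxx/repP. Qed.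

Lemma qdist_eq x y : qdist x y = 0 -> x = y.
Proof.
move=> h; rewrite -[x](cls_rep (repP x)) -[y](cls_rep (repP y)).
exact/cls_eq.
Qed.

Let qdist_sym x y : qdist x y = qdist y x.
Proof. by apply: pd_sym; exact: repP. Qed.

Let qdist_tri y x z : qdist x z <= qdist x y + qdist y z.
Proof. by apply: pd_tri; exact: repP. Qed.

HB.instance Definition _ := isMetric.Build R quot qdistxx qdist_eq qdist_sym qdist_tri.

Definition metric_quotient : metricType R := quot.

End MetricQuotient.

Lemma metric_quotient_exists (R : realType) (T : Type) (D : T -> Prop) (pd : T -> T -> R)
    (y : T) : D y ->
  (forall z, D z -> pd z z = 0) ->
  (forall z w, D z -> D w -> pd z w = pd w z) ->
  (forall y z w, D y -> D z -> D w -> pd z w <= pd z y + pd y w) ->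
  exists (N : metricType R) (phi : T -> N),
    (forall x, exists2 z, D z & phi z = x) /\
    (forall z w, D z -> D w -> mdist (phi z) (phi w) = pd z w).
Proof.
move=> Dy pdxx pdC pdT; pose N := metric_quotient pdxx pdC pdT; exists N.
pose phi z : N := match pselect (D z) with
  | left Dz => cls pdxx pdC pdT (exist _ z Dz)
  | right _ => cls pdxx pdC pdT (exist _ y Dy) end.
have phiE z (Dz : D z) : phi z = cls pdxx pdC pdT (exist _ z Dz).
  rewrite /phi; case: pselect => // Dz'; congr cls; congr exist; exact: Prop_irrelevance.
exists phi; split.
  move=> x; exists (rep x); first exact: repP.
  rewrite (phiE _ (repP _)); exact: (@cls_rep _ _ _ _ pdxx pdC pdT x).
by move=> z w Dz Dw; rewrite !phiE; exact: qdist_cls.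
Qed.

(** The same quotient for a seminorm on a subspace. The operations are computed on
    representatives, and the norm of a difference is the quotient metric above. *)
Section BanachQuotient.
Context (R : realType) (V : lmodType R) (D : V -> Prop) (p : V -> R).
Hypothesis D0 : D 0.
Hypothesis D_lin : forall a v w, D v -> D w -> D (a *: v + w).
Hypothesis pD : forall v w, D v -> D w -> p (v + w) <= p v + p w.
Hypothesis pZ : forall a v, D v -> p (a *: v) = `|a| * p v.
Hypothesis p_complete : forall u : nat -> V, (forall n, D (u n)) ->
  (forall n, p (u n - u n.+1) <= 2^-1 ^+ n) ->
  exists l, D l /\ forall e, 0 < e -> exists n, forall m, (n <= m)%N -> p (u m - l) <= e.

Let DZ a v : D v -> D (a *: v).
Proof. by move=> Dv; rewrite -[_ *: _]addr0; exact: D_lin. Qed.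

Let DD v w : D v -> D w -> D (v + w).
Proof. by move=> Dv Dw; rewrite -[v]scale1r; exact: D_lin. Qed.

Let DN v : D v -> D (- v). Proof. by move=> Dv; rewrite -scaleN1r; exact: DZ. Qed.

Let DB v w : D v -> D w -> D (v - w).
Proof. by move=> Dv Dw; apply: DD => //; exact: DN. Qed.

Let p0 : p 0 = 0. Proof. by have := pZ 0 D0; rewrite scale0r normr0 mul0r. Qed.

Let pd v w := p (v - w).

Let pdxx v : D v -> pd v v = 0. Proof. by rewrite /pd subrr. Qed.

Let pd_sym v w : D v -> D w -> pd v w = pd w v.
Proof.
move=> Dv Dw; rewrite /pd -(opprB w v) -(scaleN1r (w - v)) pZ ?normrN1 ?mul1r//; exact: DB.
Qed.

Let pd_tri u v w : D u -> D v -> D w -> pd v w <= pd v u + pd u w.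
Proof.
by move=> Du Dv Dw; rewrite /pd -[v - w](subrKA u); apply: pD; exact: DB.
Qed.

Definition bquot : Type := quot pdxx pd_sym pd_tri.
HB.instance Definition _ := Choice.on bquot.

Definition bcls (v : V) (Dv : D v) : bquot := cls pdxx pd_sym pd_tri (exist _ v Dv).
Definition brep (x : bquot) : V := rep x.

Let brepP x : D (brep x). Proof. exact: repP. Qed.

Let bclsK x : bcls (brepP x) = x. Proof. exact: cls_rep. Qed.

Let bcls_eq v w Dv Dw : p (v - w) = 0 -> @bcls v Dv = @bcls w Dw.
Proof. by move=> h; apply/cls_eq. Qed.

Let brep_cls v Dv : p (brep (@bcls v Dv) - v) = 0.
Proof. exact: (@rep_cls _ _ _ _ pdxx pd_sym pd_tri (exist _ v Dv)). Qed.

Let p_ge0 v : D v -> 0 <= p v.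
Proof.
move=> Dv; rewrite -(@pmulrn_lge0 _ _ 2)// mulr2n -{1}[p v]mul1r -normrN1 -pZ//.
by rewrite scaleN1r addrC -p0 -(subrr v); apply: pD => //; exact: DN.
Qed.

Let p_eq v w : D v -> D w -> p (v - w) = 0 -> p v = p w.
Proof.
move=> Dv Dw h; apply/eqP; rewrite eq_le; apply/andP; split.
  by rewrite -[v](subrK w); apply: le_trans (pD _ Dw) _; rewrite ?h ?add0r//; exact: DB.
rewrite -[w](subrK v); apply: le_trans (pD _ Dv) _; first exact: DB.
by move: h; rewrite -/(pd _ _) pd_sym// /pd => ->; rewrite add0r.
Qed.

Let add x y := bcls (DD (brepP x) (brepP y)).
Let opp x := bcls (DN (brepP x)).
Let zero := bcls D0.
Let scale a x := bcls (DZ a (brepP x)).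

Let bcls_congr v w Dv Dw : v = w -> @bcls v Dv = @bcls w Dw.
Proof. by move=> vw; apply: bcls_eq; rewrite vw subrr. Qed.

Let zeroN v w : D v -> D w -> p v = 0 -> p w = 0 -> p (v + w) = 0.
Proof.
move=> Dv Dw v0 w0; apply/eqP; rewrite eq_le p_ge0 ?andbT; last exact: DD.
by apply: le_trans (pD _ _) _ => //; rewrite v0 w0 addr0.
Qed.

Let addE v w Dv Dw : add (@bcls v Dv) (@bcls w Dw) = bcls (DD Dv Dw).
Proof.
apply: bcls_eq; rewrite opprD addrACA; apply: zeroN; rewrite ?brep_cls//;
  by apply: DB => //; exact: brepP.
Qed.

Let scaleE a v Dv : scale a (@bcls v Dv) = bcls (DZ a Dv).
Proof.
apply: bcls_eq; rewrite -scalerBr pZ ?brep_cls ?mulr0//.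
by apply: DB => //; exact: brepP.
Qed.

Let oppE v Dv : opp (@bcls v Dv) = bcls (DN Dv).
Proof.
apply: bcls_eq; rewrite -opprD -(scaleN1r (_ - v)) pZ ?brep_cls ?mulr0//.
by apply: DB => //; exact: brepP.
Qed.

Let addA : associative add.
Proof.
move=> x y z; rewrite -(bclsK x) -(bclsK y) -(bclsK z) !addE.
by apply: bcls_congr; rewrite addrA.
Qed.

Let addC : commutative add.
Proof. by move=> x y; apply: bcls_congr; rewrite addrC. Qed.

Let add0 : left_id zero add.
Proof. by move=> x; rewrite -(bclsK x) addE; apply: bcls_congr; rewrite add0r. Qed.

Let addN : left_inverse zero opp add.
Proof. by move=> x; rewrite -(bclsK x) oppE addE; apply: bcls_congr; rewrite addNr. Qed.

HB.instance Definition _ := GRing.isZmodule.Build bquot addA addC add0 addN.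

Let scaleA a b x : scale a (scale b x) = scale (a * b) x.
Proof. by rewrite -(bclsK x) !scaleE; apply: bcls_congr; rewrite scalerA. Qed.

Let scale1 : left_id 1 scale.
Proof. by move=> x; rewrite -(bclsK x) !scaleE; apply: bcls_congr; rewrite scale1r. Qed.

Let scaleDr : right_distributive scale add.
Proof.
move=> a x y; rewrite -(bclsK x) -(bclsK y) addE !scaleE addE.
by apply: bcls_congr; rewrite scalerDr.
Qed.

Let scaleDl x a b : scale (a + b) x = add (scale a x) (scale b x).
Proof.
rewrite -(bclsK x) !scaleE !addE.
by apply: bcls_congr; rewrite scalerDl.
Qed.

HB.instance Definition _ := GRing.Zmodule_isLmodule.Build R bquot
  scaleA scale1 scaleDr scaleDl.

Let norm (x : bquot) : R := p (brep x).

Let norm_cls v Dv : norm (@bcls v Dv) = p v.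
Proof. by apply: p_eq => //; exact: brep_cls. Qed.

Let normD x y : norm (x + y) <= norm x + norm y.
Proof. by rewrite [x + y]/(add x y) norm_cls; exact: pD. Qed.

Let normZ (a : R) x : norm (a *: x) = `|a| * norm x.
Proof. by rewrite [a *: x]/(scale a x) norm_cls pZ. Qed.

Let norm_eq0 x : norm x = 0 -> x = 0.
Proof.
by move=> h; rewrite -(bclsK x) -[RHS]/zero; apply: bcls_eq; rewrite subr0.
Qed.

HB.instance Definition _ := Lmodule_isNormed.Build R bquot normD normZ norm_eq0.

Let normE (x : bquot) : `|x| = norm x. Proof. by []. Qed.

Let normB v w Dv Dw : `|@bcls v Dv - @bcls w Dw| = p (v - w).
Proof.
have -> : @bcls v Dv - @bcls w Dw = bcls (DB Dv Dw).
  transitivity (add (bcls Dv) (opp (bcls Dw))) => //.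
  by rewrite oppE addE; exact: bcls_congr.
by rewrite normE norm_cls.
Qed.

(** A Cauchy filter is followed along a sequence of centres of balls of radii
    [2^-(n+2)]; consecutive balls meet, so that the centres satisfy the hypothesis
    of geometric decay. *)
Let complete (F : set_system bquot) : ProperFilter F -> cauchy F -> cvg F.
Proof.
move=> FF /cauchyP Fc.
have half_gt0 n : 0 < 2^-1 ^+ n :> R by rewrite exprn_gt0.
have [x xP] := ex_choice (fun n => Fc (2^-1 ^+ n.+2) (half_gt0 _)).
have [n|l [Dl lP]] := p_complete (fun n => brepP (x n)).
  have [y []] := filter_ex (filterI (xP n) (xP n.+1)).
  rewrite -!ball_normE /= => h1 h2.
  rewrite -(normB (brepP (x n)) (brepP (x n.+1))) !bclsK.
  rewrite -(subrKA y); apply: le_trans (ler_normD _ _) _.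
  rewrite [X in _ + X]distrC; apply: le_trans (lerD (ltW h1) (ltW h2)) _.
  have e1 : 2^-1 ^+ n.+2 <= 2^-1 * 2^-1 ^+ n :> R.
    by rewrite !exprS mulrA ler_wpM2r ?(ltW (half_gt0 n))// ler_piMr// invf_le1// ler1n.
  have e2 : 2^-1 ^+ n.+3 <= 2^-1 * 2^-1 ^+ n :> R.
    rewrite exprS; apply: ler_wpM2l => //; apply: le_trans e1 _.
    by rewrite ler_piMl ?(ltW (half_gt0 n))// invf_le1// ler1n.
  by apply: le_trans (lerD e1 e2) _; set t := 2^-1 ^+ n; lra.
apply: (@cvgP _ _ (bcls Dl)); apply/fcvg_ballP => e e0.
have e4 : 0 < e / 4 by rewrite divr_gt0.
have [n nP] := lP _ e4.
have [N NP] : exists N, 2^-1 ^+ N < e / 4.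
  exists (Num.bound (4 / e)); rewrite exprVn -ltf_pV2 ?posrE ?invr_gt0 ?exprn_gt0 ?divr_gt0//.
  rewrite invrK invf_div; apply: lt_trans (_ : (Num.bound (4 / e))%:R < _).
    by apply: archi_boundP; rewrite divr_ge0// ltW.
  by rewrite -natrX ltr_nat ltn_expl.
pose m := maxn n N.
apply: filterS (xP m) => y; rewrite -!ball_normE /= => ym.
rewrite -(subrKA (x m)); apply: le_lt_trans (ler_normD _ _) _.
rewrite [X in X + _]distrC -{1}(bclsK (x m)) normB.
have h1 := nP m (leq_maxl _ _).
have h2 : `|x m - y| <= e / 4.
  apply: le_trans (ltW ym) _; apply: le_trans (ltW NP).
  by rewrite ler_wiXn2l ?invr_ge0 ?invf_le1 ?ler1n// (leq_trans (leq_maxr n N))// -addn2 leq_addr.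
apply: le_lt_trans (lerD h1 h2) _.
by lra.
Qed.

HB.instance Definition _ := Uniform_isComplete.Build bquot complete.

Definition banach_quotient : completeNormedModType R := bquot.

Lemma banach_quotient_exists : exists (N : completeNormedModType R) (phi : V -> N),
  [/\ (forall x, exists2 z, D z & phi z = x),
      (forall z w, D z -> D w -> `|phi z - phi w| = p (z - w)) &
      (forall a z w, D z -> D w -> phi (a *: z + w) = a *: phi z + phi w)].
Proof.
exists banach_quotient.
pose phi z : banach_quotient := match pselect (D z) with
  | left Dz => bcls Dz
  | right _ => bcls D0 end.
have phiE z (Dz : D z) : phi z = bcls Dz.
  by rewrite /phi; case: pselect => // Dz'; exact: bcls_congr.
exists phi; split.
- by move=> x; exists (brep x); rewrite ?phiE.
- by move=> z w Dz Dw; rewrite !phiE normB.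
- move=> a z w Dz Dw; rewrite (phiE _ (D_lin a Dz Dw)) !phiE.
  transitivity (add (scale a (bcls Dz)) (bcls Dw)) => //.
  by rewrite scaleE addE; exact: bcls_congr.
Qed.

End BanachQuotient.

(** ** Families of points *)

Section Families.
Context (R : realType) (J : Type) (A : J -> lmodType R).

Definition fam : Type := forall j, A j.
HB.instance Definition _ := gen_eqMixin fam.
HB.instance Definition _ := gen_choiceMixin fam.

Let add (z w : fam) : fam := fun j => z j + w j.
Let opp (z : fam) : fam := fun j => - z j.
Let scale (a : R) (z : fam) : fam := fun j => a *: z j.

Let fam_eq (z w : fam) : (forall j, z j = w j) -> z = w.
Proof. exact: functional_extensionality_dep. Qed.

Let addA : associative add. Proof. by move=> x y z; apply: fam_eq => j; exact: addrA. Qed.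
Let addC : commutative add. Proof. by move=> x y; apply: fam_eq => j; exact: addrC. Qed.
Let add0 : left_id (fun=> 0) add. Proof. by move=> x; apply: fam_eq => j; exact: add0r. Qed.
Let addN : left_inverse (fun=> 0) opp add.
Proof. by move=> x; apply: fam_eq => j; exact: addNr. Qed.

HB.instance Definition _ := GRing.isZmodule.Build fam addA addC add0 addN.

Let scaleA a b x : scale a (scale b x) = scale (a * b) x.
Proof. by apply: fam_eq => j; exact: scalerA. Qed.
Let scale1 : left_id 1 scale. Proof. by move=> x; apply: fam_eq => j; exact: scale1r. Qed.
Let scaleDr : right_distributive scale add.
Proof. by move=> a x y; apply: fam_eq => j; exact: scalerDr. Qed.
Let scaleDl x a b : scale (a + b) x = add (scale a x) (scale b x).
Proof. by apply: fam_eq => j; exact: scalerDl. Qed.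

HB.instance Definition _ := GRing.Zmodule_isLmodule.Build R fam
  scaleA scale1 scaleDr scaleDl.

End Families.

(** A monotone, positively homogeneous and subadditive functional on a solid cone
    of non-negative functions: the common features of weighted l_q norms and of
    their limits along an ultrafilter. *)
Record fun_norm (R : realType) (J : Type) (Dn : (J -> R) -> Prop)
    (N : (J -> R) -> R) : Prop := FunNorm {
  fun_norm0 : Dn (fun=> 0);
  fun_normD : forall f g h, Dn f -> Dn g -> (forall j, 0 <= h j <= f j + g j) ->
    Dn h /\ N h <= N f + N g;
  fun_norm_ge0 : forall f, Dn f -> 0 <= N f;
  fun_normZ_le : forall a f, 0 <= a -> Dn f ->
    Dn (fun j => a * f j) /\ N (fun j => a * f j) <= a * N f }.

Lemma fun_normZ (R : realType) (J : Type) (Dn : (J -> R) -> Prop) N :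
  fun_norm Dn N -> forall a f, 0 <= a -> Dn f -> N (fun j => a * f j) = a * N f.
Proof.
move=> DnN a f a0 Df; have [Daf Naf] := fun_normZ_le DnN a0 Df.
apply/eqP; rewrite eq_le Naf/=; have [az|an0] := eqVneq a 0.
  by rewrite [X in X * _]az mul0r; exact: fun_norm_ge0 DnN _ Daf.
have {}a0 : 0 < a by rewrite lt_neqAle eq_sym an0.
have aV0 : 0 <= a^-1 by rewrite invr_ge0 ltW.
have := (fun_normZ_le DnN aV0 Daf).2; rewrite ler_pdivlMl//.
by congr (_ * N _ <= _); apply/funext => j; rewrite mulKf// gt_eqF.
Qed.

Section SpaceQuotient.
Context (R : realType) (K : space_kind) (J : Type) (A : J -> kspace R K).
Context (Dn : (J -> R) -> Prop) (N : (J -> R) -> R) (y : forall j, A j).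
Hypothesis DnN : fun_norm Dn N.

Definition fam_dist (z w : forall j, A j) (j : J) : R := mdist (z j) (w j).

Definition near_base : set (forall j, A j) := [set z | Dn (fam_dist z y)].

Lemma fam_dist_ge0 z w j : 0 <= fam_dist z w j. Proof. exact: mdist_ge0. Qed.

Lemma fam_distC z w : fam_dist z w = fam_dist w z.
Proof. by apply/funext => j; exact: metric_sym. Qed.

Lemma fam_dist_tri x z w j : fam_dist z w j <= fam_dist z x j + fam_dist x w j.
Proof. exact: metric_triangle. Qed.

Lemma fam_distxx z : fam_dist z z = fun=> 0.
Proof. by apply/funext => j; exact: mdistxx. Qed.

Lemma near_base_dist z w : near_base z -> near_base w -> Dn (fam_dist z w).
Proof.
move=> Dz Dw; apply: (fun_normD DnN Dz Dw _).1 => j.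
by rewrite fam_dist_ge0 (fam_distC w) fam_dist_tri.
Qed.

Lemma near_base_tri x z w : near_base x -> near_base z -> near_base w ->
  N (fam_dist z w) <= N (fam_dist z x) + N (fam_dist x w).
Proof.
move=> Dx Dz Dw; apply: (fun_normD DnN _ _ _).2; try exact: near_base_dist.
by move=> j; rewrite fam_dist_ge0 fam_dist_tri.
Qed.

Lemma fun_norm00 : N (fun=> 0) = 0.
Proof.
have := fun_normZ DnN (lexx 0) (fun_norm0 DnN); rewrite [RHS]mul0r => {2}<-.
by congr N; apply/funext => j; rewrite mul0r.
Qed.

(** Geometric decay of the successive distances is enough for completeness, since
    every Cauchy sequence has a subsequence of this kind. *)
Definition complete_families : Prop := forall u : nat -> forall j, A j,
  (forall n, near_base (u n)) ->
  (forall n, N (fam_dist (u n) (u n.+1)) <= 2^-1 ^+ n) ->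
  exists l, near_base l /\ forall e, 0 < e ->
    exists n, forall m, (n <= m)%N -> N (fam_dist (u m) l) <= e.

End SpaceQuotient.

Lemma near_base_y (R : realType) (K : space_kind) (J : Type) (A : J -> kspace R K)
  Dn N (y : forall j, A j) : fun_norm Dn N -> near_base Dn y y.
Proof. by move=> DnN; rewrite /near_base/= fam_distxx; exact: fun_norm0 DnN. Qed.

(** Both kinds of spaces are obtained as quotients of the families at finite
    distance from [y]. In the Banach case such families are [y] plus a linear
    subspace on which [N] is a seminorm of the coordinatewise norms, and the map is
    affine because it is linear after subtraction of [y]. *)
Lemma space_quotient (R : realType) (K : space_kind) (J : Type) (A : J -> kspace R K)
    (Dn : (J -> R) -> Prop) (N : (J -> R) -> R) (y : forall j, A j) :
  fun_norm Dn N ->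
  (K = BanachSpaces -> complete_families Dn N y) ->
  exists (L : kspace R K) (phi : (forall j, A j) -> L),
    [/\ (forall x, exists2 z, near_base Dn y z & phi z = x),
        (forall z w, near_base Dn y z -> near_base Dn y w ->
           mdist (phi z) (phi w) = N (fam_dist z w)) &
        affine_on (near_base Dn y) phi].
Proof.
move=> DnN; case: K A y => A y compl.
  have [|z|z w|x z w|L [phi [phi_surj phi_dist]]] :=
    @metric_quotient_exists R _ (near_base Dn y) (fun z w => N (fam_dist z w)) y.
  - exact: near_base_y DnN.
  - by rewrite fam_distxx (fun_norm00 DnN).
  - by rewrite fam_distC.
  - exact: near_base_tri.
  by exists L, phi.
have {}compl := compl erefl.
pose B : J -> lmodType R := fun j => A j.
pose y' : fam B := y.
pose D (v : fam B) := near_base Dn y (fun j => y j + v j).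
pose nm (v : fam B) (j : J) : R := `|v j|.
have DE v : D v <-> Dn (nm v).
  rewrite /D /near_base/=.
  have -> : fam_dist (A := A) (fun j => y j + v j) y = nm v.
    by apply/funext => j; rewrite /fam_dist mdist_banach addrC addKr.
  by [].
have nmE (z w : forall j, A j) : fam_dist z w = nm ((z : fam B) - (w : fam B)).
  by apply/funext => j; exact: mdist_banach.
have nm_ge0 v j : 0 <= nm v j by exact: normr_ge0.
have D_lin (a : R) v w : D v -> D w -> D (a *: v + w).
  rewrite !DE => Dv Dw.
  have Dav := (fun_normZ_le DnN (normr_ge0 a) Dv).1.
  apply: (fun_normD DnN Dav Dw _).1 => j; rewrite nm_ge0/=.
  by rewrite /nm; apply: le_trans (ler_normD _ _) _; rewrite normrZ.
have [||||L [phi [phi_surj phi_dist phi_lin]]] :=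
  @banach_quotient_exists R (fam B) D (fun v => N (nm v)) _ D_lin.
- apply/DE; have -> : nm 0 = (fun=> 0) by apply/funext => j; exact: normr0.
  exact: fun_norm0 DnN.
- move=> v w; rewrite !DE => Dv Dw; apply: (fun_normD DnN Dv Dw _).2 => j.
  by rewrite nm_ge0 ler_normD.
- move=> a v; rewrite !DE => Dv; rewrite -(fun_normZ DnN (normr_ge0 a) Dv).
  by congr N; apply/funext => j; exact: normrZ.
- move=> u Du uP.
  pose u' n : forall j, A j := fun j => y j + u n j.
  have dE n m : fam_dist (u' n) (u' m) = nm (u n - u m).
    by rewrite nmE; congr nm; apply: functional_extensionality_dep => j;
      rewrite /= /u' -[LHS]/(y j + u n j - (y j + u m j)) opprD addrACA subrr add0r.
  have [//|n|l [Dl lP]] := compl u'; first by rewrite dE.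
  exists (fun j => l j - y j); split.
    rewrite /D; set l' := (X in near_base _ _ X).
    suff -> : l' = l by [].
    by apply: functional_extensionality_dep => j; rewrite /l' subrKC.
  move=> e e0; have [n nP] := lP e e0; exists n => m /nP.
  rewrite nmE; apply: le_trans; rewrite le_eqVlt; apply/orP; left; apply/eqP.
  congr N; congr nm; apply: functional_extensionality_dep => j.
  by rewrite -[LHS]/(u m j - (l j - y j)) -[RHS]/(y j + u m j - l j) opprB addrCA addrA.
have DB z : near_base Dn y z -> D ((z : fam B) - y').
  by rewrite DE -nmE.
exists L, (fun z => phi ((z : fam B) - y')); split.
- move=> x; have [v Dv <-] := phi_surj x.
  exists (fun j => y j + v j) => //; congr phi.
  by apply: functional_extensionality_dep => j; rewrite -[LHS]/(y j + v j - y j) addrC addKr.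
- move=> z w Dz Dw; rewrite mdist_banach phi_dist; [|exact: DB|exact: DB].
  by rewrite opprB addrA subrK -nmE.
- move=> t z w Dz Dw.
  have -> : phi ((z : fam B) - y') = phi (1 *: ((z : fam B) - (w : fam B)) + ((w : fam B) - y')).
    by rewrite scale1r subrKA.
  have Dwz : D ((z : fam B) - (w : fam B)).
    rewrite DE -nmE. exact: (near_base_dist DnN Dz Dw).
  have -> : ((fun j => t *: z j + (1 - t) *: w j) : fam B) - y' =
     t *: ((z : fam B) - (w : fam B)) + ((w : fam B) - y').
    apply: functional_extensionality_dep => j.
    rewrite -[LHS]/(t *: z j + (1 - t) *: w j - y j).
    rewrite -[RHS]/(t *: (z j - w j) + (w j - y j)).
    by rewrite scalerBr scalerBl scale1r addrA addrA addrAC -!addrA [_ + (w j - _)]addrC.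
  rewrite !phi_lin; try exact: DB; try exact: Dwz.
  rewrite scale1r scalerDr -addrA -scalerDl [t + _]addrC subrK scale1r//.
Qed.

(** * Weighted l_q products *)

Lemma geometric_tail (R : realType) (d : nat -> nat -> R) (c : R) : 0 <= c ->
  (forall n, d n n <= 0) -> (forall l m n, d l n <= d l m + d m n) ->
  (forall n, d n n.+1 <= c * 2^-1 ^+ n) ->
  forall n m, (n <= m)%N -> d n m <= 2 * c * 2^-1 ^+ n.
Proof.
move=> c0 d0 dT dS n m /subnKC <-.
suff W k : d n (n + k)%N <= 2 * c * 2^-1 ^+ n - 2 * c * 2^-1 ^+ (n + k).
  apply: le_trans (W _) _; rewrite gerBl.
  by rewrite mulr_ge0 ?exprn_ge0// mulr_ge0.
elim: k => [|k IH]; first by rewrite addn0 subrr.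
rewrite addnS; apply: le_trans (dT _ (n + k)%N _) _.
apply: le_trans (lerD IH (dS _)) _.
by rewrite [in leRHS]exprS; lra.
Qed.

Lemma geometric_small (R : realType) (c e : R) : 0 < e ->
  exists n, forall m, (n <= m)%N -> c * 2^-1 ^+ m <= e.
Proof.
move=> e0.
have half01 : 0 < (2^-1 : R) < 1 by rewrite invr_gt0 ltr0n invf_lt1 ?ltr1n.
have [c0|c0] := leP c 0.
  exists 0%N => m _; apply: le_trans (ltW e0).
  by rewrite mulr_le0_ge0// exprn_ge0.
exists (Num.bound (c / e)) => m nm; rewrite exprVn ler_pdivrMr ?exprn_gt0//.
rewrite mulrC -ler_pdivrMr//; apply: (@le_trans _ _ m%:R).
  apply: (@le_trans _ _ (Num.bound (c / e))%:R); last by rewrite ler_nat.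
  by apply/ltW/archi_boundP; rewrite divr_ge0// ltW.
by rewrite -natrX ler_nat ltnW// ltn_expl.
Qed.

Lemma banach_geometric (R : realType) (V : completeNormedModType R) (u : nat -> V) (c : R) :
  0 <= c -> (forall n, `|u n - u n.+1| <= c * 2^-1 ^+ n) ->
  exists l, forall n, `|u n - l| <= 2 * c * 2^-1 ^+ n.
Proof.
move=> c0 uP.
have tail : forall n m, (n <= m)%N -> `|u n - u m| <= 2 * c * 2^-1 ^+ n.
  apply: (@geometric_tail _ (fun n m => `|u n - u m|)) => //.
    by move=> n; rewrite subrr normr0.
  by move=> l m n; exact: ler_distD.
have /cvg_ex[l ul] : cvg (u @ \oo).
  apply: cauchy_cvg; apply: cauchy_exP => e e0.
  have e2 : 0 < e / 2 by rewrite divr_gt0.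
  have [n nP] := geometric_small (2 * c) e2.
  exists (u n); exists n => // m /= nm; rewrite -ball_normE/=.
  apply: le_lt_trans (tail n m nm) _; apply: le_lt_trans (nP _ (leqnn _)) _.
  by rewrite ltr_pdivrMr// ltr_pMr// ltr1n.
exists l => n; apply/ler_addgt0Pr => e e0.
near \oo => m.
apply: le_trans (ler_distD (u m) _ _) _; apply: lerD.
  by apply: tail; near: m; exact: nbhs_infty_ge.
rewrite distrC ltW//; near: m; exact: (cvgrPdist_lt _ _).1 ul e e0.
Unshelve. all: by end_near. Qed.

Section LqNorm.
Context (R : realType) (q : R) (q1 : 1 <= q) (J : countType) (r : J -> R).
Hypothesis r0 : forall j, 0 < r j.
Implicit Types (f g h : J -> R) (X : {fset J}).

Let q0 : 0 < q. Proof. exact: lt_le_trans q1. Qed.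

Definition lq_esum f : \bar R := (\esum_(j in [set: J]) ((r j * f j) `^ q)%:E)%E.
Definition lq_norm f : R := (fine (lq_esum f)) `^ q^-1.
Definition lq_fin f : Prop := (forall j, 0 <= f j) /\ (lq_esum f < +oo)%E.
Definition lq_part X f : R := nq q X xpredT (fun j => r j * f j).

Lemma lq_esum_ge0 f : (0 <= lq_esum f)%E.
Proof. by apply: esum_ge0 => j _; rewrite lee_fin powR_ge0. Qed.

Lemma lq_esum_leP f c :
  (lq_esum f <= c%:E)%E <-> forall X, \sum_(j <- X) (r j * f j) `^ q <= c.
Proof.
split => [fc X|fc].
  rewrite -lee_fin; apply: le_trans fc; apply: esum_ge; exists [set` X].
    by split => //; exact: finite_fset.
  by rewrite fsbig_finite ?finite_fset//= set_fsetK sumEFin.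
apply: ub_ereal_sup => _ [X [finX _] <-].
by rewrite fsbig_finite//= sumEFin lee_fin.
Qed.

(** An infinite sum of non-negative terms is bounded by [c] as soon as its finite
    parts are: everything reduces to finite norms. *)
Lemma lq_normP f c : (forall j, 0 <= f j) -> 0 <= c ->
  (lq_fin f /\ lq_norm f <= c) <-> forall X, lq_part X f <= c.
Proof.
move=> f0 c0; have cq := powR_ge0 c q.
have -> : (forall X, lq_part X f <= c) <-> (lq_esum f <= (c `^ q)%:E)%E.
  rewrite lq_esum_leP; split=> h X; have := h X; by rewrite /lq_part nq_leP.
split => [[[_ ffin]]|h].
  rewrite powRV_leP// ?fine_ge0 ?lq_esum_ge0// -lee_fin fineK//.
  by rewrite ge0_fin_numE ?lq_esum_ge0.
have ffin : (lq_esum f < +oo)%E by apply: le_lt_trans h _; rewrite ltry.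
split => //; rewrite powRV_leP// ?fine_ge0 ?lq_esum_ge0// -lee_fin fineK//.
by rewrite ge0_fin_numE ?lq_esum_ge0.
Qed.

Lemma lq_norm_ge0 f : 0 <= lq_norm f. Proof. exact: powR_ge0. Qed.

Lemma lq_part_le f X : lq_fin f -> lq_part X f <= lq_norm f.
Proof. by move=> ff; apply: (lq_normP ff.1 (lq_norm_ge0 f)).1. Qed.

Lemma lq_part_tri f g h X : (forall j, 0 <= f j) -> (forall j, 0 <= g j) ->
  (forall j, 0 <= h j <= f j + g j) -> lq_part X h <= lq_part X f + lq_part X g.
Proof.
move=> f0 g0 hfg; apply: nq_tri => //.
- by move=> j _; rewrite mulr_ge0// ltW.
- by move=> j _; rewrite mulr_ge0// ltW.
move=> j _; have /andP[h0 hj] := hfg j.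
by rewrite -mulrDr mulr_ge0 ?(ltW (r0 j))//= ler_wpM2l// ltW.
Qed.

Lemma lq_fun_norm : fun_norm lq_fin lq_norm.
Proof.
have partZ a f X : 0 <= a -> (forall j, 0 <= f j) ->
    lq_part X (fun j => a * f j) = a * lq_part X f.
  move=> a0 f0.
  have rf0 (j : J) : xpredT j -> 0 <= r j * f j by rewrite mulr_ge0// ltW.
  rewrite /lq_part -(nqZ q1 X a0 rf0).
  by apply: eq_nq => j _; rewrite mulrCA.
split.
- apply: ((lq_normP (f := fun=> 0) (fun=> lexx 0) (lexx 0)).2 _).1 => X.
  have -> : lq_part X (fun=> 0) = lq_part X (fun j => 0 * 0).
    by apply: eq_nq => j _; rewrite mul0r.
  by rewrite partZ// mul0r.
- move=> f g h Df Dg hfg.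
  apply: (lq_normP _ _).2; first by move=> j; case/andP: (hfg j).
    by rewrite addr_ge0// lq_norm_ge0.
  move=> X; apply: le_trans (lq_part_tri X Df.1 Dg.1 hfg) _.
  by apply: lerD; exact: lq_part_le.
- by move=> f _; exact: lq_norm_ge0.
- move=> a f a0 Df; apply: (lq_normP _ _).2.
  + by move=> j; rewrite mulr_ge0// Df.1.
  + by rewrite mulr_ge0// lq_norm_ge0.
  + by move=> X; rewrite partZ//; [rewrite ler_wpM2l// lq_part_le|exact: Df.1].
Qed.

Lemma lq_coord f j : lq_fin f -> r j * f j <= lq_norm f.
Proof.
move=> Df; apply: le_trans (lq_part_le [fset j]%fset Df).
have rf0 : 0 <= r j * f j by rewrite mulr_ge0 ?(ltW (r0 j))//; exact: Df.1.
by apply: (@le_nq _ _ q1 _ _ xpredT (fun j => r j * f j)); rewrite ?inE.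
Qed.

(** Coordinatewise limits exist since the weights are positive; the estimate on the
    tails is checked on finitely many coordinates at a time. *)
Lemma lq_complete (A : J -> kspace R BanachSpaces) (y : forall j, A j) :
  complete_families lq_fin lq_norm y.
Proof.
move=> u Du uP.
have Dd n m : lq_fin (fam_dist (u n) (u m)).
  exact: (near_base_dist lq_fun_norm (Du n) (Du m)).
have coord j n : `|(u n j : (A j : completeNormedModType R)) - u n.+1 j| <=
    (r j)^-1 * 2^-1 ^+ n.
  rewrite -[leLHS](mulKf (lt0r_neq0 (r0 j))) ler_wpM2l ?invr_ge0 ?(ltW (r0 j))//.
  exact: le_trans (lq_coord j (Dd n n.+1)) (uP n).
have rV0 j : 0 <= (r j)^-1 by rewrite invr_ge0 ltW.
have lim j := banach_geometric (rV0 j) (coord j).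
pose l j := sval (cid (lim j)).
have lP j n : r j * fam_dist (u n) l j <= 2 * 2^-1 ^+ n.
  rewrite -ler_pdivlMl//; apply: le_trans (svalP (cid (lim j)) n) _.
  by rewrite [_ * (r j)^-1]mulrC mulrA.
have part_tail X n m : (n <= m)%N ->
    lq_part X (fam_dist (u n) (u m)) <= 2 * 2^-1 ^+ n.
  rewrite -[X in _ <= X * _]mulr1.
  apply: (@geometric_tail _ (fun n m => lq_part X (fam_dist (u n) (u m)))) => //.
  - move=> k; rewrite fam_distxx; apply: (lq_normP _ _).1 => //.
    by split; [exact: fun_norm0 lq_fun_norm|rewrite (fun_norm00 lq_fun_norm)].
  - move=> i j k; apply: lq_part_tri => s; first exact: fam_dist_ge0.
      exact: fam_dist_ge0.
    by rewrite fam_dist_ge0 fam_dist_tri.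
  - by move=> k; rewrite mul1r; apply: le_trans (lq_part_le _ _) (uP k).
have part_lim X n : lq_part X (fam_dist (u n) l) <= 2 * 2^-1 ^+ n.
  apply/ler_addgt0Pr => e e0.
  pose c := (count xpredT (X : seq J))%:R `^ q^-1 : R.
  have [N NP] := geometric_small (2 * c) e0.
  pose m := maxn n N.
  apply: (@le_trans _ _ (lq_part X (fam_dist (u n) (u m)) + lq_part X (fam_dist (u m) l))).
    apply: lq_part_tri => s; first exact: fam_dist_ge0.
      exact: fam_dist_ge0.
    by rewrite fam_dist_ge0 fam_dist_tri.
  apply: lerD; first by apply: part_tail; exact: leq_maxl.
  apply: le_trans (NP m (leq_maxr _ _)).
  have c2 : 0 <= 2 * 2^-1 ^+ m :> R by rewrite mulr_ge0// exprn_ge0.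
  rewrite mulrAC -(nq_const q1 X xpredT c2); apply: (nq_le q1) => j _.
  by rewrite lP andbT; apply: mulr_ge0; [exact: ltW|exact: fam_dist_ge0].
have lim_norm n : lq_fin (fam_dist (u n) l) /\ lq_norm (fam_dist (u n) l) <= 2 * 2^-1 ^+ n.
  have c2 : 0 <= 2 * 2^-1 ^+ n :> R by rewrite mulr_ge0// exprn_ge0.
  exact: (lq_normP (fam_dist_ge0 (u n) l) c2).2 (fun X => part_lim X n).
exists l; split.
  apply: (fun_normD lq_fun_norm (lim_norm 0%N).1 (Du 0%N) _).1 => j.
  by rewrite fam_dist_ge0 (fam_distC (u 0%N) l) fam_dist_tri.
move=> e e0; have [n nP] := geometric_small 2 e0; exists n => m nm.
exact: le_trans (lim_norm m).2 (nP m nm).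
Qed.

Lemma lq_product_exists (K : space_kind) (A : J -> kspace R K) (y : forall j, A j) :
  exists (N : kspace R K) (phi : (forall j, A j) -> N),
    is_lq_product q r (lq_domain q r y) phi.
Proof.
have domE : near_base lq_fin y = lq_domain q r y.
  apply/seteqP; split => z; first by case.
  by move=> zy; split => // j; exact: fam_dist_ge0.
have [K0|L [phi [phi_surj phi_dist phi_aff]]] := @space_quotient R K J A _ _ y lq_fun_norm.
  by subst K; exact: lq_complete.
by exists L, phi; rewrite -domE.
Qed.

End LqNorm.

Lemma finite_lq_sumE (R : realType) (q : R) (J : finType) (M : metricType R)
    (r : J -> R) (z w : J -> M) :
  lq_sum (M := fun=> M) q r z w = (\sum_j (r j * mdist (z j) (w j)) `^ q)%:E.
Proof.
have fT : finite_set [set: J] by exact: finite_finset.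
rewrite /lq_sum (esum_fset fT); last by move=> j _; rewrite lee_fin powR_ge0.
rewrite (fsbig_finite _ _ fT)/= sumEFin; congr (_%:E).
rewrite -[RHS]big_enum/=; apply: perm_big; apply: uniq_perm => [||j].
- exact: fset_uniq.
- exact: enum_uniq.
- by rewrite mem_enum in_fset_set// in_setT.
Qed.

Lemma finite_lq_product_exists (R : realType) (K : space_kind) (q : R) (J : finType)
    (M : kspace R K) (r : J -> R) (y : M) : 1 <= q -> (forall j, 0 < r j) ->
  exists (N : kspace R K) (phi : (J -> M) -> N),
    is_lq_product (M := fun=> M) q r [set: J -> M] phi.
Proof.
move=> q1 r0; have [N [phi phiP]] := lq_product_exists q1 r0 (fun _ : J => y).
exists N, phi; suff <- : lq_domain (M := fun=> M) q r (fun _ : J => y) = [set: J -> M] by [].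
by apply/seteqP; split => // z _; rewrite /lq_domain/= finite_lq_sumE ltry.
Qed.

(** * Limits of l_q norms along an ultrafilter *)

(** Take for [rho i] the largest scale up to [i] at which the property holds at [i]. *)
Lemma diagonal (F : set_system nat) {FF : Filter F} (P : nat -> nat -> Prop) :
  \oo `<=` F -> (forall r, \forall i \near F, P r i) ->
  exists rho : nat -> nat, (forall i, (0 < rho i)%N -> P (rho i) i) /\
    forall r, \forall i \near F, (r <= rho i)%N.
Proof.
move=> oF PF.
pose best i := fix best n := if n is n'.+1 then
  (if `[< P n i >] then n else best n') else 0%N.
have bestP i n : (0 < best i n)%N -> P (best i n) i.
  by elim: n => //= n IH; case: asboolP.
have best_ge i n r : (r <= n)%N -> P r i -> (r <= best i n)%N.
  elim: n => [|n IH]; first by rewrite leqn0 => /eqP ->.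
  rewrite leq_eqVlt => /orP[/eqP -> /= Pn|rn Pr /=]; first by case: asboolP.
  by case: asboolP => _; [exact: ltnW|exact: IH].
exists (fun i => best i i); split => [i|r]; first exact: bestP.
have ge_r : \forall i \near F, (r <= i)%N by apply: oF; exact: nbhs_infty_ge.
near=> i.
have h1 : (r <= i)%N by near: i.
have h2 : P r i by near: i; exact: PF.
exact: (best_ge i i r h1 h2).
Unshelve. all: by end_near. 
Qed.

Lemma ultra_bounded_cvg (R : realType) (U : set_system nat) (u : nat -> R) (c : R) :
  UltraFilter U -> (forall m, 0 <= u m <= c) -> cvg (u m @[m --> U]).
Proof.
move=> UU uc.
have FU : ProperFilter U by exact: ultra_proper.
have [|p [_ up]] := @segment_compact R 0 c (u @ U) _.
  by apply: (@filterE _ U) => m; rewrite /= in_itv/=; exact: uc.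
apply: (@cvgP _ _ p) => V Vp.
have [//|UV] := in_ultra_setVsetC (u @^-1` V) UU.
by have [x []] := up (~` V) V UV Vp.
Qed.

Section UltraNorm.
Context (R : realType) (q : R) (q1 : 1 <= q) (Phi : nat -> finType).
Hypothesis Phi0 : forall m, (0 < #|Phi m|)%N.
Context (U : set_system nat) (UU : UltraFilter U) (oU : \oo `<=` U).
Implicit Types (f g h : {m & Phi m} -> R) (b : bool).

Let FU : ProperFilter U. Proof. exact: ultra_proper. Qed.
Let q0 : 0 < q. Proof. exact: lt_le_trans q1. Qed.

(** With this weight the norm of a constant function is that constant. *)
Definition weight m : R := #|Phi m|%:R `^ (- q^-1).

Lemma weight_gt0 m : 0 < weight m.
Proof. by rewrite powR_gt0// ltr0n. Qed.

Definition unorm m (E : {set Phi m}) f : R :=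
  nq q (index_enum (Phi m)) [in E] (fun a => weight m * f (existT _ m a)).

Definition unormT m f := unorm [set: Phi m] f.

Lemma unorm_ge0 m (E : {set Phi m}) f : 0 <= unorm E f.
Proof. exact: nq_ge0. Qed.

Lemma unorm_tri m (E : {set Phi m}) f g h :
  (forall j, 0 <= f j) -> (forall j, 0 <= g j) ->
  (forall a, a \in E -> 0 <= h (existT _ m a) <= f (existT _ m a) + g (existT _ m a)) ->
  unorm E h <= unorm E f + unorm E g.
Proof.
move=> f0 g0 hfg; have w0 := ltW (weight_gt0 m); apply: nq_tri => //.
- by move=> a _; rewrite mulr_ge0.
- by move=> a _; rewrite mulr_ge0.
by move=> a /hfg/andP[h0 ha]; rewrite -mulrDr mulr_ge0//= ler_wpM2l.
Qed.

Lemma unorm_le m (E : {set Phi m}) f g :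
  (forall a, a \in E -> 0 <= f (existT _ m a) <= g (existT _ m a)) ->
  unorm E f <= unorm E g.
Proof.
move=> fg; have w0 := ltW (weight_gt0 m); apply: nq_le => // a /fg/andP[f0 fa].
by rewrite mulr_ge0//= ler_wpM2l.
Qed.

Lemma unorm_sub m (E E' : {set Phi m}) f : E \subset E' -> unorm E f <= unorm E' f.
Proof. by move=> /fintype.subsetP EE'; exact: nq_sub. Qed.

Lemma unorm_subT m (E : {set Phi m}) f : unorm E f <= unormT m f.
Proof. exact/unorm_sub/finset.subsetT. Qed.

Lemma unormZ m (E : {set Phi m}) a f : 0 <= a -> (forall j, 0 <= f j) ->
  unorm E (fun j => a * f j) = a * unorm E f.
Proof.
move=> a0 f0; rewrite /unorm.
have wf0 i : i \in E -> 0 <= weight m * f (existT _ m i).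
  by move=> _; rewrite mulr_ge0// ltW// weight_gt0.
rewrite -(nqZ q1 (index_enum (Phi m)) a0 wf0).
by apply: eq_nq => j _; rewrite mulrCA.
Qed.

Lemma unorm_split m (E : {set Phi m}) f : (forall j, 0 <= f j) ->
  unormT m f <= unorm E f + unorm (~: E) f.
Proof.
move=> f0; have w0 := ltW (weight_gt0 m).
have wf0 a : a \in finset.setTfor (Phi m) -> 0 <= weight m * f (existT _ m a).
  by move=> _; rewrite mulr_ge0.
apply: (le_trans (nq_split q1 (index_enum (Phi m)) [in E] wf0)).
by apply: lerD; apply: (nq_sub q1) => a; rewrite !inE.
Qed.

Lemma unorm_powR_split m (E : {set Phi m}) f :
  unormT m f `^ q = unorm E f `^ q + unorm (~: E) f `^ q.
Proof.
rewrite /unormT /unorm !(nq_powR q1) (bigID [in E])/=.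
by congr (_ + _); apply: eq_bigl => a; rewrite !inE.
Qed.

Lemma unorm_const m (E : {set Phi m}) c : 0 <= c ->
  unorm E (fun=> c) = c * (#|E|%:R / #|Phi m|%:R) `^ q^-1.
Proof.
move=> c0; have w0 := ltW (weight_gt0 m).
rewrite /unorm nq_const ?mulr_ge0// [weight m * c]mulrC -mulrA; congr (c * _).
have -> : count [in E] (index_enum (Phi m)) = #|E|.
  by rewrite -sum1_count sum1_card.
rewrite powRM ?invr_ge0 ?ler0n// mulrC; congr (_ * _).
by rewrite /weight -[in RHS]powR_inv1 ?ler0n// -powRrM mulN1r.
Qed.

Lemma unormT_const m c : 0 <= c -> unormT m (fun=> c) = c.
Proof.
move=> c0; rewrite /unormT unorm_const// cardsT divff ?powR1 ?mulr1//.
by rewrite pnatr_eq0 -lt0n.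
Qed.

Lemma unorm0 m (E : {set Phi m}) f : #|E| = 0%N -> unorm E f = 0.
Proof.
move=> /cards0_eq ->; rewrite /unorm nqE big_pred0 ?powR0 ?invr_neq0 ?gt_eqF//.
by move=> a; rewrite /= inE.
Qed.

(** For [b = false] these are the sequences of subsets of vanishing density; for
    [b = true] the threshold [e = 0] is included, which forces the subsets to be
    eventually empty. *)
Definition null b (E : forall m, {set Phi m}) : Prop := forall e : R,
  0 < e ?<= if b -> \forall m \near U, #|E m|%:R <= e * #|Phi m|%:R.

Lemma nullW b E : null b E -> null false E.
Proof. by move=> h e /= e0; apply: h; case: b => //=; exact: ltW. Qed.

Lemma null_le b (E E' E'' : forall m, {set Phi m}) :
  (\forall m \near U, (#|E'' m| <= #|E m| + #|E' m|)%N) ->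
  null b E -> null b E' -> null b E''.
Proof.
move=> EE hE hE' e e0.
have e2 : 0 < e / 2 ?<= if b.
  by case: b e0 {hE hE'} => /= e0; [rewrite divr_ge0|rewrite divr_gt0].
near=> m.
have h : (#|E'' m| <= #|E m| + #|E' m|)%N by near: m.
have h1 : #|E m|%:R <= e / 2 * #|Phi m|%:R by near: m; exact: hE.
have h2 : #|E' m|%:R <= e / 2 * #|Phi m|%:R by near: m; exact: hE'.
apply: (@le_trans _ _ (#|E m| + #|E' m|)%:R); first by rewrite ler_nat.
rewrite natrD; apply: le_trans (lerD h1 h2) _.
by rewrite -mulrDl -splitr.
Unshelve. all: by end_near. Qed.

Lemma null_true_unorm E f : null true E -> \forall m \near U, unorm (E m) f = 0.
Proof.
move=> /(_ 0 (lexx 0)); apply: filterS => m.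
by rewrite mul0r lern0 => /eqP; exact: unorm0.
Qed.

Lemma null_const b E c : 0 <= c -> null b E ->
  unorm (E m) (fun=> c) @[m --> U] --> (0 : R).
Proof.
move=> c0 /nullW hE; apply/cvgrPdist_le => e e0.
pose d := (e / (c + 1)) `^ q.
have c1 : 0 < c + 1 by rewrite ltr_wpDl.
have d0 : 0 < d by rewrite powR_gt0// divr_gt0.
apply: filterS (hE d d0) => m Em.
rewrite sub0r normrN ger0_norm ?unorm_ge0// unorm_const//.
apply: (@le_trans _ _ ((c + 1) * (d `^ q^-1))); last first.
  have -> : d `^ q^-1 = e / (c + 1) by rewrite /d powRK// divr_ge0// ltW.
  by rewrite mulrC divfK// gt_eqF.
apply: ler_pM; rewrite ?powR_ge0// ?lerDl//.
by apply: powRV_le; rewrite ?divr_ge0// ler_pdivrMr// ltr0n.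
Qed.

Lemma cvg0_le (u v : nat -> R) : (forall m, 0 <= u m) ->
  (\forall m \near U, u m <= v m) -> v m @[m --> U] --> (0 : R) ->
  u m @[m --> U] --> (0 : R).
Proof.
move=> u0 uv v0; apply: (@squeeze_cvgr _ _ _ _ (fun=> 0) v) => //.
  by apply: filterS uv => m ->; rewrite u0.
exact: cvg_cst.
Qed.

Definition ultra_fin b f : Prop := [/\ forall j, 0 <= f j,
  exists c, forall m, unormT m f <= c &
  forall E, null b E -> unorm (E m) f @[m --> U] --> (0 : R)].

Definition ultra_norm f : R := lim (unormT m f @[m --> U]).

Lemma bounded_ultra_norm f c : (forall m, unormT m f <= c) ->
  unormT m f @[m --> U] --> ultra_norm f.
Proof.
move=> fc; apply: ultra_bounded_cvg => m.
by apply/andP; split; [exact: unorm_ge0|exact: fc].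
Qed.

Lemma ultra_norm_cvg b f : ultra_fin b f -> unormT m f @[m --> U] --> ultra_norm f.
Proof. by move=> [_ [c fc] _]; exact: bounded_ultra_norm fc. Qed.

Lemma ultra_fin_true f : (forall j, 0 <= f j) ->
  (exists c, forall m, unormT m f <= c) -> ultra_fin true f.
Proof.
move=> f0 fc; split => // E /(null_true_unorm f) h.
apply: (@cvg0_le _ (fun=> 0)).
- by move=> m; exact: unorm_ge0.
- by apply: filterS h => m ->.
- exact: cvg_cst.
Qed.

Lemma ultra_finW b f : ultra_fin b f -> ultra_fin true f.
Proof. by case=> f0 fc _; exact: ultra_fin_true. Qed.

Lemma ultra_norm_near f l : unormT m f @[m --> U] --> l -> ultra_norm f = l.
Proof. by move=> h; apply: cvg_lim => //; exact: norm_hausdorff. Qed.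

Lemma ultra_fun_norm b : fun_norm (ultra_fin b) ultra_norm.
Proof.
have zero : ultra_fin b (fun=> 0).
  split => // [|E hE]; last exact: null_const hE.
  by exists 0 => m; rewrite unormT_const.
split => //.
- move=> f g h Df Dg hfg.
  have [f0 [cf fc] fE] := Df; have [g0 [cg gc] gE] := Dg.
  have tri m (E : {set Phi m}) : unorm E h <= unorm E f + unorm E g.
    by apply: unorm_tri.
  have Dh : ultra_fin b h.
    split; first by move=> j; case/andP: (hfg j).
      by exists (cf + cg) => m; apply: le_trans (tri _ _) _; apply: lerD; [exact: fc|exact: gc].
    move=> E hE; apply: (@cvg0_le _ (fun m => unorm (E m) f + unorm (E m) g)).
    + by move=> m; exact: unorm_ge0.
    + by near=> m; exact: tri.
    + by rewrite -[0]addr0; apply: cvgD; [exact: fE|exact: gE].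
  split => //.
  apply: (ler_cvg_to (ultra_norm_cvg Dh) (cvgD (ultra_norm_cvg Df) (ultra_norm_cvg Dg))).
  by near=> m; exact: tri.
- move=> f Df; apply: (ler_cvg_to (cvg_cst 0) (ultra_norm_cvg Df)).
  by near=> m; exact: unorm_ge0.
- move=> a f a0 [f0 [c fc] fE].
  have D : ultra_fin b (fun j => a * f j).
    split; first by move=> j; rewrite mulr_ge0.
      by exists (a * c) => m; rewrite /unormT unormZ//; apply: ler_wpM2l => //; exact: fc.
    move=> E /fE h; rewrite -[0](mulr0 a).
    have -> : (fun m => unorm (E m) (fun j => a * f j)) = (fun m => a * unorm (E m) f).
      by apply/funext => m; rewrite unormZ.
    by apply: cvgM h; exact: cvg_cst.
  split => //; rewrite le_eqVlt; apply/orP; left; apply/eqP.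
  apply: ultra_norm_near.
  have -> : (fun m => unormT m (fun j => a * f j)) = (fun m => a * unormT m f).
    by apply/funext => m; rewrite /unormT unormZ.
  by apply: cvgM; [exact: cvg_cst|exact: bounded_ultra_norm fc].
Unshelve. all: by end_near. Qed.

(** On a null set [f] is at most [g], which vanishes there in the limit, plus an
    error which is small on the whole. *)
Lemma ultra_fin_closed b f : (forall j, 0 <= f j) ->
  (exists c, forall m, unormT m f <= c) ->
  (forall e, 0 < e -> exists g h, [/\ ultra_fin b g, (forall j, 0 <= h j),
     (forall j, f j <= g j + h j) & \forall m \near U, unormT m h <= e]) ->
  ultra_fin b f.
Proof.
move=> f0 fc app; split => // E hE; apply/cvgrPdist_le => e e0.
have e2 : 0 < e / 2 by rewrite divr_gt0.
have [g [h [[g0 _ gE] h0 fgh hm]]] := app _ e2.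
have gm := (cvgrPdist_le _ _).1 (gE E hE) _ e2.
near=> m; rewrite sub0r normrN ger0_norm ?unorm_ge0//.
have fm : unorm (E m) f <= unorm (E m) g + unorm (E m) h.
  by apply: unorm_tri => // a _; rewrite f0 fgh.
apply: le_trans fm _; rewrite [e]splitr; apply: lerD.
  have : `|0 - unorm (E m) g| <= e / 2 by near: m; exact: gm.
  by rewrite sub0r normrN ger0_norm// unorm_ge0.
apply: le_trans (unorm_subT _ _) _; near: m; exact: hm.
Unshelve. all: by end_near. Qed.

(** The limit space is complete whatever the factors are: a Cauchy sequence of
    families is replaced by one of its terms, depending on the index [m]. *)
Lemma ultra_complete b (K : space_kind) (A : {m & Phi m} -> kspace R K) (y : forall j, A j) :
  complete_families (ultra_fin b) ultra_norm y.
Proof.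
move=> u Du uP; have fnb := ultra_fun_norm b.
have Dd n m : ultra_fin b (fam_dist (u n) (u m)).
  exact: (near_base_dist fnb (Du n) (Du m)).
(* The factor 2 leaves room between the limit norm and its approximations. *)
pose S i m := unormT m (fam_dist (u i) (u i.+1)) <= 2 * 2^-1 ^+ i.
have SU i : \forall m \near U, S i m.
  have h := ultra_norm_cvg (Dd i i.+1).
  have p : 0 < 2^-1 ^+ i :> R by rewrite exprn_gt0.
  have h2 := (cvgrPdist_le _ _).1 h _ p.
  near=> m; rewrite /S.
  have : `|ultra_norm (fam_dist (u i) (u i.+1)) - unormT m (fam_dist (u i) (u i.+1))| <= 2^-1 ^+ i.
    by near: m; exact: h2.
  by rewrite ler_norml => /andP[h3 _]; have := uP i; lra.
have [rho [rhoP rho_oo]] : exists rho : nat -> nat,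
    (forall m, (0 < rho m)%N -> forall i, (i < rho m)%N -> S i m) /\
    forall r, \forall m \near U, (r <= rho m)%N.
  apply: (@diagonal _ _ (fun r m => forall i, (i < r)%N -> S i m) oU).
  elim=> [|r IH]; first by near=> m.
  apply: filterS2 IH (SU r) => m h1 h2 i; rewrite ltnS leq_eqVlt.
  by move=> /orP[/eqP ->//|]; exact: h1.
pose l j := u (rho (tag j)) j.
have lE n m : unormT m (fam_dist (u n) l) = unormT m (fam_dist (u n) (u (rho m))) by [].
have tri (z w x : forall j, A j) m :
    unormT m (fam_dist z x) <= unormT m (fam_dist z w) + unormT m (fam_dist w x).
  apply: unorm_tri => *; rewrite ?fam_dist_ge0//; exact: fam_dist_tri.
have tail n m : (n <= rho m)%N -> unormT m (fam_dist (u n) l) <= 4 * 2^-1 ^+ n.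
  move=> nr; rewrite lE.
  pose c i := minn i (rho m).
  have := @geometric_tail _ (fun i k => unormT m (fam_dist (u (c i)) (u (c k)))) 2 (ler0n _ 2).
  move=> /(_ _ _ _ n (rho m) nr).
  rewrite /c minnn (minn_idPl nr) -natrM; apply.
  - by move=> i; rewrite fam_distxx unormT_const.
  - by move=> i j k; exact: tri.
  - move=> i /=; rewrite /c; have [ir|ri] := ltnP i (rho m).
      rewrite (minn_idPl ir).
      by apply: rhoP => //; exact: leq_ltn_trans ir.
    rewrite (minn_idPr (leqW ri)) fam_distxx unormT_const.
      by rewrite mulr_ge0// exprn_ge0.
    exact: lexx.
have l0 : exists c, forall m, unormT m (fam_dist l y) <= c.
  have [_ [c uc] _] := Du 0%N; exists (4 * 2^-1 ^+ 0 + c) => m.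
  apply: le_trans (tri _ (u 0%N) _ _) _; apply: lerD (uc m).
  by rewrite fam_distC; exact: tail.
have Dl : near_base (ultra_fin b) y l.
  apply: ultra_fin_closed => //; first by move=> j; exact: fam_dist_ge0.
  move=> e e0; have [n nP] := geometric_small 4 e0.
  exists (fam_dist (u n) y), (fam_dist l (u n)); split.
  + exact: Du.
  + exact: fam_dist_ge0.
  + by move=> j; rewrite addrC; exact: fam_dist_tri.
  + apply: filterS (rho_oo n) => m nr; rewrite fam_distC.
    by apply: le_trans (tail _ _ nr) _; exact: nP.
exists l; split => // e e0; have [n nP] := geometric_small 4 e0.
exists n => m nm.
have Dml : ultra_fin b (fam_dist (u m) l) by exact: (near_base_dist fnb (Du m) Dl).
apply: (ler_cvg_to (ultra_norm_cvg Dml) (cvg_cst e)).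
apply: filterS (rho_oo m) => i mi.
by apply: le_trans (tail _ _ mi) _; exact: nP.
Unshelve. all: by end_near. Qed.

Lemma ultra_space_exists b (K : space_kind) (M : kspace R K) (y : {m & Phi m} -> M) :
  exists (L : kspace R K) (phi : ({m & Phi m} -> M) -> L),
    [/\ (forall x, exists2 z, near_base (A := fun=> M) (ultra_fin b) y z & phi z = x),
        (forall z w, near_base (A := fun=> M) (ultra_fin b) y z ->
           near_base (A := fun=> M) (ultra_fin b) y w ->
           mdist (phi z) (phi w) = ultra_norm (fam_dist (A := fun=> M) z w)) &
        affine_on (A := fun=> M) (near_base (A := fun=> M) (ultra_fin b) y) phi].
Proof.
by apply: space_quotient; [exact: ultra_fun_norm|move=> _; exact: ultra_complete].
Qed.

End UltraNorm.

(** * From equivariant embeddings to fibred coarse embeddings *)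

Lemma right_action_isometric (R : realType) (G : groupType) (M : metricType R)
    (alpha : M -> G -> M) :
  (forall y, alpha y 1%g = y) ->
  (forall y g h, alpha y (g * h)%g = alpha (alpha y g) h) ->
  (forall g x y, mdist (alpha x g) (alpha y g) = mdist x y) ->
  isometric_right_action alpha.
Proof.
move=> a1 aM ai; split => // g; split; first exact: ai.
by move=> y; exists (alpha y (g^-1)%g); rewrite -aM mulVg a1.
Qed.

Section FibredOfActions.
Context (R : realType) (K : space_kind) (MM : space_class R K) (k : nat).
Context (G : nat -> marked_group k) (B : Type) (H : B -> marked_group k).
Context (N : kspace R K) (alpha : forall j : B, N -> H j -> N) (y : N).
Context (rho omega : R -> R).

Lemma du_distE m (g h : G m) :
  du_dist (X := cayleys R G) (existT _ m g) (existT _ m h) = ((cay_dist g h)%:R)%:E.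
Proof. by rewrite /du_dist/= eqxx tagged_asE. Qed.

Lemma small_subset_tag (r : R) n (C : set {m : nat & cayleys R G m}) m (c : G m) x :
  small_subset r n C -> C (existT _ m c) -> C x ->
  exists g : G m, x = existT _ m g /\ (cay_dist c g)%:R <= r.
Proof.
move=> [_ _ Cr] Cc Cx; have := Cr _ _ Cc Cx; case: x Cx => m' g Cx.
rewrite /du_dist/=; case: eqP => // e; subst m'.
by rewrite tagged_asE lee_fin => dr; exists g.
Qed.

(** On a component whose balls are those of [H j], a small set around a base point
    [c] is trivialised by letting the element of [H j] spelled like [g c^-1] act;
    right translation invariance makes the transition maps independent of [g]. *)
Lemma fibred_of_actions : MM N ->
  (forall j, isometric_right_action (@alpha j)) ->
  (forall j (g h : H j), rho (cay_dist g h)%:R <= mdist (@alpha j y g) (@alpha j y h) /\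
     mdist (@alpha j y g) (@alpha j y h) <= omega (cay_dist g h)%:R) ->
  (forall n, \forall m \near \oo, exists j, agree n (G m) (H j)) ->
  fibred_coarse_embedding MM (cayleys R G) rho omega.
Proof.
move=> MN act bounds agr.
exists N, (fun=> N), (fun=> y); split => //.
  by move=> _; exists id; apply: isometry_space_iso; split => // x; exists x.
move=> r r0; pose r' := Num.bound r.
have rr' d : d%:R <= r -> (d <= r')%N.
  move=> dr; rewrite -(ler_nat R); apply: le_trans dr _.
  exact/ltW/archi_boundP.
(* Every identity below involves at most four elements of length at most [r']. *)
have [n0 _ n0P] := agr (4 * r')%N.
have [j0 _] := n0P n0 (leqnn n0).
have [jj jjP] : exists jj : nat -> B,
    forall m, (n0 <= m)%N -> agree (4 * r') (G m) (H (jj m)).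
  apply: (@ex_choice _ _ (fun m j => (n0 <= m)%N -> agree (4 * r') (G m) (H j))) => m.
  case: (leqP n0 m) => [mn|_]; last by exists j0.
  by have [j jP] := n0P m mn; exists j.
pose base (C : set {m : nat & cayleys R G m}) : {m : nat & cayleys R G m} :=
  match pselect (exists x, C x) with
  | left h => projT1 (cid h)
  | right _ => existT _ 0%N (1%g : G 0%N)
  end.
have baseP C : C !=set0 -> C (base C).
  by move=> C0; rewrite /base; case: pselect => // h; exact: projT2 (cid h).
pose w (C : set {m : nat & cayleys R G m}) (x : {m : nat & cayleys R G m}) : word k :=
  geod ((tagged x : G (tag x)) * ((tagged_as x (base C) : G (tag x))^-1))%g.
pose t C x (p : N) : N := @alpha (jj (tag x)) p (ev (H (jj (tag x))) (w C x)).
have shape C x : small_subset r n0.+1 C -> C x ->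
    exists (m : nat) (c : G m), [/\ (n0 <= m)%N, base C = existT _ m c,
      tag x = m & forall z, C z -> exists g : G m, [/\ z = existT _ m g,
        (size (geod (g * c^-1)%g) <= r')%N & w C z = geod (g * c^-1)%g]].
  move=> Cs Cx; have [C0 Cn _] := Cs; have := baseP C C0.
  case bC : (base C) => [m c] Cc; exists m, c.
  have zP z : C z -> exists g : G m, [/\ z = existT _ m g,
        (size (geod (g * c^-1)%g) <= r')%N & w C z = geod (g * c^-1)%g].
    move=> /(small_subset_tag Cs Cc)[g [-> dr]]; exists g; split => //.
      rewrite size_geod; apply: rr'; rewrite -(cay_distMr _ _ c).
      by rewrite mul1g mulgVK.
    by rewrite /w bC /= tagged_asE.
  split => //; first by have := Cn _ Cc => /ltnW.
  by have [g [-> _ _]] := zP x Cx.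
exists n0.+1, t; split => //.
- by move=> C _ x _; apply: isometry_space_iso; have [_ _] := act (jj (tag x)); exact.
- move=> C Cs x1 x2 C1 C2; have [m [c [nm bC _ CP]]] := shape C x1 Cs C1.
  have [g1 [-> s1 w1]] := CP _ C1; have [g2 [-> s2 w2]] := CP _ C2.
  rewrite /t w1 w2 /= du_distE /=.
  have -> : cay_dist g1 g2 = cay_dist (ev (H (jj m)) (geod (g1 * c^-1)%g))
                                       (ev (H (jj m)) (geod (g2 * c^-1)%g)).
    rewrite -(cay_distMr _ _ (c^-1)%g) -{1}(ev_geod (g1 * c^-1)%g) -{1}(ev_geod (g2 * c^-1)%g).
    apply: agree_dist (jjP m nm) _.
    apply: (@leq_trans (2 * (r' + r'))); first by rewrite leq_mul2l/= leq_add.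
    by rewrite addnn -mul2n mulnA.
  exact: bounds.
- move=> C1 C2 Cs1 Cs2 [x0 [C1x0 C2x0]].
  have [m [c1 [nm bC1 _ CP1]]] := shape C1 x0 Cs1 C1x0.
  have [m' [c2 [_ bC2 tx0 CP2]]] := shape C2 x0 Cs2 C2x0.
  have [g0 [x0E s10 w10]] := CP1 _ C1x0.
  move: tx0; rewrite x0E /= => mm'; subst m'.
  have [g0' [x0E' s20 w20]] := CP2 _ C2x0.
  have g0E : g0' = g0.
    by move: x0E'; rewrite x0E => /eqP; rewrite eq_Tagged/= => /eqP.
  rewrite {}g0E in x0E' s20 w20.
  have [a1 aM ai] := act (jj m).
  pose u (p : N) : N := @alpha (jj m) p
    ((ev (H (jj m)) (geod (g0 * c2^-1)%g))^-1 * ev (H (jj m)) (geod (g0 * c1^-1)%g))%g.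
  exists u; split; first by apply: isometry_space_iso; exact: ai.
  move=> x [C1x C2x] p.
  have [g [xE s1 w1]] := CP1 _ C1x; have [g' [xE' s2 w2]] := CP2 _ C2x.
  have gE : g' = g by move: xE'; rewrite xE => /eqP; rewrite eq_Tagged/= => /eqP.
  rewrite {}gE in xE' s2 w2.
  rewrite /t w1 w2 xE /= /u -aM; congr (@alpha _ _ _).
  rewrite -!ev_inv -!ev_cat; apply/(agree_eq (jjP m nm)).
    rewrite !size_cat size_inv_word -!addnA !mulSn mul0n addn0.
    by rewrite !leq_add.
  rewrite !ev_cat ev_inv !ev_geod invgM invgK.
  by rewrite !mulgA !mulgVK.
Qed.

End FibredOfActions.

Section LqActions.
Context (R : realType) (K : space_kind) (MM : space_class R K) (q : R) (q1 : 1 <= q).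
Context (B : countType) (H : B -> groupType) (M : B -> kspace R K).
Context (alpha : forall j, M j -> H j -> M j) (y : forall j, M j).
Hypothesis act : forall j, isometric_right_action (@alpha j).
Hypothesis MMM : forall j, MM (M j).

Let one : B -> R := fun=> 1.
Let one0 j : 0 < one j. Proof. exact: ltr01. Qed.

Lemma lq_fin_single j (c : R) (f : B -> R) : 0 <= c -> f j = c ->
  (forall i, i != j -> f i = 0) -> lq_fin q one f /\ lq_norm q one f = c.
Proof.
move=> c0 fj fi.
have f0 i : 0 <= f i by have [->|/fi ->] := eqVneq i j; rewrite ?fj.
have qn0 : q != 0 by rewrite gt_eqF// (lt_le_trans ltr01).
have [fin le_c] : lq_fin q one f /\ lq_norm q one f <= c.
  apply: (lq_normP q1 one f0 c0).2 => X; rewrite /lq_part (nq_leP q1 _ _ _ c0).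
  have zero (s : seq B) : j \notin s -> \sum_(i <- s) (one i * f i) `^ q = 0.
    move=> js; rewrite big_seq big1// => i si; rewrite fi ?mulr0 ?powR0//.
    by apply: contraNneq js => <-.
  have [jX|jX] := boolP (j \in X); last by rewrite zero// powR_ge0.
  rewrite (big_rem j)//= fj mul1r zero ?addr0//.
  by rewrite mem_rem_uniqF// fset_uniq.
split => //; apply/eqP; rewrite eq_le le_c/= -fj -[f j]mul1r.
exact: (lq_coord q1 one0 j fin).
Qed.

(** [H j] moves the coordinate [j] only. A point of the product has a unique family
    of coordinates, and changing one coordinate does not leave the product. *)
Lemma lq_product_actions :
  (exists j : B, True) ->
  exists (N : kspace R K) (beta : forall j, N -> H j -> N) (z : N),
    [/\ lq_class q MM N, (forall j, isometric_right_action (beta j)) &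
        forall j g h, mdist (beta j z g) (beta j z h) =
                      mdist (@alpha j (y j) g) (@alpha j (y j) h)].
Proof.
move=> [jB _].
have [N [phi phiP]] := lq_product_exists q1 one0 y.
have [phi_surj phi_dist _] := phiP.
have fn := lq_fun_norm q1 one0.
pose D := near_base (lq_fin q one) y.
have DE z : D z -> lq_domain q one y z by case.
have dist z w : D z -> D w -> mdist (phi z) (phi w) = lq_norm q one (fam_dist z w).
  by move=> Dz Dw; rewrite phi_dist//; exact: DE.
have phi_inj z w : D z -> D w -> phi z = phi w -> z = w.
  move=> Dz Dw zw; apply: functional_extensionality_dep => j.
  have fzw := near_base_dist fn Dz Dw.
  apply: mdist_positivity; apply/eqP; rewrite eq_le mdist_ge0 andbT.
  have := lq_coord q1 one0 j fzw; rewrite mul1r => h; apply: le_trans h _.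
  by rewrite -dist// zw mdistxx.
have [psi psiP] : exists psi : N -> forall j, M j, forall x, D (psi x) /\ phi (psi x) = x.
  apply: (@ex_choice _ _ (fun x z => D z /\ phi z = x)) => x.
  have [z Dz zx] := phi_surj x; exists z; split => //.
  by split => // j; exact: fam_dist_ge0.
have psiD x := (psiP x).1; have psiK x := (psiP x).2.
have phiK z : D z -> psi (phi z) = z by move=> Dz; apply: phi_inj.
have Dwith z j (a : M j) : D z -> D (dfwith z j a).
  move=> Dz; pose d i : R := if i == j then mdist a (y j) else 0.
  have [Dd _] : lq_fin q one d /\ lq_norm q one d = mdist a (y j).
    apply: (@lq_fin_single j); rewrite /d ?mdist_ge0 ?eqxx// => i ij.
    by rewrite (negbTE ij).
  apply: (fun_normD fn Dz Dd _).1 => i; rewrite fam_dist_ge0/= /d.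
  have [->|ij] := eqVneq i j.
    by rewrite /fam_dist dfwithin lerDr mdist_ge0.
  by rewrite /fam_dist dfwithout// 1?eq_sym// addr0.
pose beta j x g := phi (dfwith (psi x) j (@alpha j (psi x j) g)).
have psi_beta j x g : psi (beta j x g) = dfwith (psi x) j (@alpha j (psi x j) g).
  by rewrite phiK//; exact: Dwith.
have Dy : D y by exact: near_base_y fn.
exists N, beta, (phi y); split.
- by exists B, M, y, phi; split => //; constructor; exact: jB.
- move=> j; have [a1 aM ai] := act j; apply: right_action_isometric.
  + move=> x; rewrite /beta a1 -[RHS]psiK; congr phi.
    apply: functional_extensionality_dep => i.
    by have [<-|ij] := eqVneq j i; rewrite ?dfwithin// dfwithout.
  + move=> x g h; rewrite {2}/beta psi_beta dfwithin /beta aM; congr phi.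
    apply: functional_extensionality_dep => i.
    by have [<-|ij] := eqVneq j i; rewrite ?dfwithin// !dfwithout.
  + move=> g x x'; have := dist _ _ (psiD x) (psiD x'); rewrite !psiK => ->.
    rewrite /beta (dist _ _ (Dwith _ _ _ (psiD x)) (Dwith _ _ _ (psiD x'))).
    congr (lq_norm _ _ _); apply/funext => i; rewrite /fam_dist.
    have [<-|ij] := eqVneq j i; first by rewrite !dfwithin (ai g).1.
    by rewrite !dfwithout.
- move=> j g h.
  rewrite /beta (phiK _ Dy) (dist _ _ (Dwith _ _ _ Dy) (Dwith _ _ _ Dy)).
  apply: (@lq_fin_single j _ _ (mdist_ge0 _ _) _ _).2 => [|i ij].
    by rewrite /fam_dist !dfwithin.
  by rewrite /fam_dist !dfwithout ?mdistxx// eq_sym.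
Qed.

End LqActions.

Section PartTwo.
Context (R : realType) (K : space_kind) (MM : space_class R K) (k : nat).
Context (G : nat -> marked_group k).

Lemma CPsharp_sub_CPfib (Ginf : marked_group k) : cay_cvg G Ginf ->
  CPsharp MM Ginf `<=` CPfib MM (cayleys R G).
Proof.
move=> GG [rho omega] [c1 c2 [M [alpha [y [MMM act bounds]]]]]; split => //=.
apply: (@fibred_of_actions R K MM k G unit (fun=> Ginf) M (fun=> alpha) y) => //.
move=> n; have := (cay_cvg_agree G Ginf).1 GG n.
by apply: filterS => m mn; exists tt.
Qed.

(** There are finitely many sets of relations of each length, and one accumulation
    point is picked for each of those that occur; the index is a length with a list
    of words. The limit space must be a countable product, hence the need for a
    countable family even when the boundary is uncountable. *)
Lemma countable_boundary : exists H : nat * seq (word k) -> marked_group k,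
  (forall j, cay_boundary G (H j)) /\
  forall n, \forall m \near \oo, exists j, agree n (G m) (H j).
Proof.
have [H0 H0P] := cay_compact G.
pose rel (H : marked_group k) n (s : seq (word k)) :=
  forall w, (size w <= n)%N -> ev H w = 1%g <-> w \in s.
have [H HP] : exists H : nat * seq (word k) -> marked_group k, forall j,
    cay_boundary G (H j) /\
    ((exists2 H', cay_boundary G H' & rel H' j.1 j.2) -> rel (H j) j.1 j.2).
  apply: (@ex_choice _ _ (fun (j : nat * seq (word k)) H => cay_boundary G H /\
    ((exists2 H', cay_boundary G H' & rel H' j.1 j.2) -> rel H j.1 j.2))) => j.
  have [[H' bH' relH']|no] := pselect (exists2 H', cay_boundary G H' & rel H' j.1 j.2).
    by exists H'.
  by exists H0.
exists H; split => [j|n]; first exact: (HP j).1.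
apply: filterS (boundary_agree G n) => m [H' bH' agr].
pose s := [seq w <- words k n | `[< ev (G m) w = 1%g >]].
have relG : rel (G m) n s.
  move=> w wn; rewrite mem_filter mem_words wn andbT.
  by split => [e|/asboolP//]; exact/asboolP.
exists (n, s) => w wn; have relH := (HP (n, s)).2.
have -> : ev (H (n, s)) w = 1%g <-> w \in s.
  apply: relH wn; exists H' => // v vn /=.
  by apply: iff_trans (relG v vn); apply: iff_sym; exact: agr.
exact: relG.
Qed.

Lemma CPsharp_inter_sub_CPfib (q : R) : 1 <= q ->
  CPsharp_inter MM (cay_boundary G) `<=` CPfib (lq_class q MM) (cayleys R G).
Proof.
move=> q1 [rho omega] CP.
have [H [HB Hagr]] := countable_boundary.
have [c1 c2 _] := CP _ (HB (0%N, [::])).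
split => //=.
pose datum (j : nat * seq (word k)) : Type :=
  {M : kspace R K & ((M -> H j -> M) * M)%type}.
have [D DP] : exists D : forall j, datum j, forall j,
    [/\ MM (projT1 (D j)), isometric_right_action (projT2 (D j)).1 &
      forall g h : H j,
        rho (cay_dist g h)%:R <= mdist ((projT2 (D j)).1 (projT2 (D j)).2 g)
                                       ((projT2 (D j)).1 (projT2 (D j)).2 h) /\
        mdist ((projT2 (D j)).1 (projT2 (D j)).2 g)
              ((projT2 (D j)).1 (projT2 (D j)).2 h) <= omega (cay_dist g h)%:R].
  have E j : exists d : datum j, 
    [/\ MM (projT1 d), isometric_right_action (projT2 d).1 &
      forall g h : H j,
        rho (cay_dist g h)%:R <= mdist ((projT2 d).1 (projT2 d).2 g)
                                       ((projT2 d).1 (projT2 d).2 h) /\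
        mdist ((projT2 d).1 (projT2 d).2 g)
              ((projT2 d).1 (projT2 d).2 h) <= omega (cay_dist g h)%:R].
    have [_ _ [M [alpha [y MP]]]] := CP _ (HB j).
    by exists (existT _ M (alpha, y)).
  exists (fun j => sval (cid (E j))) => j; exact: svalP (cid (E j)).
have [N [beta [z [NC act dist]]]] := @lq_product_actions R K MM q q1 _
  (fun j => H j : groupType) (fun j => projT1 (D j)) (fun j => (projT2 (D j)).1)
  (fun j => (projT2 (D j)).2) (fun j => let: And3 _ a _ := DP j in a)
  (fun j => let: And3 a _ _ := DP j in a) (ex_intro _ (0%N, [::]) I).
apply: (@fibred_of_actions R K _ k G _ H N beta z) => // j g h.
by rewrite dist; have [_ _] := DP j; exact.
Qed.

End PartTwo.

(** * Local systems from fibred coarse embeddings *)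

(** What the trivializations on the balls of one Cayley graph provide: [v g x] is
    the value of the section at [x] seen in the trivialization around [g], and
    [u g g'] is the change of trivialization; [r] is the scale at which the
    cocycle relations hold. *)
Record local_system (R : realType) (k : nat) (G : marked_group k) (M : metricType R)
    (v : G -> G -> M) (u : G -> G -> M -> M) (rho omega : R -> R) (r : nat) : Prop :=
  LocalSystem {
  ls_bounds : forall g x1 x2, (cay_dist g x1 <= r)%N -> (cay_dist g x2 <= r)%N ->
    rho (cay_dist x1 x2)%:R <= mdist (v g x1) (v g x2) /\
    mdist (v g x1) (v g x2) <= omega (cay_dist x1 x2)%:R;
  ls_isom : forall g g', (cay_dist g g' <= r)%N ->
    forall p p', mdist (u g g' p) (u g g' p') = mdist p p';
  ls_shift : forall g g' x, (cay_dist g x <= r)%N -> (cay_dist g' x <= r)%N ->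
    u g g' (v g' x) = v g x;
  ls_comp : forall g g' g'' p, (cay_dist g g' <= r)%N -> (cay_dist g g'' <= r)%N ->
    u g g' (u g' g'' p) = u g g'' p;
  ls_id : forall g p, u g g p = p }.

(** The trivializations used at the index [i] are those of the balls of radius half
    the scale [R' i], where [R' i] tends to infinity slowly enough for the
    component [n i] to be admitted at this scale. The cocycle relations hold because
    a change of trivialization is determined by its effect at one point of the
    intersection. *)
Lemma local_system_exists (R : realType) (K : space_kind) (MM : space_class R K)
    (k : nat) (G : nat -> marked_group k) (n : nat -> nat) (rho omega : R -> R) :
  (forall i, (i <= n i)%N) ->
  fibred_coarse_embedding MM (cayleys R G) rho omega ->
  exists (M : kspace R K) (v : forall i, G (n i) -> G (n i) -> M)
      (u : forall i, G (n i) -> G (n i) -> M -> M),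
    MM M /\ forall r, \forall i \near \oo, local_system (v i) (u i) rho omega r.
Proof.
move=> n_ge [M [F [s [MMM _ fib]]]].
pose X := {m : nat & cayleys R G m}.
have E (r : nat) : exists Nt : nat * (set X -> forall x, F x -> M),
  [/\ (forall C, small_subset r%:R Nt.1 C -> forall x, C x -> space_iso (Nt.2 C x)),
      (forall C, small_subset r%:R Nt.1 C -> forall x1 x2, C x1 -> C x2 ->
         rho (fine (du_dist x1 x2)) <= mdist (Nt.2 C x1 (s x1)) (Nt.2 C x2 (s x2))
         /\ mdist (Nt.2 C x1 (s x1)) (Nt.2 C x2 (s x2)) <= omega (fine (du_dist x1 x2))) &
      (forall C1 C2, small_subset r%:R Nt.1 C1 -> small_subset r%:R Nt.1 C2 ->
         C1 `&` C2 !=set0 -> exists w : M -> M, space_iso w /\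
           forall x, (C1 `&` C2) x -> forall p : F x, w (Nt.2 C2 x p) = Nt.2 C1 x p)].
  by have [N [t [_ t1 t2 t3]]] := fib r%:R (ler0n _ r); exists (N, t).
have [Nt NtP] : exists Nt, forall r, _ := ex_choice E.
have [R' [R'P R'_oo]] : exists R' : nat -> nat,
    (forall i, (0 < R' i)%N -> ((Nt (R' i)).1 <= n i)%N) /\
    forall r, \forall i \near \oo, (r <= R' i)%N.
  apply: (@diagonal \oo _ (fun r i => ((Nt r).1 <= n i)%N)) => // r.
  apply: filterS (nbhs_infty_ge (Nt r).1) => i ri.
  exact: leq_trans ri (n_ge i).
pose pt i (x : G (n i)) : X := existT _ (n i) x.
pose C i (g : G (n i)) : set X :=
  [set z | exists x : G (n i), z = pt i x /\ (cay_dist g x <= (R' i)./2)%N].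
pose T i (g x : G (n i)) : F (pt i x) -> M := (Nt (R' i)).2 (C i g) (pt i x).
pose trans i (g g' : G (n i)) (w : M -> M) := space_iso w /\
  forall x, (C i g `&` C i g') x -> forall p : F x,
    w ((Nt (R' i)).2 (C i g') x p) = (Nt (R' i)).2 (C i g) x p.
pose u i (g g' : G (n i)) : M -> M := match pselect (exists w, trans i g g' w) with
  | left h => projT1 (cid h) | right _ => id end.
exists M, (fun i g x => T i g x (s (pt i x))), u; split => // r.
(* Half of the scale must be at least [r], and the scale must be positive. *)
apply: filterS (R'_oo (2 * r).+2) => i ri.
have r_half : (r <= (R' i)./2)%N.
  apply: (@leq_trans ((2 * r).+2)./2); last exact: half_leq.
  by rewrite /= mul2n doubleK.
have Ri0 : (0 < R' i)%N by apply: leq_trans ri.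
have inC g x : (cay_dist g x <= r)%N -> C i g (pt i x).
  by move=> gx; exists x; split => //; exact: leq_trans gx r_half.
have gC g : C i g (pt i g) by apply: inC; rewrite cay_distxx.
have small g : small_subset (R' i)%:R (Nt (R' i)).1 (C i g).
  split.
  - by exists (pt i g).
  - by move=> _ [x [-> _]] /=; exact: R'P.
  - move=> _ _ [x [-> gx]] [x' [-> gx']].
    rewrite /du_dist/= eqxx tagged_asE lee_fin ler_nat.
    apply: leq_trans (cay_distD x g x') _; rewrite cay_distC.
    apply: leq_trans (leq_add gx gx') _; rewrite addnn.
    by rewrite -[leqRHS]odd_double_half leq_addl.
have [T1 T2 T3] := NtP (R' i).
have uP g g' : (cay_dist g g' <= r)%N \/
    (exists x, (cay_dist g x <= r)%N /\ (cay_dist g' x <= r)%N) ->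
    trans i g g' (u i g g').
  move=> gg'; rewrite /u; case: pselect => [h|[]]; first exact: projT2 (cid h).
  apply: T3; try exact: small.
  case: gg' => [gg'|[x [gx g'x]]].
    by exists (pt i g'); split; [exact: inC|exact: gC].
  by exists (pt i x); split; exact: inC.
have Tsurj g x : (cay_dist g x <= r)%N -> forall p, exists p', T i g x p' = p.
  by move=> gx; have [[_ +] _] := T1 _ (small g) _ (inC _ _ gx); exact.
split.
- move=> g x1 x2 gx1 gx2.
  have := T2 _ (small g) _ _ (inC _ _ gx1) (inC _ _ gx2).
  by rewrite /du_dist/= eqxx tagged_asE.
- by move=> g g' gg'; have [[[+ _] _] _] := uP g g' (or_introl gg'); exact.
- move=> g g' x gx g'x; have [_ h] := uP g g' (or_intror (ex_intro _ x (conj gx g'x))).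
  by rewrite /T h//; split; exact: inC.
- move=> g g' g'' p gg' gg''.
  have g'g : (cay_dist g' g <= r)%N by rewrite cay_distC.
  have g''g : (cay_dist g'' g <= r)%N by rewrite cay_distC.
  have gg : (cay_dist g g <= r)%N by rewrite cay_distxx.
  have [p' <-] := Tsurj g'' g g''g p.
  have [_ h1] := uP g' g'' (or_intror (ex_intro _ g (conj g'g g''g))).
  have [_ h2] := uP g g' (or_introl gg').
  have [_ h3] := uP g g'' (or_introl gg'').
  rewrite /T h1; last by split; exact: inC.
  rewrite h2; last by split; exact: inC.
  by rewrite h3//; split; exact: inC.
- move=> g p; have gg : (cay_dist g g <= r)%N by rewrite cay_distxx.
  have [p' <-] := Tsurj g g gg p.
  by have [_ h] := uP g g (or_introl gg); rewrite /T h.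
Qed.

(** * The limit action *)

Section LimitAction.
Context (R : realType) (q : R) (q1 : 1 <= q) (k : nat).
Context (G : nat -> marked_group k) (H : marked_group k).
Context (GH : forall n, \forall i \near \oo, agree n (G i) H).
Context (K : space_kind) (M : kspace R K).
Context (v : forall i, G i -> G i -> M) (u : forall i, G i -> G i -> M -> M).
Context (rho omega : R -> R) (rho_c : control_fun rho) (omega_c : control_fun omega).
Hypothesis ls : forall r, \forall i \near \oo, local_system (@v i) (@u i) rho omega r.
Context (F : forall i, {fset G i}) (F0 : forall i, F i != fset0).
Context (U : set_system nat) (UU : UltraFilter U) (oU : \oo `<=` U) (b : bool).

Let FU : ProperFilter U. Proof. exact: ultra_proper. Qed.
Let q0 : 0 < q. Proof. exact: lt_le_trans q1. Qed.

(** The second factor only serves to make the cardinals unbounded. *)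
Definition Phi i : finType := (F i * 'I_i.+1)%type.

Definition vertex i (a : Phi i) : G i := val a.1.

Definition escaping i (w : word k) : {set Phi i} :=
  [set a : Phi i | (ev (G i) w * vertex a)%g \notin F i].

Hypothesis escaping_null : forall w, null R U b (fun i => escaping i w).

Definition translate i (w : word k) (a : Phi i) : Phi i :=
  (insubd a.1 (ev (G i) w * vertex a)%g, a.2).

Lemma Phi_gt0 i : (0 < #|Phi i|)%N.
Proof.
have /fset0Pn[x xF] := F0 i.
by apply/card_gt0P; exists ([` xF]%fset, ord0).
Qed.

Lemma vertex_translate i w (a : Phi i) : a \notin escaping i w ->
  vertex (translate w a) = (ev (G i) w * vertex a)%g.
Proof. by rewrite inE negbK => aF; rewrite /vertex /translate/= val_insubd aF. Qed.

Lemma Phi_eq i (a a' : Phi i) : vertex a = vertex a' -> a.2 = a'.2 -> a = a'.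
Proof. by case: a a' => [x l] [x' l'] e /= ->; congr pair; exact: val_inj. Qed.

Lemma translate_inj i w : {in ~: escaping i w &, injective (@translate i w)}.
Proof.
move=> a a'; rewrite !finset.in_setC => ab a'b e.
apply: Phi_eq; last by case: e.
by apply: (mulgI (ev (G i) w)); rewrite -!vertex_translate// e.
Qed.

Lemma vertex_translate_dist i w (a : Phi i) : a \notin escaping i w ->
  (cay_dist (vertex a) (vertex (translate w a)) <= size w)%N.
Proof. by move=> ab; rewrite vertex_translate//; exact: cay_dist_ev. Qed.

Notation families := ({i & Phi i} -> M).
Notation fdist := (fam_dist (A := fun _ : {i & Phi i} => M)).

(** The section of the field of spaces, each point seen in its own trivialization. *)
Definition base : families := fun j => v (vertex (tagged j)) (vertex (tagged j)).

Definition in_scale i (r : nat) : bool :=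
  `[< local_system (@v i) (@u i) rho omega r >].

Lemma in_scale_near r : \forall i \near U, in_scale i r.
Proof. by apply: oU; apply: filterS (ls r) => i h; apply/asboolP. Qed.

(** The translation by a word carries the coordinate at [w g] to the one at [g],
    through the change of trivialization from around [w g] to around [g]. Where
    [w g] leaves the finite set, or where the trivializations are not yet available
    at the scale of [w], the coordinate is reset to that of the base family, so that
    the orbit of the base family stays at bounded distance from it. *)
Definition act_word (w : word k) (z : families) : families := fun j =>
  let: existT i a := j in
  if in_scale i (size w) && (a \notin escaping i w)
  then u (vertex a) (vertex (translate w a)) (z (existT _ i (translate w a)))
  else v (vertex a) (vertex a).

Definition translated i w (E : {set Phi i}) : {set Phi i} :=
  [set translate w a | a in E :\: escaping i w]%SET.

Lemma card_translated i w (E : {set Phi i}) : (#|translated w E| = #|E :\: escaping i w|)%N.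
Proof.
apply: card_in_imset => a a'; rewrite !finset.in_setD => /andP[ab _] /andP[a'b _].
by apply: translate_inj; rewrite finset.in_setC.
Qed.

(** The coordinates that are reset contribute nothing, and the others are moved by
    an injection through isometries. *)
Lemma act_word_dist i w (E : {set Phi i}) z z' : in_scale i (size w) ->
  unorm q E (fdist (act_word w z) (act_word w z')) = unorm q (translated w E) (fdist z z') :> R.
Proof.
move=> gw; have /asboolP gs := gw; rewrite /unorm !nqE; congr (_ `^ _).
rewrite big_imset/=; last first.
  move=> a a'; rewrite !finset.in_setD => /andP[ab _] /andP[a'b _].
  by apply: translate_inj; rewrite finset.in_setC.
rewrite (bigID [in escaping i w])/= big1 ?add0r; last first.
  move=> a /andP[_ ab]; rewrite /fam_dist/= ab andbF mdistxx mulr0 powR0//.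
  by rewrite gt_eqF.
apply: eq_big => a; first by rewrite finset.in_setD andbC.
move=> /andP[aE ab]; rewrite /fam_dist/= gw ab/=.
by rewrite (ls_isom gs)// vertex_translate_dist.
Qed.

Lemma act_word_le i w (E : {set Phi i}) z z' :
  unorm q E (fdist (act_word w z) (act_word w z')) <= unorm q (translated w E) (fdist z z') :> R.
Proof.
have [gw|gw] := boolP (in_scale i (size w)); first by rewrite act_word_dist.
apply: (@le_trans _ _ (unorm q E (fun=> 0))); last first.
  by rewrite (unorm_const q1 Phi_gt0)// mul0r unorm_ge0.
apply: (unorm_le q1 Phi_gt0) => a _.
by rewrite /fam_dist/= (negbTE gw) /= mdistxx lexx.
Qed.

Lemma act_word_base w j : 0 <= fdist (act_word w base) base j <= omega (size w)%:R.
Proof.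
rewrite fam_dist_ge0/=; case: j => i a.
have om0 : 0 <= omega (size w)%:R by case: omega_c => h _ _; apply: h; exact: ler0n.
rewrite /fam_dist/= /base/=; case: ifP => [/andP[gw ab]|_]; last by rewrite mdistxx.
have /asboolP gs := gw; have d := vertex_translate_dist ab.
rewrite (ls_shift gs)//; last by rewrite cay_distxx.
apply: le_trans ((ls_bounds gs d _).2) _; first by rewrite cay_distxx.
by case: omega_c => _ + _; apply; rewrite ?ler0n// ler_nat cay_distC.
Qed.

Let Db := near_base (A := fun _ : {i & Phi i} => M) (ultra_fin q U b) base.
Let fn := ultra_fun_norm q1 Phi_gt0 UU b.

Lemma null_translated w (E : forall i, {set Phi i}) : null R U b E ->
  null R U b (fun i => translated w (E i)).
Proof.
move=> nE; apply: (null_le UU _ nE nE); apply: filterE => i.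
rewrite card_translated; apply: leq_trans (leq_addr _ _).
by apply: subset_leq_card; exact: finset.subsetDl.
Qed.

Lemma act_word_near_base w z : Db z -> Db (act_word w z).
Proof.
move=> [z0 [c zc] zE].
have om0 : 0 <= omega (size w)%:R by case: omega_c => h _ _; apply: h; exact: ler0n.
have le i (E : {set Phi i}) : unorm q E (fdist (act_word w z) base) <=
    unorm q (translated w E) (fdist z base) + unorm q E (fun=> omega (size w)%:R) :> R.
  apply: (@le_trans _ _ (unorm q E (fdist (act_word w z) (act_word w base)) +
                         unorm q E (fdist (act_word w base) base))).
    apply: (unorm_tri q1 Phi_gt0).
    - by move=> j; exact: fam_dist_ge0.
    - by move=> j; exact: fam_dist_ge0.
    - by move=> a _; rewrite fam_dist_ge0 fam_dist_tri.
  apply: lerD; first exact: act_word_le.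
  by apply: (unorm_le q1 Phi_gt0) => a _; exact: act_word_base.
split; first by move=> j; exact: fam_dist_ge0.
  exists (c + omega (size w)%:R) => i; apply: le_trans (le _ _) _; apply: lerD.
    exact: le_trans (unorm_subT q1 _ _) (zc i).
  by rewrite -/(unormT q i _) (unormT_const q1 Phi_gt0).
move=> E nE; apply: (cvg0_le UU).
- by move=> i; exact: unorm_ge0.
- by apply: filterE => i; exact: le.
- rewrite -[0]addr0; apply: cvgD; first exact: zE (null_translated w nE).
  exact: (null_const q1 Phi_gt0 UU om0 nE).
Qed.

(** A null set contributes nothing to the limit norm of a function that does not
    concentrate, so two such functions may be compared off a null set. *)
Lemma ultra_norm_null f g (E : forall i, {set Phi i}) :
  ultra_fin q U b f -> ultra_fin q U b g -> null R U b E ->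
  (\forall i \near U, unorm q (~: E i)%SET f <= unorm q [set: Phi i]%SET g :> R) ->
  ultra_norm q U f <= ultra_norm q U g :> R.
Proof.
move=> Df Dg nE fg; have [f0 _ fE] := Df.
have lim : unorm q (E i) f + unormT q i g @[i --> U] --> 0 + ultra_norm q U g.
  by apply: cvgD; [exact: fE|exact: (ultra_norm_cvg UU Dg)].
rewrite -[leRHS]add0r; apply: ler_cvg_to (ultra_norm_cvg UU Df) lim _.
apply: filterS fg => i fg; apply: le_trans (unorm_split q1 Phi_gt0 (E i) f0) _.
exact: lerD.
Qed.

Lemma null_escapingU w w' (E : forall i, {set Phi i}) :
  (\forall i \near U, E i \subset escaping i w :|: escaping i w') -> null R U b E.
Proof.
move=> Ew; apply: (null_le UU _ (escaping_null w) (escaping_null w')).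
apply: filterS Ew => i /subset_leq_card h; apply: leq_trans h _.
by rewrite cardsU leq_subr.
Qed.

(** At each index only the coordinates outside the translated set are lost, and
    there are as many of them as escaping points. *)
Lemma act_word_isometry w z z' : Db z -> Db z' ->
  ultra_norm q U (fdist (act_word w z) (act_word w z')) = ultra_norm q U (fdist z z') :> R.
Proof.
move=> Dz Dz'; have Dd := near_base_dist fn Dz Dz'.
have Dd' := near_base_dist fn (act_word_near_base w Dz) (act_word_near_base w Dz').
have n0 : null R U b (fun i => finset.set0 : {set Phi i}).
  by apply: (null_escapingU (w := [::]) (w' := [::])); apply: filterE => i; exact: finset.sub0set.
apply/eqP; rewrite eq_le; apply/andP; split.
  apply: (ultra_norm_null Dd' Dd n0); apply: filterE => i.
  rewrite finset.setC0; apply: le_trans (act_word_le _ _ _ _) _.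
  exact: (unorm_subT q1 _ _).
pose E i := ~: translated w [set: Phi i].
have nE : null R U b E.
  apply: (null_le UU _ (escaping_null w) n0); apply: filterE => i.
  rewrite cards0 addn0 /E; have := cardsC (translated w [set: Phi i]).
  rewrite card_translated finset.setTD => h.
  by rewrite -(leq_add2l #|~: escaping i w|) h addnC cardsC.
apply: (ultra_norm_null Dd Dd' nE).
apply: filterS (in_scale_near (size w)) => i gw.
by rewrite finset.setCK act_word_dist.
Qed.

Lemma ultra_norm_eq0 z z' (E : forall i, {set Phi i}) : Db z -> Db z' ->
  null R U b E ->
  (\forall i \near U, forall a, a \notin E i -> z (existT _ i a) = z' (existT _ i a)) ->
  ultra_norm q U (fdist z z') = 0 :> R.
Proof.
move=> Dz Dz' nE zz'; have Dd := near_base_dist fn Dz Dz'.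
apply/eqP; rewrite eq_le (fun_norm_ge0 fn Dd) andbT -(fun_norm00 fn).
apply: (ultra_norm_null Dd (fun_norm0 fn) nE); apply: filterS zz' => i zz'.
rewrite -/(unormT q i _) (unormT_const q1 Phi_gt0)//.
apply: (@le_trans _ _ (unorm q (~: E i) (fun=> 0))).
  apply: (unorm_le q1 Phi_gt0) => a.
  by rewrite finset.in_setC fam_dist_ge0/= /fam_dist => /zz' ->; rewrite mdistxx.
by rewrite (unorm_const q1 Phi_gt0)// mul0r.
Qed.

Let wd (h : H) : word k := geod h.

Lemma agree_near n : \forall i \near U, agree n (G i) H.
Proof. exact/oU/GH. Qed.

(** Off the points escaping in one of the two steps this is the cocycle relation of
    the changes of trivialization, together with the equality of the words spelling
    [g * h], which holds in all groups close to the limit. *)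
Lemma act_word_comp (g h : H) z : Db z ->
  ultra_norm q U (fdist (act_word (wd (g * h)%g) z)
                        (act_word (wd h) (act_word (wd g) z))) = 0 :> R.
Proof.
move=> Dz; set wg := wd g; set wh := wd h; set wgh := wd (g * h)%g.
pose E i : {set Phi i} :=
  [set a | (a \in escaping i wh) || (translate wh a \in escaping i wg)]%SET.
apply: (@ultra_norm_eq0 _ _ E); try by do ?apply: act_word_near_base.
  apply: (null_le UU _ (escaping_null wh) (escaping_null wg)); apply: filterE => i.
  have sub : E i \subset
      escaping i wh :|: ([set a | translate wh a \in escaping i wg] :\: escaping i wh).
    by apply/fintype.subsetP => a; rewrite !inE; case: (_ \notin F i).
  apply: leq_trans (subset_leq_card sub) _; rewrite cardsU.
  apply: leq_trans (leq_subr _ _) _; rewrite leq_add2l.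
  rewrite -[leqLHS](card_in_imset (f := translate wh)).
    apply: subset_leq_card; apply/fintype.subsetP => _ /imsetP[a + ->].
    by rewrite finset.in_setD => /andP[_]; rewrite inE.
  move=> a a'; rewrite !finset.in_setD => /andP[ab _] /andP[a'b _].
  by apply: translate_inj; rewrite finset.in_setC.
have near_eq : \forall i \near U, ev (G i) wgh = (ev (G i) wg * ev (G i) wh)%g.
  apply: filterS (agree_near (size wgh + size (wg ++ wh))) => i ag.
  rewrite -ev_cat; apply/(agree_eq ag (leqnn _)).
  by rewrite ev_cat !ev_geod.
near=> i => a; rewrite inE negb_or => /andP[ah sg].
pose r := (size wg + size wh + size wgh)%N.
have e : ev (G i) wgh = (ev (G i) wg * ev (G i) wh)%g by near: i; exact: near_eq.
have gg : in_scale i (size wg) by near: i; exact: in_scale_near.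
have gh : in_scale i (size wh) by near: i; exact: in_scale_near.
have ggh : in_scale i (size wgh) by near: i; exact: in_scale_near.
have /asboolP gr : in_scale i r by near: i; exact: in_scale_near.
have agh : a \notin escaping i wgh.
  by move: sg; rewrite !inE !negbK vertex_translate// e mulgA.
have sE : translate wg (translate wh a) = translate wgh a.
  by apply: Phi_eq => //; rewrite !vertex_translate// e mulgA.
rewrite /act_word gg gh ggh sg ah agh /= sE (ls_comp gr)//.
  by apply: leq_trans (vertex_translate_dist ah) _; rewrite /r addnAC leq_addl.
by apply: leq_trans (vertex_translate_dist agh) _; rewrite /r leq_addl.
Unshelve. all: by end_near. Qed.

Lemma act_word_one z : Db z ->
  ultra_norm q U (fdist (act_word (wd 1%g) z) z) = 0 :> R.
Proof.
move=> Dz; set w1 := wd 1%g.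
apply: (@ultra_norm_eq0 _ _ (fun i => escaping i w1)) => //.
  exact: act_word_near_base.
near=> i => a ab.
have ag : agree (size w1) (G i) H by near: i; exact: agree_near.
have g1 : in_scale i (size w1) by near: i; exact: in_scale_near.
have /asboolP gs := g1.
have e : ev (G i) w1 = 1%g by apply/(ag _ (leqnn _)); exact: ev_geod.
have sE : translate w1 a = a by apply: Phi_eq => //; rewrite vertex_translate// e mul1g.
by rewrite /act_word g1 ab /= sE (ls_id gs).
Unshelve. all: by end_near. Qed.

Lemma base_near_base : Db base.
Proof. exact: near_base_y fn. Qed.

(** Off a null set each coordinate of the two translates is the value of the section
    at [w_g x] and [w_h x] in the trivialization around [x], and these points are at
    the distance of [g] and [h] by right invariance. *)
Lemma orbit_bounds (g h : H) :
  rho (cay_dist g h)%:R <=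
    ultra_norm q U (fdist (act_word (wd g) base) (act_word (wd h) base)) /\
  ultra_norm q U (fdist (act_word (wd g) base) (act_word (wd h) base)) <=
    omega (cay_dist g h)%:R.
Proof.
set wg := wd g; set wh := wd h; set d : R := (cay_dist g h)%:R.
have d0 : 0 <= d by exact: ler0n.
have om0 : 0 <= omega d by case: omega_c => + _ _; exact.
have rh0 : 0 <= rho d by case: rho_c => + _ _; exact.
pose E i : {set Phi i} := escaping i wg :|: escaping i wh.
have nE : null R U b E.
  by apply: (null_escapingU (w := wg) (w' := wh)); apply: filterE => i; exact: subxx.
have Dd := near_base_dist fn (act_word_near_base wg base_near_base)
  (act_word_near_base wh base_near_base).
set f := fdist _ _ in Dd *.
have bounds : \forall i \near U, forall a, a \notin E i ->
    rho d <= f (existT _ i a) <= omega d.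
  near=> i => a; rewrite finset.in_setU negb_or => /andP[ag ah].
  pose r := (size wg + size wh)%N.
  have agr : agree (2 * r) (G i) H by near: i; exact: agree_near.
  have gg : in_scale i (size wg) by near: i; exact: in_scale_near.
  have gh : in_scale i (size wh) by near: i; exact: in_scale_near.
  have /asboolP gs := gg; have /asboolP hs := gh.
  have /asboolP rs : in_scale i r by near: i; exact: in_scale_near.
  have dg := vertex_translate_dist ag; have dh := vertex_translate_dist ah.
  rewrite /f /fam_dist /= gg gh ag ah /= /base /=.
  rewrite (ls_shift gs) ?(ls_shift hs)// ?cay_distxx//.
  have -> : d = (cay_dist (vertex (translate wg a)) (vertex (translate wh a)))%:R.
    rewrite !vertex_translate// cay_distMr /d; congr (_%:R).
    by rewrite (agree_dist agr)// !ev_geod.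
  apply/andP; apply: (ls_bounds rs).
    exact: leq_trans dg (leq_addr _ _).
  exact: leq_trans dh (leq_addl _ _).
have Dcst c : 0 <= c -> ultra_fin q U b (fun _ : {i & Phi i} => c).
  move=> c0; split => //.
    by exists c => i; rewrite (unormT_const q1 Phi_gt0).
  by move=> E' nE'; exact: (null_const q1 Phi_gt0 UU c0 nE').
have Ncst c : 0 <= c -> ultra_norm q U (fun _ : {i & Phi i} => c) = c.
  move=> c0; apply: (ultra_norm_near UU).
  have -> : (fun i => unormT q i (fun _ : {i & Phi i} => c)) = fun=> c.
    by apply/funext => i; rewrite (unormT_const q1 Phi_gt0).
  exact: cvg_cst.
split.
  rewrite -[leLHS](Ncst _ rh0).
  apply: (ultra_norm_null (Dcst _ rh0) Dd nE).
  apply: filterS bounds => i bd; apply: le_trans (unorm_subT q1 (~: E i) _).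
  apply: (unorm_le q1 Phi_gt0) => a.
  by rewrite finset.in_setC => /bd/andP[-> _]; rewrite rh0.
rewrite -[leRHS](Ncst _ om0).
apply: (ultra_norm_null Dd (Dcst _ om0) nE).
apply: filterS bounds => i bd; apply: le_trans (unorm_subT q1 (~: E i) _).
apply: (unorm_le q1 Phi_gt0) => a.
by rewrite finset.in_setC fam_dist_ge0 => /bd/andP[_ ->].
Unshelve. all: by end_near. Qed.

(** The translations pass to the classes of families at distance zero because they
    are isometric, and the laws of an action hold there because they hold up to
    distance zero. *)
Lemma limit_action (L : metricType R) (phi : families -> L) :
  (forall x, exists2 z, Db z & phi z = x) ->
  (forall z w, Db z -> Db w -> mdist (phi z) (phi w) = ultra_norm q U (fdist z w)) ->
  exists (alpha : L -> H -> L) (y : L), isometric_right_action alpha /\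
    forall g h : H, rho (cay_dist g h)%:R <= mdist (alpha y g) (alpha y h) /\
      mdist (alpha y g) (alpha y h) <= omega (cay_dist g h)%:R.
Proof.
move=> phi_surj phi_dist.
have [psi psiP] : exists psi : L -> families, forall x, Db (psi x) /\ phi (psi x) = x.
  apply: (@ex_choice _ _ (fun x z => Db z /\ phi z = x)) => x.
  by have [z Dz zx] := phi_surj x; exists z.
have psiD x := (psiP x).1; have psiK x := (psiP x).2.
pose alpha x h := phi (act_word (wd h) (psi x)).
have phi_eq z z' : Db z -> Db z' -> ultra_norm q U (fdist z z') = 0 -> phi z = phi z'.
  by move=> Dz Dz' h; apply: mdist_positivity; rewrite phi_dist.
have D w x : Db (act_word w (psi x)) by exact: act_word_near_base.
have alphaE z h : Db z -> alpha (phi z) h = phi (act_word (wd h) z).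
  move=> Dz; apply: phi_eq; [exact: D|exact: act_word_near_base|].
  by rewrite act_word_isometry// -phi_dist// psiK mdistxx.
exists alpha, (phi base); split.
  apply: right_action_isometric.
  - move=> x; rewrite -[RHS]psiK; apply: phi_eq => //.
    exact: act_word_one.
  - move=> x g h; rewrite [alpha x g]/alpha alphaE//.
    apply: phi_eq; [exact: D|exact: act_word_near_base|exact: act_word_comp].
  - move=> h x x'; rewrite phi_dist// act_word_isometry//.
    by rewrite -phi_dist// !psiK.
move=> g h; have Db0 := base_near_base.
rewrite !alphaE// phi_dist; [exact: orbit_bounds| |]; exact: act_word_near_base.
Qed.

End LimitAction.

(** * Ultraproducts of averaged powers and their convex subspaces *)

Lemma affine_comb_dist (R : realType) (V : completeNormedModType R) (t : R) (x x' y : V) :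
  `|t *: x + (1 - t) *: x' - y| <= `|t| * `|x - y| + `|1 - t| * `|x' - y|.
Proof.
rewrite -!normrZ; apply: le_trans (ler_normD _ _).
rewrite !scalerBr addrACA -opprD -scalerDl [t + _]addrC subrK scale1r.
exact: lexx.
Qed.

Lemma near_base_affine (R : realType) (J : Type) (A : J -> kspace R BanachSpaces)
    (Dn : (J -> R) -> Prop) (N : (J -> R) -> R) (y : forall j, A j) :
  fun_norm Dn N -> forall (t : R) z w, near_base Dn y z -> near_base Dn y w ->
  near_base Dn y (fun j => (t *: (z j : (A j : completeNormedModType R)) + (1 - t) *: w j)).
Proof.
move=> DnN t z w Dz Dw.
have Dtz := (fun_normZ_le DnN (normr_ge0 t) Dz).1.
have Dtw := (fun_normZ_le DnN (normr_ge0 (1 - t)) Dw).1.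
apply: (fun_normD DnN Dtz Dtw _).1 => j; rewrite fam_dist_ge0/= /fam_dist !mdist_banach.
exact: affine_comb_dist.
Qed.

Lemma powR_continuous (R : realType) (q t : R) : 0 < t ->
  {for t, continuous (fun x : R => x `^ q)}.
Proof.
move=> t0; apply: differentiable_continuous; apply/derivable1_diffP.
by apply: derivable_powR; rewrite in_itv/= t0.
Qed.

Definition lift_family (Phi : nat -> finType) (N : nat -> Type) (T : Type)
    (ps : forall m, N m -> Phi m -> T) (x : forall m, N m) : {m & Phi m} -> T :=
  fun j => ps (tag j) (x (tag j)) (tagged j).

Definition slice (Phi : nat -> finType) (T : Type) m (z : {m & Phi m} -> T) : Phi m -> T :=
  fun a => z (existT _ m a).
Arguments slice {Phi T} m z a.

Lemma part_dist (R : realType) (q : R) (Phi : nat -> finType) m (K : space_kind)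
    (M N : kspace R K) (ph : (Phi m -> M) -> N) (z w : {m & Phi m} -> M) :
  is_lq_product (M := fun=> M) q (fun=> weight q Phi m) [set: Phi m -> M] ph ->
  mdist (ph (slice m z)) (ph (slice m w)) =
  unormT q m (fam_dist (A := fun _ : {m & Phi m} => M) z w).
Proof.
move=> [_ d _]; rewrite d// finite_lq_sumE /= /unormT /unorm nqE.
by congr (_ `^ _); apply: eq_bigl => a; rewrite inE.
Qed.

Lemma ultra_norm_dist0 (R : realType) (q : R) (Phi : nat -> finType)
    (U : set_system nat) (f : {m & Phi m} -> R) : UltraFilter U ->
  (forall m, unormT q m f = 0) -> ultra_norm q U f = 0.
Proof.
move=> UU zw; have FU : ProperFilter U by exact: ultra_proper.
apply: (ultra_norm_near UU).
by rewrite (_ : (fun m => _) = fun=> 0); [exact: cvg_cst|apply/funext].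
Qed.

(** The defects of affinity of the section [ps] are at distance zero. *)
Lemma lift_affine (R : realType) (q : R) (q1 : 1 <= q) (Phi : nat -> finType)
    (Phi0 : forall m, (0 < #|Phi m|)%N) (U : set_system nat) (UU : UltraFilter U)
    (K : space_kind) (M : kspace R K) (y : {m & Phi m} -> M)
    (L : kspace R K) (phi : ({m & Phi m} -> M) -> L) (N : nat -> kspace R K)
    (ph : forall m, (Phi m -> M) -> N m) (ps : forall m, N m -> Phi m -> M)
    (y' : forall m, N m) :
  let D := near_base (A := fun _ : {m & Phi m} => M) (ultra_fin q U true) y in
  (forall z w, D z -> D w -> mdist (phi z) (phi w) =
     ultra_norm q U (fam_dist (A := fun _ : {m & Phi m} => M) z w)) ->
  affine_on (A := fun _ : {m & Phi m} => M) D phi ->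
  (forall m, is_lq_product (M := fun=> M) q (fun=> weight q Phi m) [set: Phi m -> M] (ph m)) ->
  (forall m x, ph m (ps m x) = x) ->
  (forall x, ultra_domain y' x -> D (lift_family ps x)) ->
  affine_on (ultra_domain y') (fun x => phi (lift_family ps x)).
Proof.
case: K M y L phi N ph ps y' => // M y L phi N ph ps y' D phi_dist phi_aff phP psP liftD.
move=> t x x' xD x'D; have Dx := liftD x xD; have Dx' := liftD x' x'D.
have comb_D : ultra_domain y'
    (fun m => t *: (x m : (N m : completeNormedModType R)) + (1 - t) *: x' m).
  have [c xc] := xD; have [c' xc'] := x'D.
  exists (`|t| * c + `|1 - t| * c') => m; rewrite mdist_banach.
  apply: le_trans (affine_comb_dist _ _ _ _) _.
  by apply: lerD; apply: ler_wpM2l => //; [exact: xc|exact: xc'].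
rewrite -phi_aff//; apply: (@mdist_positivity R (banach_metric L)); rewrite phi_dist.
- apply: ultra_norm_dist0 => m; rewrite -(part_dist _ _ (phP m)).
  have -> : ph m (slice m (lift_family ps (fun m => t *: x m + (1 - t) *: x' m))) =
            t *: x m + (1 - t) *: x' m by exact: (psP m (t *: x m + (1 - t) *: x' m)).
  have [_ _ aff] := phP m.
  have := aff t (ps m (x m)) (ps m (x' m)) I I; rewrite !psP => <-.
  exact: mdistxx.
- exact: liftD.
- exact: (near_base_affine (ultra_fun_norm q1 Phi0 UU true) t Dx Dx').
Qed.

Lemma induced_affine (R : realType) (K : space_kind) (J : Type) (A : J -> kspace R K)
    (Dn : (J -> R) -> Prop) (N : (J -> R) -> R) (y : forall j, A j)
    (D : set (forall j, A j)) (L0 L : kspace R K) (phi0 : (forall j, A j) -> L0)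
    (phi : (forall j, A j) -> L) (f : L0 -> L) :
  fun_norm Dn N -> near_base Dn y `<=` D ->
  affine_on (near_base Dn y) phi0 -> affine_on D phi ->
  (forall x, exists2 z, near_base Dn y z & phi0 z = x) ->
  (forall z, near_base Dn y z -> f (phi0 z) = phi z) ->
  affine_map f /\ (geodesically_convex (range f) -> admissible_subset (range f)).
Proof.
case: K A y D L0 L phi0 phi f => // A y D L0 L phi0 phi f DnN sub aff0 aff surj fE.
have f_aff (t : R) (x x' : L0) : f (t *: x + (1 - t) *: x') = t *: f x + (1 - t) *: f x'.
  have [z Dz <-] := surj x; have [z' Dz' <-] := surj x'.
  rewrite -aff0// !fE//; first by apply: aff; exact: sub.
  exact: (near_base_affine DnN t Dz Dz').
split => //= _ t _ _ [x _ <-] [x' _ <-].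
by exists (t *: x + (1 - t) *: x'); rewrite ?f_aff.
Qed.

Section UltraSpaces.
Context (R : realType) (K : space_kind) (MM : space_class R K) (q : R) (q1 : 1 <= q).
Context (Phi : nat -> finType) (Phi0 : forall m, (0 < #|Phi m|)%N).
Context (Phi_oo : #|Phi m| @[m --> \oo] --> \oo).
Context (U : set_system nat) (UU : UltraFilter U) (oU : \oo `<=` U).
Context (M : kspace R K) (MMM : MM M) (y : {m & Phi m} -> M).

Let FU : ProperFilter U. Proof. exact: ultra_proper. Qed.
Let q0 : 0 < q. Proof. exact: lt_le_trans q1. Qed.

Notation families := ({m & Phi m} -> M).
Notation fdist := (fam_dist (A := fun _ : {m & Phi m} => M)).
Notation Db b := (near_base (A := fun _ : {m & Phi m} => M) (ultra_fin q U b) y).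

Let fn b := ultra_fun_norm q1 Phi0 UU b.

Lemma nonprincipal_above : nonprincipal U.
Proof.
split => // n Un; have : U [set m | (n.+1 <= m)%N] by apply: oU; exact: nbhs_infty_ge.
by rewrite Un => /principal_filterP/=; rewrite ltnn.
Qed.

Lemma DbW b z : Db b z -> Db true z.
Proof. exact: ultra_finW. Qed.

(** The limit of the averaged powers of [M], built from families with values in
    [M], is the ultraproduct of the powers themselves: the points of each power
    are lifted to families by an arbitrary section, whose choice is invisible to
    the limit distance. *)
Lemma Fq_space_exists : exists (L : kspace R K) (phi : families -> L),
  [/\ Fq q MM L,
      (forall x, exists2 z, Db true z & phi z = x),
      (forall z w, Db true z -> Db true w -> mdist (phi z) (phi w) = ultra_norm q U (fdist z w)) &
      affine_on (A := fun _ : {m & Phi m} => M) (Db true) phi].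
Proof.
have [L [phi [phi_surj phi_dist phi_aff]]] := ultra_space_exists q1 Phi0 UU oU true y.
exists L, phi; split => //.
have pt (m : nat) : M.
  by have [a _] := sigW (elimT card_gt0P (Phi0 m)); exact: (y (existT _ m a)).
have [N [ph phP]] : exists (N : nat -> kspace R K) (ph : forall m, (Phi m -> M) -> N m),
    forall m, is_lq_product (M := fun=> M) q (fun=> weight q Phi m) [set: Phi m -> M] (ph m).
  have E m : exists d : {N : kspace R K & (Phi m -> M) -> N},
      is_lq_product (M := fun=> M) q (fun=> weight q Phi m) [set: Phi m -> M] (projT2 d).
    have [N [ph phP]] :=
      finite_lq_product_exists (pt m) q1 (fun _ : Phi m => weight_gt0 q Phi0 m).
    by exists (existT _ N ph).
  exists (fun m => projT1 (sval (cid (E m)))), (fun m => projT2 (sval (cid (E m)))) => m.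
  exact: (svalP (cid (E m))).
have [ps psP] : exists ps : forall m, N m -> (Phi m -> M), forall m x, ph m (ps m x) = x.
  have S m : exists ps : N m -> (Phi m -> M), forall x, ph m (ps x) = x.
    apply: (@ex_choice _ _ (fun x f => ph m f = x)) => x; have [su _ _] := phP m.
    by have [z _ zx] := su x; exists z.
  by exists (fun m => sval (cid (S m))) => m; exact: (svalP (cid (S m))).
have ph_dist m (z w : families) :
    mdist (ph m (slice m z)) (ph m (slice m w)) = unormT q m (fdist z w).
  exact: part_dist.
have partK x m : ph m (slice m (lift_family ps x)) = x m.
  exact: (psP m (x m)).
pose y' m := ph m (slice m y).
have liftD x : ultra_domain y' x -> Db true (lift_family ps x).
  move=> [c xc]; apply: (ultra_fin_true q1 UU); first by move=> j; exact: fam_dist_ge0.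
  by exists c => m; rewrite -ph_dist partK; exact: xc.
pose pi x := phi (lift_family ps x).
exists M, Phi, N, ph, y', U, pi; split => //.
  exact: nonprincipal_above.
split.
- move=> l; have [z Dz <-] := phi_surj l.
  have [z0 [c zc] _] := Dz.
  pose x m := ph m (slice m z).
  have xD : ultra_domain y' x by exists c => m; rewrite ph_dist.
  exists x => //; apply: mdist_positivity; rewrite phi_dist//; last exact: liftD.
  by apply: ultra_norm_dist0 => m; rewrite -ph_dist partK mdistxx.
- move=> x x' xD x'D.
  have Dx := liftD x xD; have Dx' := liftD x' x'D.
  rewrite phi_dist//.
  have -> : (fun m => mdist (x m) (x' m)) =
            (fun m => unormT q m (fdist (lift_family ps x) (lift_family ps x'))).
    by apply/funext => m; rewrite -ph_dist !partK.
  exact: (ultra_norm_cvg UU (near_base_dist (fn true) Dx Dx')).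
- exact: (lift_affine q1 Phi0 UU phi_dist phi_aff phP psP liftD).
Qed.

(** Tightness passes to intermediate points: if [z] lies on a geodesic from [a] to
    [w], then on the complement of a null set [z] is already as far from [a] as in
    total, which leaves nothing for the null set itself. *)
Lemma between_near_base (a w z : families) (s t : R) :
  Db false a -> Db false w -> Db true z -> 0 <= t <= s ->
  ultra_norm q U (fdist a z) = t -> ultra_norm q U (fdist z w) = s - t ->
  ultra_norm q U (fdist a w) = s -> Db false z.
Proof.
move=> Da Dw Dz /andP[t0 ts] azE zwE awE.
have [z0 zc _] := Dz; split => // E nE.
have Da' := DbW Da; have Dw' := DbW Dw.
have lim_az := ultra_norm_cvg UU (near_base_dist (fn true) Da' Dz).
have lim_zw := ultra_norm_cvg UU (near_base_dist (fn true) Dz Dw').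
have lim_aw := ultra_norm_cvg UU (near_base_dist (fn true) Da' Dw').
rewrite azE in lim_az; rewrite zwE in lim_zw; rewrite awE in lim_aw.
have [_ _ /(_ E nE) aE] := Da.
have [_ _ /(_ E nE) awnull] := near_base_dist (fn false) Da Dw.
have g0 (z1 z2 : families) j : 0 <= fdist z1 z2 j by exact: fam_dist_ge0.
pose X m := unormT q m (fdist a z).
pose Y m := unorm q (~: E m)%SET (fdist a z).
pose Z m := unorm q (E m) (fdist a z).
have tri m (E' : {set Phi m}) z1 z2 z3 : unorm q E' (fdist z1 z3) <=
    unorm q E' (fdist z1 z2) + unorm q E' (fdist z2 z3) :> R.
  by apply: (unorm_tri q1 Phi0) => // c _; rewrite g0 fam_dist_tri.
have YX m : Y m <= X m by exact: (unorm_subT q1).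
have limY : Y m @[m --> U] --> t.
  pose low m := unormT q m (fdist a w) - unorm q (E m) (fdist a w) - unormT q m (fdist z w).
  have lim_low : low m @[m --> U] --> t.
    have -> : t = s - 0 - (s - t) by rewrite subr0 opprB addrC subrK.
    by apply: cvgB => //; apply: cvgB.
  apply: (squeeze_cvgr _ lim_low lim_az); apply: filterE => m; rewrite YX andbT.
  have h1 := unorm_split q1 Phi0 (E m) (g0 a w).
  have h2 := tri m (~: E m)%SET a z w.
  have h3 := unorm_subT q1 (~: E m)%SET (fdist z w).
  rewrite /low /Y; move: h1 h2 h3; rewrite /unormT; lra.
have limZ : Z m @[m --> U] --> (0 : R).
  move: t0; rewrite le_eqVlt => /orP[/eqP t0|t_gt0].
    apply: (cvg0_le UU (v := X)); first by move=> m; exact: unorm_ge0.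
      by apply: filterE => m; exact: (unorm_subT q1).
    by rewrite t0.
  apply/cvgrPdist_le => e e0.
  have limq : X m `^ q - Y m `^ q @[m --> U] --> (0 : R).
    rewrite -(subrr (t `^ q)); apply: cvgB.
      exact: (@continuous_cvg _ _ _ U _ X (fun x : R => x `^ q) t (powR_continuous t_gt0) lim_az).
    exact: (@continuous_cvg _ _ _ U _ Y (fun x : R => x `^ q) t (powR_continuous t_gt0) limY).
  have eq0 : 0 < e `^ q by rewrite powR_gt0.
  have near_q := (cvgrPdist_le _ _).1 limq _ eq0.
  near=> m.
  have : `|0 - (X m `^ q - Y m `^ q)| <= e `^ q by near: m; exact: near_q.
  rewrite sub0r normrN (unorm_powR_split q1 (E m)) addrK => h.
  rewrite sub0r normrN ger0_norm ?unorm_ge0//.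
  rewrite ger0_norm ?powR_ge0// in h.
  exact: (powR_le_cancel q1 (unorm_ge0 _ _ _) (ltW e0) h).
apply: (cvg0_le UU (v := fun m => Z m + unorm q (E m) (fdist a y))).
- by move=> m; exact: unorm_ge0.
- by apply: filterE => m; rewrite /Z (fam_distC a z); exact: tri.
- by rewrite -[0]addr0; apply: cvgD.
Unshelve. all: by end_near. Qed.

(** The families without concentration form a closed convex part of the limit: it is
    closed because tightness is a closed condition, and convex by the previous lemma
    or, in the Banach case, by linearity. *)
Lemma FSq_space_exists : exists (L0 : kspace R K) (phi0 : families -> L0),
  [/\ FSq q MM L0,
      (forall x, exists2 z, Db false z & phi0 z = x) &
      (forall z w, Db false z -> Db false w ->
         mdist (phi0 z) (phi0 w) = ultra_norm q U (fdist z w))].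
Proof.
have [L [phi [FqL phi_surj phi_dist phi_aff]]] := Fq_space_exists.
have [L0 [phi0 [phi0_surj phi0_dist phi0_aff]]] := ultra_space_exists q1 Phi0 UU oU false y.
exists L0, phi0; split => //.
have [ps psP] : exists ps : L0 -> families, forall x, Db false (ps x) /\ phi0 (ps x) = x.
  apply: (@ex_choice _ _ (fun x z => Db false z /\ phi0 z = x)) => x.
  by have [z Dz zx] := phi0_surj x; exists z.
have psD x := (psP x).1; have psK x := (psP x).2.
pose f x := phi (ps x).
have f_dist x x' : mdist (f x) (f x') = mdist x x'.
  by rewrite (phi_dist _ _ (DbW (psD x)) (DbW (psD x'))) -phi0_dist// !psK.
have fE z : Db false z -> f (phi0 z) = phi z.
  move=> Dz; apply: mdist_positivity; rewrite (phi_dist _ _ (DbW (psD (phi0 z))) (DbW Dz)).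
  by rewrite -(phi0_dist _ _ (psD (phi0 z)) Dz) psK mdistxx.
have rangeP x : range f x <-> exists2 z, Db false z & phi z = x.
  split => [[x0 _ <-]|[z Dz <-]]; first by exists (ps x0).
  by exists (phi0 z) => //; exact: fE.
have Dy : Db false y by exact: (near_base_y y (fn false)).
have [f_aff adm] := induced_affine (fn false) (@DbW false) phi0_aff phi_aff phi0_surj fE.
have f_conv : geodesically_convex (range f).
  move=> x x' c /rangeP[a Da ax] /rangeP[a' Da' ax'] [c0 cd c_dist] t td.
  have [z Dz zt] := phi_surj (c t); apply/rangeP; exists z => //.
  have /andP[t0 tle] := td.
  have d0 : 0 <= mdist x x' := mdist_ge0 x x'.
  have dl : 0 <= (0 : R) <= mdist x x' by rewrite lexx d0.
  have dr : 0 <= mdist x x' <= mdist x x' by rewrite d0 lexx.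
  apply: (between_near_base Da Da' Dz td).
  - rewrite -(phi_dist _ _ (DbW Da) Dz) ax zt -[X in mdist X _]c0 (c_dist _ _ dl td).
    by rewrite sub0r normrN ger0_norm.
  - rewrite -(phi_dist _ _ Dz (DbW Da')) ax' zt -[X in mdist _ X]cd (c_dist _ _ td dr).
    by rewrite distrC ger0_norm// subr_ge0.
  - by rewrite -(phi_dist _ _ (DbW Da) (DbW Da')) ax ax'.
exists L, (range f), f; split => //.
- split.
  + by exists (phi y); apply/rangeP; exists y.
  + move=> x clx; apply/rangeP; have [z Dz zx] := phi_surj x; exists z => //.
    have [z0 zc _] := Dz.
    apply: (ultra_fin_closed q1 Phi0 UU z0 zc) => e e0.
    have [p [/rangeP[w Dw wp] pe]] := clx _ (nbhsx_ballx x e e0).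
    exists (fdist w y), (fdist z w); split => //.
    * by move=> j; exact: fam_dist_ge0.
    * by move=> j; rewrite addrC; exact: fam_dist_tri.
    have := ultra_norm_cvg UU (near_base_dist (fn true) Dz (DbW Dw)).
    rewrite -(phi_dist _ _ Dz (DbW Dw)).
    rewrite zx wp => lim.
    have pe' : mdist x p < e by move: pe; rewrite ballEmdist.
    exact: (cvgr_le _ lim _ pe').
  + exact: adm.
Qed.
End UltraSpaces.

(** * From fibred coarse embeddings to equivariant embeddings *)

Section FolnerSets.
Context (R : realType) (k : nat) (G : nat -> marked_group k) (F : forall i, {fset G i}).

Lemma card_Phi i : #|Phi F i| = (#|` F i| * i.+1)%N.
Proof. by rewrite card_prod card_ord -cardfE. Qed.

Lemma card_escaping i w :
  (#|escaping F i w| <= #|` [fset (ev (G i) w * x)%g | x in F i] `\` F i|%fset * i.+1)%N.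
Proof.
pose B : {set F i} := [set x : F i | (ev (G i) w * val x)%g \notin F i]%SET.
have sub : escaping F i w \subset finset.setX B [set: 'I_i.+1]%SET.
  by apply/fintype.subsetP => -[x l]; rewrite !inE andbT.
apply: leq_trans (subset_leq_card sub) _; rewrite cardsX cardsT card_ord leq_mul2r /=.
pose f (x : F i) : G i := (ev (G i) w * val x)%g.
have f_inj : injective f by move=> x y /mulgI/val_inj.
have -> : #|B| = #|` [fset f x | x in B]%fset|.
  by rewrite card_imfset//= cardE.
apply: fsubset_leq_card; apply/fsubsetP => _ /imfsetP[x /= xB ->].
rewrite in_fsetD; apply/andP; split; first by move: xB; rewrite inE.
by apply/imfsetP; exists (val x) => //=; exact: valP.
Qed.

(** A point escapes when its translate lies in the part of the Folner boundary
    outside the set. *)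
Lemma null_folner (U : set_system nat) {FU : Filter U} : \oo `<=` U ->
  (forall i w, (size w <= i)%N ->
     #|` [fset (ev (G i) w * x)%g | x in F i] `\` F i|%fset%:R <=
       (i.+1%:R)^-1 * #|` F i|%:R :> R) ->
  forall w, null R U false (fun i => escaping F i w).
Proof.
move=> oU fol w e /= e0; apply: oU; near=> i.
have wi : (size w <= i)%N by near: i; exact: nbhs_infty_ge.
have ie : (i.+1%:R)^-1 <= e.
  rewrite -[e]invrK lef_pV2 ?posrE ?invr_gt0 ?ltr0n//.
  apply: (@le_trans _ _ (Num.bound e^-1)%:R).
    by apply/ltW/archi_boundP; rewrite invr_ge0 ltW.
  rewrite ler_nat; apply: leqW; near: i; exact: nbhs_infty_ge.
apply: (@le_trans _ _ (#|` [fset (ev (G i) w * x)%g | x in F i] `\` F i|%fset * i.+1)%:R).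
  by rewrite ler_nat card_escaping.
rewrite card_Phi !natrM mulrA ler_wpM2r ?ler0n//.
by apply: le_trans (fol i w wi) _; rewrite ler_wpM2r ?ler0n.
Unshelve. all: by end_near. Qed.

Lemma null_full (U : set_system nat) {FU : Filter U} :
  (forall i x, x \in F i) -> forall w, null R U true (fun i => escaping F i w).
Proof.
move=> full w e /= e0; apply: filterE => i.
have -> : escaping F i w = finset.set0 by apply/setP => a; rewrite !inE full.
by rewrite cards0 mulr_ge0 ?ler0n.
Qed.

End FolnerSets.

Section PartOne.
Context (R : realType) (K : space_kind) (MM : space_class R K) (k : nat).
Context (G : nat -> marked_group k) (q : R) (q1 : 1 <= q).

(** The class reached by the limit construction: with exhaustive finite sets the
    whole limit of averaged powers carries the action, with Folner sets only the
    part without concentration. *)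
Let limit_class (b : bool) : space_class R K := if b then Fq q MM else FSq q MM.

Lemma limit_CPsharp (b : bool) ro :
  (forall n : nat -> nat, exists F : forall i, {fset G (n i)},
     (forall i, F i != fset0) /\
     forall U : set_system nat, Filter U -> \oo `<=` U ->
       forall w, null R U b (fun i => escaping F i w)) ->
  CPfib MM (cayleys R G) ro ->
  CPsharp_inter (limit_class b) (cay_boundary G) ro.
Proof.
case: ro => rho omega sets [/= rho_c omega_c fib] H [n [n_lt GH]].
have [M [v [u [MMM ls]]]] := local_system_exists (homo_ltn_ge n_lt) fib.
have [F [F0 escaping_null]] := sets n.
have [U [UU oU]] := ultraFilterLemma (F := \oo) _.
have FU : ProperFilter U by exact: ultra_proper.
have Phi_oo : #|Phi F i| @[i --> \oo] --> \oo.
  apply/cvgnyPge => N; near=> i; rewrite card_Phi.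
  apply: (@leq_trans i.+1); first by apply: leqW; near: i; exact: nbhs_infty_ge.
  by rewrite leq_pmull// cardfs_gt0.
have GH' := (cay_cvg_agree _ _).1 GH.
have P0 := Phi_gt0 F0.
split => //=; rewrite /limit_class; case: b sets escaping_null => _ escaping_null.
  have [L [phi [FqL phi_surj phi_dist _]]] :=
    Fq_space_exists q1 P0 Phi_oo UU oU MMM (base (F := F) v).
  have [alpha [y [act bounds]]] := limit_action q1 GH' rho_c omega_c ls F0 UU oU
    (escaping_null U _ oU) phi_surj phi_dist.
  by exists L, alpha, y.
have [L [phi [FqL phi_surj phi_dist]]] :=
  FSq_space_exists q1 P0 Phi_oo UU oU MMM (base (F := F) v).
have [alpha [y [act bounds]]] := limit_action q1 GH' rho_c omega_c ls F0 UU oU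
  (escaping_null U _ oU) phi_surj phi_dist.
by exists L, alpha, y.
Unshelve. all: by end_near. Qed.

Lemma finite_CPsharp : (forall m, finite_group (G m)) ->
  CPfib MM (cayleys R G) `<=` CPsharp_inter (Fq q MM) (cay_boundary G).
Proof.
move=> fin ro; apply: (limit_CPsharp (b := true)) => n.
have full i (x : G (n i)) : x \in fset_set [set: G (n i)].
  by rewrite in_fset_set ?in_setT//; exact: fin.
exists (fun i => fset_set [set: G (n i)]); split => [i|U FU _].
  by apply/fset0Pn; exists 1%g; exact: full.
exact: null_full.
Qed.

Lemma amenable_CPsharp : (forall m, amenable R (G m)) ->
  CPfib MM (cayleys R G) `<=` CPsharp_inter (FSq q MM) (cay_boundary G).
Proof.
move=> am ro; apply: (limit_CPsharp (b := false)) => n.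
have ie i : 0 < (i.+1%:R)^-1 :> R by rewrite invr_gt0 ltr0n.
pose S i := [fset ev (G (n i)) w | w in words k i]%fset.
pose F i := sval (cid (am (n i) (S i) _ (ie i))).
have FP i := svalP (cid (am (n i) (S i) _ (ie i))).
exists F; split => [i|U FU oU]; first exact: (FP i).1.
apply: null_folner => // i w wi.
have wS : ev (G (n i)) w \in S i.
  by apply/imfsetP; exists w => //=; rewrite mem_words.
apply: le_trans ((FP i).2 _ wS) => /=; rewrite ler_nat.
by apply: fsubset_leq_card; exact: fsubsetUl.
Qed.

End PartOne.

Lemma menable_of_sub (R : realType) (K K' : space_kind) (MM : space_class R K)
    (NN : space_class R K') (k : nat) (G : nat -> marked_group k) :
  CPfib MM (cayleys R G) `<=` CPsharp_inter NN (cay_boundary G) ->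
  admits_fibred MM (cayleys R G) -> uniformly_menable NN (cay_boundary G).
Proof.
move=> sub [ro fib]; split; first exact: cay_compact.
by exists ro; exact: sub.
Qed.

Lemma fibred_of_sub (R : realType) (K K' : space_kind) (MM : space_class R K)
    (NN : space_class R K') (k : nat) (G : nat -> marked_group k) :
  CPsharp_inter MM (cay_boundary G) `<=` CPfib NN (cayleys R G) ->
  uniformly_menable MM (cay_boundary G) -> admits_fibred NN (cayleys R G).
Proof. by move=> sub [_ [ro CP]]; exists ro; exact: sub. Qed.

Theorem theorem1 (R : realType) (K : space_kind) (MM : space_class R K)
    (MM_neq0 : exists M, MM M)
    (MM_inhabited : forall M : kspace R K, MM M -> inhabited M)
    (k : nat) (k_ge1 : (1 <= k)%N) (G : nat -> marked_group k) :
  [/\ (* (i)(1) *)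
      (forall m, finite_group (G m)) ->
      forall q : R, 1 <= q ->
        (admits_fibred MM (cayleys R G) ->
           uniformly_menable (Fq q MM) (cay_boundary G)) /\
        CPfib MM (cayleys R G)
          `<=` CPsharp_inter (Fq q MM) (cay_boundary G),
      (* (i)(2) *)
      (forall m, amenable R (G m)) ->
      forall q : R,
        ([/\ 1 < q, FSq_defined q MM &
             forall M : kspace R K, MM M ->
               exists2 L : kspace R K, Fq q (eq M) L & uniquely_geodesic L]
         \/ (K = BanachSpaces /\ 1 <= q)) ->
        (admits_fibred MM (cayleys R G) ->
           uniformly_menable (FSq q MM) (cay_boundary G)) /\
        CPfib MM (cayleys R G)
          `<=` CPsharp_inter (FSq q MM) (cay_boundary G),
      (* (ii) *)
      forall q : R, 1 <= q ->
        (uniformly_menable MM (cay_boundary G) ->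
           admits_fibred (lq_class q MM) (cayleys R G)) /\
        CPsharp_inter MM (cay_boundary G)
          `<=` CPfib (lq_class q MM) (cayleys R G) &
      (* (ii), convergent sequences *)
      forall Ginf : marked_group k, cay_cvg G Ginf ->
        (uniformly_menable MM (cay_boundary G) ->
           admits_fibred MM (cayleys R G)) /\
        (CPsharp_inter MM (cay_boundary G) `<=` CPfib MM (cayleys R G)) /\
        CPsharp MM Ginf `<=` CPfib MM (cayleys R G)].
Proof.
split.
- move=> fin q q1; have sub := finite_CPsharp (MM := MM) q1 fin.
  by split => //; exact: menable_of_sub.
- move=> am q hq.
  have q1 : 1 <= q by case: hq => [[/ltW]|[]].
  have sub := amenable_CPsharp (MM := MM) q1 am.
  by split => //; exact: menable_of_sub.
- move=> q q1; have sub := CPsharp_inter_sub_CPfib (MM := MM) (G := G) q1.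
  by split => //; exact: fibred_of_sub.
- move=> Ginf GG; have sub := CPsharp_sub_CPfib (MM := MM) GG.
  have sub' : CPsharp_inter MM (cay_boundary G) `<=` CPfib MM (cayleys R G).
    by move=> ro CP; apply: sub; apply: CP; exact: cvg_boundary.
  by split; [exact: fibred_of_sub|split].
Qed.
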